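(* Let $H=(h_{i\bar j})$, $h_{i\bar j}=\partial_i\bar\partial_j\Phi$, be a Kähler metric on $\mathbb{C}^n$ with potential $\Phi$, let $\mathcal{A}=C^\infty(\mathbb{C}^n)$, let $\bullet$ be the non-normalized star product on $\mathcal{A}[[\hbar]]$ and $e_\hbar\in\mathcal{A}[[\hbar]]$ its unit (both as in the context). Then the normalized product $$f_1\star f_2=e_\hbar^{-1}\big((f_1e_\hbar)\bullet(f_2e_\hbar)\big)$$ endows $\mathcal{A}[[\hbar]]$ with the structure of an associative algebra over $\mathbb{C}$ with unit the constant function $1$, and for $f_1,f_2\in\mathcal{A}$ $$f_1\star f_2=f_1f_2+\hbar\sum_{i,j=1}^nh^{i\bar j}\,\bar\partial_jf_1\,\partial_if_2+O(\hbar^2).$$ Moreover, the linear functional $\mathrm{tr}:\mathcal{A}_c[[\hbar]]\to\mathbb{C}[\hbar^{-1},\hbar]]$ (formal Laurent series in $\hbar$) given by $$\mathrm{tr}(f)=\int_{\mathbb{C}^n}e_\hbar(z,\bar z)f(z,\bar z)\,d\mu_\hbar(z,\bar z)$$ satisfies $\mathrm{tr}(f_1\star f_2)=\mathrm{tr}(f_2\star f_1)$ for all $f_1,f_2\in\mathcal{A}_c[[\hbar]]$.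
   Context: $\partial_i=\partial/\partial z^i$, $\bar\partial_i=\partial/\partial\bar z^i$, with standard multi-index notation. $\Phi$ is a smooth real function on $\mathbb{C}^n$ with $H=(\partial_i\bar\partial_j\Phi)$ positive definite everywhere; $h^{i\bar j}$ are the entries of the inverse matrix, with the convention $\sum_jh^{i\bar j}h_{k\bar j}=\delta^i_k$. $\mathcal{A}_c\subset\mathcal{A}$ is the space of compactly supported functions. $d\mu_\hbar=\det H\prod_{i=1}^n\frac{|dz^i\wedge d\bar z^i|}{2\pi\hbar}=(\pi\hbar)^{-n}\det H\,d\mathrm{Leb}$; integrals of formal power series in $\hbar$ are taken coefficientwise. **The product $\bullet$.** It is the formal Laplace expansion at $v=z$ of $\int_{\mathbb{C}^n} f_1(z,\bar v)f_2(v,\bar z)e^{\phi(z,\bar z;v,\bar v)/\hbar}d\mu_\hbar(v,\bar v)$, $\phi(z,\bar z;v,\bar v)=\Phi(z,\bar v)+\Phi(v,\bar z)-\Phi(z,\bar z)-\Phi(v,\bar v)$, obtained by substituting $v=z+\epsilon y$, $\epsilon^2=\hbar$. Precisely, fix $z$ and let $E_z$ be the linear functional on polynomials in $y,\bar y$ given by $E_z[y^I\bar y^J]=\partial_u^I\partial_{\bar u}^J\exp\big(\sum_{i,j}h^{i\bar j}(z)u_i\bar u_j\big)\big|_{u=\bar u=0}$ (equivalently, $\frac{\det H(z)}{\pi^n}\int_{\mathbb{C}^n} y^I\bar y^J e^{-\sum h_{i\bar j}(z)y^i\bar y^j}\,d\mathrm{Leb}(y)$). Put $$F_1=\sum_J\tfrac{\epsilon^{|J|}}{J!}\bar\partial^Jf_1(z)\,\bar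 y^J,\qquad F_2=\sum_I\tfrac{\epsilon^{|I|}}{I!}\partial^If_2(z)\,y^I,$$ $$S=-\sum_{|I|,|J|\ge1,\,|I|+|J|\ge3}\tfrac{\epsilon^{|I|+|J|-2}}{I!J!}\partial^I\bar\partial^J\Phi(z)\,y^I\bar y^J,\qquad M=\tfrac1{\det H(z)}\sum_{I,J}\tfrac{\epsilon^{|I|+|J|}}{I!J!}\partial^I\bar\partial^J(\det H)(z)\,y^I\bar y^J.$$ Then $(f_1\bullet f_2)(z):=E_z[F_1F_2\,e^{S}M]$, with $E_z$ applied to each coefficient of $\epsilon^k$; odd powers of $\epsilon$ vanish, and $\epsilon^2=\hbar$. The product is extended to $\mathcal{A}[[\hbar]]$ by $\mathbb{C}[[\hbar]]$-bilinearity. **The unit.** The product $\bullet$ is associative and has a unique two-sided unit $e_\hbar=1+\sum_{l\ge1}\hbar^le^{(l)}\in\mathcal{A}[[\hbar]]$, characterized by $e_\hbar\bullet f=f\bullet e_\hbar=f$ for all $f\in\mathcal{A}$. $e_\hbar^{-1}$ is its inverse for the pointwise product in $\mathcal{A}[[\hbar]]$, and $f_ie_\hbar$ denotes the pointwise product. *)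

(* Defs.v *)
From HB Require Import structures.
From mathcomp Require Import all_boot all_order all_algebra.
From mathcomp Require Import complex.
From mathcomp Require mpoly.
(* The notations of mpoly clash with those of MathComp-Analysis. *)
Import -(notations) mpoly.
From mathcomp Require Import all_classical all_reals all_analysis.
Set Implicit Arguments.
Unset Strict Implicit.
Unset Printing Implicit Defensive.
Import Order.TTheory GRing.Theory Num.Theory.
Import numFieldNormedType.Exports.
Local Open Scope ring_scope.

(* The point (x, y) stands for z = x + i y; as a real normed space this is
   R^n x R^n, so that the library's directional derivatives apply. *)
Notation Cn R n := ('rV[R]_n * 'rV[R]_n)%type.

Definition coord_dir (R : realType) (n : nat) (s : 'I_n + 'I_n) : Cn R n :=
  match s with
  | inl i => (delta_mx 0 i, 0)
  | inr i => (0, delta_mx 0 i)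
  end.

Fixpoint Ck_fun (R : realType) (n k : nat) (f : Cn R n -> R) : Prop :=
  continuous f /\
  if k is k'.+1 then
    forall s : 'I_n + 'I_n,
      (forall z, derivable f z (coord_dir R s)) /\
      Ck_fun k' (fun z => 'D_(coord_dir R s) f z)
  else True.

Definition smooth_real (R : realType) (n : nat) (f : Cn R n -> R) : Prop :=
  forall k, Ck_fun k f.

Definition smooth (R : realType) (n : nat) (f : Cn R n -> R[i]) : Prop :=
  smooth_real (fun z => complex.Re (f z)) /\
  smooth_real (fun z => complex.Im (f z)).

Definition compactly_supported (R : realType) (n : nat) (f : Cn R n -> R[i]) :
    Prop :=
  compact (closure [set z | f z != 0]%classic).

Definition real_partial (R : realType) (n : nat) (s : 'I_n + 'I_n)
    (f : Cn R n -> R[i]) (z : Cn R n) : R[i] :=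
  ('D_(coord_dir R s) (fun w => complex.Re (f w)) z
   +i* 'D_(coord_dir R s) (fun w => complex.Im (f w)) z)%C.

Definition dz (R : realType) (n : nat) (i : 'I_n) (f : Cn R n -> R[i])
    (z : Cn R n) : R[i] :=
  (real_partial (inl i) f z - 'i%C * real_partial (inr i) f z) / 2%:R.

Definition dzbar (R : realType) (n : nat) (i : 'I_n) (f : Cn R n -> R[i])
    (z : Cn R n) : R[i] :=
  (real_partial (inl i) f z + 'i%C * real_partial (inr i) f z) / 2%:R.

Definition dzM (R : realType) (n : nat) (I : multinom n) (f : Cn R n -> R[i]) :
    Cn R n -> R[i] :=
  foldr (fun i g => iter (I i) (@dz R n i) g) f (enum 'I_n).

Definition dzbarM (R : realType) (n : nat) (J : multinom n)
    (f : Cn R n -> R[i]) : Cn R n -> R[i] :=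
  foldr (fun j g => iter (J j) (@dzbar R n j) g) f (enum 'I_n).

Definition cplx_fun (R : realType) (n : nat) (Phi : Cn R n -> R) :
    Cn R n -> R[i] :=
  fun z => (Phi z)%:C%C.

Definition metric (R : realType) (n : nat) (Phi : Cn R n -> R) (z : Cn R n) :
    'M[R[i]]_n :=
  \matrix_(i, j) dz i (dzbar j (cplx_fun Phi)) z.

Definition det_metric (R : realType) (n : nat) (Phi : Cn R n -> R) :
    Cn R n -> R[i] :=
  fun z => \det (metric Phi z).

(* The transpose comes from the convention
   sum_j h^{i jbar} h_{k jbar} = delta^i_k. *)
Definition inv_metric (R : realType) (n : nat) (Phi : Cn R n -> R)
    (z : Cn R n) : 'M[R[i]]_n :=
  invmx (metric Phi z)^T.

(* In R[i], 0 < c means that c is real and positive. *)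
Definition pos_def (R : realType) (n : nat) (A : 'M[R[i]]_n) : Prop :=
  forall v : 'rV[R[i]]_n, v != 0 ->
    0 < \sum_i \sum_j v 0 i * A i j * (v 0 j)^*.

Definition kahler_potential (R : realType) (n : nat) (Phi : Cn R n -> R) :
    Prop :=
  smooth_real Phi /\ forall z, pos_def (metric Phi z).

(* A formal power series is the sequence of its coefficients. *)

Definition fps_mul (A : pzRingType) (a b : nat -> A) : nat -> A :=
  fun k => \sum_(j < k.+1) a j * b (k - j)%N.

Definition fps_one (A : pzRingType) : nat -> A := fun k => (k == 0%N)%:R.

Definition fps_pow (A : pzRingType) (a : nat -> A) (m : nat) : nat -> A :=
  iter m (fps_mul a) (@fps_one A).

(* For a 0 != 0, a^{-1} = sum_m a_0^{-m-1} (a_0 - a)^m; the m-th term has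
   valuation at least m, so that m <= k suffices for the k-th coefficient. *)
Definition fps_inv (K : fieldType) (a : nat -> K) : nat -> K :=
  fun k => \sum_(m < k.+1)
    (a 0%N) ^- m.+1 *
    fps_pow (fun j => (if j == 0%N then a 0%N else 0) - a j) m k.

(* Among the n + n polynomial variables, the first n are the y^i and the last
   n are the ybar^j. *)

Definition yvar (R : realType) (n : nat) (i : 'I_n) : mpoly (n + n) R[i] :=
  mpolyX R[i] (mnm1 (lshift n i)).

Definition ybarvar (R : realType) (n : nat) (j : 'I_n) : mpoly (n + n) R[i] :=
  mpolyX R[i] (mnm1 (rshift n j)).

Definition ymon (R : realType) (n : nat) (I : multinom n) :
    mpoly (n + n) R[i] :=
  \prod_(i < n) yvar R i ^+ I i.

Definition ybarmon (R : realType) (n : nat) (J : multinom n) :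
    mpoly (n + n) R[i] :=
  \prod_(j < n) ybarvar R j ^+ J j.

Definition mfactorial (n : nat) (I : multinom n) : nat :=
  (\prod_(i < n) (I i)`!)%N.

Definition inv_metric_form (R : realType) (n : nat) (Phi : Cn R n -> R)
    (z : Cn R n) : mpoly (n + n) R[i] :=
  \sum_(i < n) \sum_(j < n)
    inv_metric Phi z i j *: (yvar R i * ybarvar R j).

(* d_u^I d_ubar^J exp (sum h^{i jbar} u_i ubar_j) at u = ubar = 0, for
   alpha = (I, J), with u and ubar as independent variables.  The m-th power
   of the form is homogeneous of degree 2m, so that m <= |alpha| suffices. *)
Definition gauss_moment (R : realType) (n : nat) (Phi : Cn R n -> R)
    (z : Cn R n) (alpha : multinom (n + n)) : R[i] :=
  meval (fun=> 0) (mderivm alpha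
    (\sum_(m < (mdeg alpha).+1)
       (m`!%:R)^-1 *: inv_metric_form Phi z ^+ m)).

Definition gauss_E (R : realType) (n : nat) (Phi : Cn R n -> R) (z : Cn R n)
    (p : mpoly (n + n) R[i]) : R[i] :=
  \sum_(alpha <- msupp p) mcoeff alpha p * gauss_moment Phi z alpha.

Definition series_F1 (R : realType) (n : nat) (f1 : Cn R n -> R[i])
    (z : Cn R n) (k : nat) : mpoly (n + n) R[i] :=
  \sum_(J : bmultinom n k.+1 | mdeg J == k)
    ((mfactorial J)%:R^-1 * dzbarM J f1 z) *: ybarmon R J.

Definition series_F2 (R : realType) (n : nat) (f2 : Cn R n -> R[i])
    (z : Cn R n) (k : nat) : mpoly (n + n) R[i] :=
  \sum_(I : bmultinom n k.+1 | mdeg I == k)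
    ((mfactorial I)%:R^-1 * dzM I f2 z) *: ymon R I.

Definition series_S (R : realType) (n : nat) (Phi : Cn R n -> R)
    (z : Cn R n) (k : nat) : mpoly (n + n) R[i] :=
  - \sum_(I : bmultinom n k.+3)
      \sum_(J : bmultinom n k.+3 |
            [&& (1 <= mdeg I)%N, (1 <= mdeg J)%N, (3 <= mdeg I + mdeg J)%N
              & (mdeg I + mdeg J == k.+2)%N])
        ((mfactorial I * mfactorial J)%:R^-1 *
         dzM I (dzbarM J (cplx_fun Phi)) z) *: (ymon R I * ybarmon R J).

(* series_S has no constant term in epsilon, so that its m-th power has
   valuation at least m. *)
Definition series_expS (R : realType) (n : nat) (Phi : Cn R n -> R)
    (z : Cn R n) (k : nat) : mpoly (n + n) R[i] :=
  \sum_(m < k.+1)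
    ((m`!%:R : R[i])^-1) *: fps_pow (series_S Phi z) m k.

Definition series_M (R : realType) (n : nat) (Phi : Cn R n -> R)
    (z : Cn R n) (k : nat) : mpoly (n + n) R[i] :=
  (det_metric Phi z)^-1 *:
  \sum_(I : bmultinom n k.+1)
    \sum_(J : bmultinom n k.+1 | (mdeg I + mdeg J == k)%N)
      ((mfactorial I * mfactorial J)%:R^-1 *
       dzM I (dzbarM J (det_metric Phi)) z) *: (ymon R I * ybarmon R J).

(* The coefficient of hbar^k is that of epsilon^(2k). *)
Definition bullet_fun (R : realType) (n : nat) (Phi : Cn R n -> R)
    (f1 f2 : Cn R n -> R[i]) : nat -> Cn R n -> R[i] :=
  fun k z =>
    gauss_E Phi z
      (fps_mul (fps_mul (fps_mul (series_F1 f1 z) (series_F2 f2 z))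
                        (series_expS Phi z))
               (series_M Phi z) k.*2).

Notation hseries R n := (nat -> Cn R n -> R[i]).

Definition smooth_series (R : realType) (n : nat) (a : hseries R n) : Prop :=
  forall k, smooth (a k).

Definition compact_series (R : realType) (n : nat) (a : hseries R n) : Prop :=
  forall k, smooth (a k) /\ compactly_supported (a k).

Definition hconst (R : realType) (n : nat) (f : Cn R n -> R[i]) : hseries R n :=
  fun k z => if k == 0%N then f z else 0.

Definition hlin (R : realType) (n : nat) (c : R[i]) (a b : hseries R n) :
    hseries R n :=
  fun k z => c * a k z + b k z.

Definition hmul (R : realType) (n : nat) (a b : hseries R n) : hseries R n :=
  fun k z => fps_mul (a^~ z) (b^~ z) k.

Definition hinv (R : realType) (n : nat) (a : hseries R n) : hseries R n :=
  fun k z => fps_inv (a^~ z) k.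

Definition bullet (R : realType) (n : nat) (Phi : Cn R n -> R)
    (a b : hseries R n) : hseries R n :=
  fun k z => \sum_(i < k.+1) \sum_(j < (k - i).+1)
    bullet_fun Phi (a i) (b j) (k - i - j)%N z.

Definition is_bullet_unit (R : realType) (n : nat) (Phi : Cn R n -> R)
    (e : hseries R n) : Prop :=
  smooth_series e /\
  forall f : Cn R n -> R[i], smooth f ->
    bullet Phi e (hconst f) = hconst f /\ bullet Phi (hconst f) e = hconst f.

Definition star (R : realType) (n : nat) (Phi : Cn R n -> R)
    (e a b : hseries R n) : hseries R n :=
  hmul (hinv e) (bullet Phi (hmul a e) (hmul b e)).

Definition is_unital_assoc_algebra (R : realType) (n : nat)
    (A : hseries R n -> Prop) (mul : hseries R n -> hseries R n -> hseries R n)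
    (one : hseries R n) : Prop :=
  [/\ A one /\ (forall a b, A a -> A b -> A (mul a b)),
      forall c a b d, A a -> A b -> A d ->
        mul (hlin c a b) d = hlin c (mul a d) (mul b d),
      forall c a b d, A a -> A b -> A d ->
        mul d (hlin c a b) = hlin c (mul d a) (mul d b),
      forall a b d, A a -> A b -> A d -> mul a (mul b d) = mul (mul a b) d
    & forall a, A a -> mul one a = a /\ mul a one = a].

Fixpoint lebesgue_tuple (R : realType) (m : nat) :
    set (m.-tuple (measurableTypeR R)) -> \bar R :=
  match m with
  | 0%N => \d_([tuple] : 0.-tuple (measurableTypeR R))
  | m'.+1 => fun A =>
      product_measure1 (@lebesgue_measure R) (@lebesgue_tuple R m')
        [set p : measurableTypeR R * m'.-tuple (measurableTypeR R) |
           A (cons_tuple p.1 p.2)]%classic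
  end.

Definition point_of_tuple (R : realType) (n : nat)
    (t : (n + n).-tuple (measurableTypeR R)) : Cn R n :=
  (\row_i tnth t (lshift n i), \row_i tnth t (rshift n i)).

Definition real_integral (R : realType) (n : nat) (g : Cn R n -> R) : R :=
  fine (\int[@lebesgue_tuple R (n + n)]_t (g (point_of_tuple t))%:E)%E.

Definition cplx_integral (R : realType) (n : nat) (f : Cn R n -> R[i]) : R[i] :=
  (real_integral (fun z => complex.Re (f z))
   +i* real_integral (fun z => complex.Im (f z)))%C.

(* tr f m is the coefficient of hbar^m; the volume form is
   (pi hbar)^{-n} det H dLeb. *)
Definition tr (R : realType) (n : nat) (Phi : Cn R n -> R) (e f : hseries R n) :
    int -> R[i] :=
  fun m => match m + n%:Z with
           | Posz k => ((pi : R) ^- n)%:C%C *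
               cplx_integral (fun z => hmul e f k z * det_metric Phi z)
           | Negz _ => 0
           end.

Definition is_laurent (R : realType) (a : int -> R[i]) : Prop :=
  exists N : int, forall m, m < N -> a m = 0.

(* Main.v *)
Require Import Defs.
From HB Require Import structures.
From mathcomp Require Import all_boot all_order all_algebra.
From mathcomp Require Import complex ring.
From mathcomp Require mpoly.
(* The notations of mpoly clash with those of MathComp-Analysis. *)
Import -(notations) mpoly.
From mathcomp Require Import all_classical all_reals all_analysis.
From mathcomp Require Import measurable_realfun.
Set Implicit Arguments.
Unset Strict Implicit.
Unset Printing Implicit Defensive.
Import Order.TTheory GRing.Theory Num.Theory.
Import numFieldNormedType.Exports.
Local Open Scope ring_scope.

(** The product is the Laplace expansion of a Gaussian integral. The argument is algebraic: power
    series in [eps], with [eps] squared equal to hbar, over a commutative ring [A] with commuting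
    derivations in which positive integers are invertible. Smooth functions on C^n form such a ring,
    and [bullet_funE] identifies the given product with the algebraic one, [prodA]. The Gaussian
    functional [wick] is determined by integration by parts ([wick_unique]). Divided by det H it
    becomes integration against exp (- q) with constant normalization, so derivatives in the base
    point pass under the integral sign ([der_nwick], which rests on Jacobi's formula for the
    determinant). Taylor series f (z + a eps y, zbar + b eps ybar) are flows of vector fields, which
    makes translations easy to compose.

    Associativity. Differentiating the integrand in zbar with v = z + eps y fixed shows that left
    multiplication commutes with hbar dbar_j + dbar_j Phi ([eprod_commute]). It is also a formal
    differential operator in the holomorphic derivatives ([holdiff_prodA]). Such an operator, if it
    commutes with multiplication by every dbar_j Phi, is multiplication by a function: the
    commutator contracts the symbol with the invertible matrix H ([jet_kill]). Order by order, this
    applies to c |-> (a . b) . c - a . (b . c), which vanishes on the unit and hence everywhere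
    ([sprodA]). The normalized product is the transport of this product along a |-> a e, so it is
    associative with unit 1.

    First order. Removing the constant terms from the two Taylor series isolates the Gaussian second
    moment h^{i jbar}. What remains is expressed by products with 1, which the first coefficient of
    the unit cancels ([prodA_1], [nstar_cst_1]).

    Trace. Since e (a * b) = (a e) . (b e), where [*] is the normalized product, the trace of a * b
    is formally a double integral over z and v whose exponent is symmetric in the two points.
    Exchanging the points is the translation z |-> z - eps y followed by eps |-> - eps. The
    translation changes the integral over y by a divergence ([translate_divergence]), and even
    orders in [eps] do not see the sign ([prodA_trace]). A divergence with compact support has
    integral zero, by Fubini and the fundamental theorem of calculus ([divergence_supported]). *)

Definition fps (A : Type) : Type := nat -> A.

HB.instance Definition _ (A : zmodType) := GRing.Zmodule.copy (fps A) (nat -> A).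

(** Both sides run over the triples with total k; this is what associativity of the Cauchy product
    amounts to. *)
Lemma sum_ord_triangle (V : nmodType) (F : nat -> nat -> nat -> V) k :
  \sum_(i < k.+1) \sum_(j < i.+1) F j (i - j)%N (k - i)%N =
  \sum_(j < k.+1) \sum_(l < (k - j).+1) F j l (k - j - l)%N.
Proof.
elim: k F => [|k IHk] F; first by rewrite !big_ord1.
have E (j : 'I_k.+1) : \sum_(l < (k.+1 - j).+1) F j l (k.+1 - j - l)%N =
    \sum_(l < (k - j).+1) F j l (k - j - l).+1 + F j (k.+1 - j)%N 0%N.
  rewrite subSn -1?ltnS // big_ord_recr /= subnn; congr (_ + _).
  by apply: eq_bigr => l _; rewrite subSn // -ltnS.
rewrite big_ord_recr [RHS]big_ord_recr /= !subnn big_ord1 /=.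
under [in RHS]eq_bigr => j _ do rewrite E.
rewrite big_split /= -(IHk (fun j l m => F j l m.+1)).
rewrite [X in _ + X = _]big_ord_recr /= subnn.
rewrite -!addrA; congr (_ + _).
by apply: eq_bigr => i _; rewrite subSn // -ltnS.
Qed.

(** * The ring of formal power series in [eps] *)

Section FpsRing.
Variable A : comPzRingType.
Implicit Types a b c : fps A.

Fact fps_mulA : associative (@fps_mul A : fps A -> fps A -> fps A).
Proof.
move=> a b c; apply/funext => k; rewrite /fps_mul.
under eq_bigr do rewrite mulr_sumr.
under [RHS]eq_bigr do rewrite mulr_suml.
rewrite [RHS](sum_ord_triangle (fun j l m => a j * b l * c m)).
by apply: eq_bigr => j _; apply: eq_bigr => l _; rewrite mulrA.
Qed.

Fact fps_mulC : commutative (@fps_mul A : fps A -> fps A -> fps A).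
Proof.
move=> a b; apply/funext => k; rewrite /fps_mul (reindex_inj rev_ord_inj) /=.
apply: eq_bigr => j _; rewrite subSS mulrC subKn //; exact: leq_ord.
Qed.

Fact fps_mul1 : left_id (@fps_one A : fps A) (@fps_mul A : fps A -> fps A -> fps A).
Proof.
move=> a; apply/funext => k.
rewrite /fps_mul big_ord_recl /fps_one /= mul1r subn0 big1 ?addr0 // => i _.
by rewrite mul0r.
Qed.

Fact fps_mulDl :
  left_distributive (@fps_mul A : fps A -> fps A -> fps A) +%R.
Proof.
move=> a b c; apply/funext => k; rewrite /fps_mul -[RHS]big_split /=.
by apply: eq_bigr => j _; rewrite -mulrDl.
Qed.

HB.instance Definition _ := GRing.Zmodule_isComPzRing.Build (fps A)
  fps_mulA fps_mulC fps_mul1 fps_mulDl.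

Lemma fps_mulE a b k : (a * b) k = \sum_(j < k.+1) a j * b (k - j)%N.
Proof. by []. Qed.

Lemma fpsDE a b k : (a + b) k = a k + b k.
Proof. by []. Qed.

Lemma fpsNE a k : (- a) k = - a k.
Proof. by []. Qed.

Lemma fpsMnE a n k : (a *+ n) k = a k *+ n.
Proof. by elim: n => [|n IHn]; rewrite ?mulr0n // !mulrS fpsDE IHn. Qed.

Lemma fpsMzE a (n : int) k : (a *~ n) k = a k *~ n.
Proof. case: n => n; first exact: fpsMnE.
by rewrite -[LHS]/((- (a *+ n.+1)) k) fpsNE fpsMnE. Qed.

Lemma fps_oneE k : (1 : fps A) k = (k == 0%N)%:R.
Proof. by []. Qed.

Lemma fps_powE a m : fps_pow a m = (a ^+ m : fps A).
Proof. by elim: m => //= m IHm; rewrite exprS -IHm. Qed.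

Lemma fps_mul0E a b : (a * b) 0%N = a 0%N * b 0%N.
Proof. by rewrite fps_mulE big_ord1. Qed.

Definition eps : fps A := fun k => (k == 1%N)%:R.

Lemma epsM0 a : (eps * a) 0%N = 0.
Proof. by rewrite fps_mulE big_ord1 /= mul0r. Qed.

Lemma epsMS a k : (eps * a) k.+1 = a k.
Proof.
rewrite fps_mulE big_ord_recl /= mul0r add0r big_ord_recl /= mul1r subSS subn0.
by rewrite big1 ?addr0 // => i _; rewrite mul0r.
Qed.

Lemma epsI : injective ( *%R eps).
Proof. by move=> a b eq_ab; apply/funext => k; rewrite -[LHS]epsMS -[RHS]epsMS eq_ab. Qed.

Definition fcst (x : A) : fps A := fun k => if k == 0%N then x else 0.

Lemma fcstM x a k : (fcst x * a) k = x * a k.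
Proof.
rewrite fps_mulE big_ord_recl subn0 big1 ?addr0 // => i _.
by rewrite mul0r.
Qed.

Lemma eq_fps_mul a a' b b' k : (forall j, (j <= k)%N -> a j = a' j) ->
  (forall j, (j <= k)%N -> b j = b' j) -> (a * b) k = (a' * b') k.
Proof.
move=> ea eb; rewrite !fps_mulE; apply: eq_bigr => j _.
by rewrite ea ?eb ?leq_subr ?leq_ord.
Qed.

Lemma fps_expr_lt a m k : a 0%N = 0 -> (k < m)%N -> (a ^+ m) k = 0.
Proof.
move=> a0; elim: m k => // m IHm k; rewrite ltnS => lekm.
rewrite exprS fps_mulE big_ord_recl a0 mul0r add0r big1 // => i _ /=.
rewrite IHm ?mulr0 //; case: k lekm i => [|k] lekm i; first by case: i.
by rewrite /= /bump /= add1n subSS; apply: leq_trans lekm; rewrite ltnS leq_subr.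
Qed.

Lemma fps_sumE (I : Type) (r : seq I) (P : pred I) (F : I -> fps A) k :
  (\sum_(i <- r | P i) F i) k = \sum_(i <- r | P i) F i k.
Proof. by elim/big_rec2: _ => //= i y x _ <-. Qed.

(** The substitution of [- eps] for [eps]. *)
Definition fsign a : fps A := fun k => (-1) ^+ k * a k.

Lemma fsignM a b : fsign (a * b) = fsign a * fsign b.
Proof.
apply/funext => k; rewrite /fsign !fps_mulE mulr_sumr; apply: eq_bigr => i _.
rewrite mulrACA -exprD subnKC //; exact: leq_ord.
Qed.

Lemma fsignD a b : fsign (a + b) = fsign a + fsign b.
Proof. by apply/funext => k; rewrite /fsign mulrDr. Qed.

Lemma fsignN a : fsign (- a) = - fsign a.
Proof. by apply/funext => k; rewrite /fsign mulrN. Qed.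

Lemma fsign_eps a : fsign (eps * a) = - (eps * fsign a).
Proof.
apply/funext => -[|k]; first by rewrite /fsign opprfctE !epsM0 mulr0 oppr0.
by rewrite /fsign opprfctE !epsMS exprS mulN1r mulNr.
Qed.

Lemma fsign_cst x : fsign (fcst x) = fcst x.
Proof. by apply/funext => -[|k]; rewrite /fsign ?mul1r ?mulr0. Qed.

Definition fder a : fps A := fun k => a k.+1 *+ k.+1.

Lemma fderD a b : fder (a + b) = fder a + fder b.
Proof. by apply/funext => k; rewrite /fder mulrnDl. Qed.

Lemma fderN a : fder (- a) = - fder a.
Proof. by apply/funext => k; rewrite /fder mulNrn. Qed.

Lemma fderM a b : fder (a * b) = fder a * b + a * fder b.
Proof.
apply/funext => k; rewrite /fder fps_mulE -sumrMnl.
have E (j : 'I_k.+2) : a j * b (k.+1 - j)%N *+ k.+1 =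
    (a j *+ j) * b (k.+1 - j)%N + a j * (b (k.+1 - j)%N *+ (k.+1 - j)).
  rewrite mulrnAl mulrnAr -mulrnDr subnKC // -ltnS; exact: ltn_ord.
under eq_bigr => j _ do rewrite E.
rewrite big_split /= big_ord_recl /= mulr0n mul0r add0r.
rewrite [X in _ + X]big_ord_recr /= subnn mulr0n mulr0 addr0.
congr (_ + _).
by apply: eq_bigr => i _; rewrite subSn // -ltnS.
Qed.

Lemma fder_cst x : fder (fcst x) = 0.
Proof. by apply/funext => k; rewrite /fder mul0rn. Qed.

End FpsRing.

(** * Coefficientwise maps and derivations *)

Definition fmap (A B : Type) (M : A -> B) (a : fps A) : fps B := fun k => M (a k).

Definition leibniz (P : pzRingType) (M : P -> P) : Prop :=
  forall x y, M (x * y) = M x * y + x * M y.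

Lemma leibniz1 (P : pzRingType) (M : P -> P) : leibniz M -> M 1 = 0.
Proof.
move=> ML; have := ML 1 1; rewrite !mulr1 mul1r => /eqP.
by rewrite -[X in X == _]addr0 (inj_eq (addrI _)) eq_sym => /eqP.
Qed.

Lemma leibnizX (P : comPzRingType) (M : P -> P) x n : leibniz M ->
  M (x ^+ n) = x ^+ n.-1 * M x *+ n.
Proof.
move=> ML; elim: n => [|n IHn]; first by rewrite expr0 leibniz1.
rewrite exprS ML IHn mulrS mulrC; congr (_ + _) => /=.
by case: n {IHn} => [|n]; rewrite ?mulr0n ?mulr0 //= mulrnAr mulrA -exprS.
Qed.

Lemma fmap_leibniz (P : comPzRingType) (M : {additive P -> P}) :
  leibniz M -> leibniz (fmap M : fps P -> fps P).
Proof.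
move=> ML a b; apply/funext => k.
rewrite /fmap fps_mulE raddf_sum -[RHS]big_split /=; exact: eq_bigr.
Qed.

Section FmapAdditive.
Variables (P Q : comPzRingType) (M : {additive P -> Q}).

Lemma fmapD (a b : fps P) : fmap M (a + b) = fmap M a + fmap M b.
Proof. by apply/funext => k; rewrite /fmap raddfD. Qed.

Lemma fmapN (a : fps P) : fmap M (- a) = - fmap M a.
Proof. by apply/funext => k; rewrite /fmap raddfN. Qed.

Lemma fmapB (a b : fps P) : fmap M (a - b) = fmap M a - fmap M b.
Proof. by rewrite fmapD fmapN. Qed.

Lemma fmap_eps (a : fps P) : fmap M (eps P * a) = eps Q * fmap M a.
Proof.
by apply/funext => -[|k]; rewrite /fmap ?epsM0 ?epsMS // raddf0.
Qed.

Lemma fmap_cst x : fmap M (fcst x) = fcst (M x).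
Proof. by apply/funext => -[|k]; rewrite /fmap /fcst //= raddf0. Qed.

Lemma fmap_fder (a : fps P) : fmap M (fder a) = fder (fmap M a).
Proof. by apply/funext => k; rewrite /fmap /fder raddfMn. Qed.

End FmapAdditive.

(** * Formal exponentials and flows, through differential equations in [eps] *)

Section CharZero.
Variables (A : comUnitRingType) (P : comAlgType A).
Hypothesis natU : forall k, (k.+1%:R : A) \is a GRing.unit.
Implicit Types S U V W : fps P.

Lemma mulrSnI (x y : P) k : x *+ k.+1 = y *+ k.+1 -> x = y.
Proof.
move=> eq_xy; have: k.+1%:R^-1 *: (k.+1%:R *: x) = k.+1%:R^-1 *: (k.+1%:R *: y :> P).
  by rewrite !scaler_nat eq_xy.
by rewrite !scalerA mulVr // !scale1r.
Qed.

Lemma factU k : (k`!%:R : A) \is a GRing.unit.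
Proof. by case: k`! (fact_gt0 k) => // n _; exact: natU. Qed.

Lemma factVS k : (k.+1`!%:R : A)^-1 *+ k.+1 = k`!%:R^-1.
Proof.
rewrite -[LHS]mulr_natr factS natrM invrM ?factU ?natU //.
by rewrite -mulrA mulVr ?natU // mulr1.
Qed.

Lemma raddfZVnat (Q : algType A) (M : {additive P -> Q}) (k : nat) x :
  (k%:R : A) \is a GRing.unit -> M (k%:R^-1 *: x) = k%:R^-1 *: M x.
Proof.
move=> kU; have E: k%:R *: M (k%:R^-1 *: x) = M x.
  by rewrite scaler_nat -raddfMn -scaler_nat scalerA mulrV // scale1r.
by rewrite -[in RHS]E scalerA mulVr // scale1r.
Qed.

Definition causal (F : fps P -> fps P) : Prop :=
  forall U V k, (forall j, (j <= k)%N -> U j = V j) -> F U k = F V k.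

(** Coefficient k+1 of [U] is recovered from coefficient k of [fder U], hence, [F] being causal,
    from the coefficients of [U] up to k. *)
Lemma ode_unique (F : fps P -> fps P) U V : causal F ->
  fder U = F U -> fder V = F V -> U 0%N = V 0%N -> U = V.
Proof.
move=> cF dU dV UV0; apply/funext => k.
elim/ltn_ind: k => -[//|k] IHk; apply: (@mulrSnI _ _ k).
rewrite -[LHS]/(fder U k) -[RHS]/(fder V k) dU dV.
by apply: cF => j lejk; apply: IHk.
Qed.

Lemma causalM B : causal ( *%R B).
Proof. by move=> U V k UV; apply: eq_fps_mul. Qed.

Lemma causal_fmap (M : P -> P) : causal (fmap M).
Proof. by move=> U V k UV; rewrite /fmap UV. Qed.

Lemma causalD F G : causal F -> causal G -> causal (fun U => F U + G U).
Proof. by move=> cF cG U V k UV; rewrite fpsDE (cF U V) ?(cG U V). Qed.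

Lemma causal_const B : causal (fun=> B).
Proof. by []. Qed.

Definition exps S : fps P :=
  fun k => \sum_(m < k.+1) (m`!%:R : A)^-1 *: (S ^+ m) k.

Lemma exps_trunc S n k : S 0%N = 0 -> (k < n)%N ->
  exps S k = \sum_(m < n) (m`!%:R : A)^-1 *: (S ^+ m) k.
Proof.
move=> S0 ltkn; rewrite /exps (big_ord_widen n (fun m => (m`!%:R : A)^-1 *: (S ^+ m) k)) //.
rewrite big_mkcond; apply: eq_bigr => i _; case: ifPn => //.
by rewrite -leqNgt => ltki; rewrite fps_expr_lt ?scaler0.
Qed.

Lemma exps0E S : exps S 0%N = 1.
Proof. by rewrite /exps big_ord1 invr1 scale1r. Qed.

Lemma fder_exps S : S 0%N = 0 -> fder (exps S) = fder S * exps S.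
Proof.
move=> S0; apply/funext => k; rewrite /fder /exps -sumrMnl.
rewrite big_ord_recl /= expr0 fps_oneE /= scaler0 mul0rn add0r.
under eq_bigr => m _.
  rewrite /= scalerMnr -[_ *+ k.+1]/(fder (S ^+ m.+1) k) (leibnizX _ _ (@fderM P)) natmulfctE /=.
  rewrite -scalerMnr scalerMnl factVS; over.
rewrite mulrC fps_mulE.
under eq_bigr do rewrite fps_mulE scaler_sumr.
rewrite exchange_big /=; apply: eq_bigr => j _.
rewrite -/(exps S j) (exps_trunc S0 (ltn_ord j)) mulr_suml.
by apply: eq_bigr => m _; rewrite scalerAl.
Qed.

(** The tool for recognizing an exponential: U' = S' U with initial value 1 has a single
    solution. *)
Lemma expsP S U : S 0%N = 0 -> U 0%N = 1 -> fder U = fder S * U -> U = exps S.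
Proof.
move=> S0 U0 dU; apply: (ode_unique (F := *%R (fder S))) => //.
- exact: causalM.
- exact: fder_exps.
- by rewrite exps0E.
Qed.

Lemma expsD S U : S 0%N = 0 -> U 0%N = 0 -> exps (S + U) = exps S * exps U.
Proof.
move=> S0 U0; apply/esym/expsP.
- by rewrite fpsDE S0 U0 addr0.
- by rewrite fps_mul0E !exps0E mulr1.
- by rewrite fderM !fder_exps // fderD mulrDl !mulrA [_ * fder U]mulrC.
Qed.

Lemma fsignX S m : fsign (S ^+ m) = fsign S ^+ m.
Proof.
elim: m => [|m IHm]; last by rewrite !exprS fsignM IHm.
by apply/funext => -[|k]; rewrite !expr0 /fsign fps_oneE ?mulr1 ?mulr0.
Qed.

Lemma fsign_exps S : fsign (exps S) = exps (fsign S).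
Proof.
apply: funext => k; rewrite /fsign /exps mulr_sumr.
apply: eq_bigr => m _; rewrite -scalerAr; congr (_ *: _).
by rewrite -[LHS]/(fsign (S ^+ m) k) fsignX.
Qed.

(** Both sides solve one linear differential equation in [eps] with initial value 0. *)
Lemma fmap_exps (M : {additive P -> P}) S : leibniz M -> S 0%N = 0 ->
  fmap M (exps S) = fmap M S * exps S.
Proof.
move=> ML S0; have fML := fmap_leibniz ML.
apply: (ode_unique (F := fun U => fmap M (fder S) * exps S + fder S * U)).
- by apply: causalD; [exact: causal_const|exact: causalM].
- by rewrite -fmap_fder fder_exps // fML.
- by rewrite fderM fder_exps // -fmap_fder; congr (_ + _); rewrite mulrCA.
- by rewrite fps_mul0E /fmap exps0E S0 leibniz1 // raddf0 mul0r.
Qed.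

Section Expo.
Variable L : {additive P -> P}.

Lemma iter_raddf0 j : iter j L 0 = 0.
Proof. by elim: j => //= j ->; rewrite raddf0. Qed.

Lemma iter_raddfD j x y : iter j L (x + y) = iter j L x + iter j L y.
Proof. by elim: j => //= j ->; rewrite raddfD. Qed.

Lemma iter_raddfMn j x n : iter j L (x *+ n) = iter j L x *+ n.
Proof. by elim: j => //= j ->; rewrite raddfMn. Qed.

(* The flow exp(eps L), extended coefficientwise to power series. *)
Definition expo W : fps P :=
  fun k => \sum_(j < k.+1) (j`!%:R : A)^-1 *: iter j L (W (k - j)%N).

Lemma expo0E W : expo W 0%N = W 0%N.
Proof. by rewrite /expo big_ord1 invr1 scale1r. Qed.

Lemma expo_cstE x k : expo (fcst x) k = (k`!%:R : A)^-1 *: iter k L x.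
Proof.
rewrite /expo big_ord_recr /= subnn /fcst /= big1 ?add0r // => i _.
by rewrite subn_eq0 leqNgt ltn_ord /= iter_raddf0 scaler0.
Qed.

Lemma fder_expo W : fder (expo W) = fmap L (expo W) + expo (fder W).
Proof.
apply/funext => k; rewrite fpsDE /fmap /expo raddf_sum /fder -sumrMnl.
have E (j : 'I_k.+2) :
    (j`!%:R : A)^-1 *: iter j L (W (k.+1 - j)%N) *+ k.+1 =
    (j`!%:R : A)^-1 *: iter j L (W (k.+1 - j)%N) *+ j +
    (j`!%:R : A)^-1 *: iter j L (W (k.+1 - j)%N) *+ (k.+1 - j).
  by rewrite -mulrnDr subnKC // -ltnS; exact: ltn_ord.
under eq_bigr => j _ do rewrite E.
rewrite big_split /= big_ord_recl /= mulr0n add0r.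
rewrite [X in _ + X]big_ord_recr /= subnn mulr0n addr0.
congr (_ + _); apply: eq_bigr => i _.
  by rewrite /= /bump /= add1n subSS raddfZVnat ?factU // scalerMnl factVS.
by rewrite subSn -1?ltnS ?ltn_ord //= scalerMnr iter_raddfMn.
Qed.

Lemma expoD V W : expo (V + W) = expo V + expo W.
Proof.
apply/funext => k; rewrite -[RHS]/(expo V k + expo W k) /expo -big_split /=.
by apply: eq_bigr => j _; rewrite -scalerDr -iter_raddfD.
Qed.

Lemma expo0 : expo 0 = 0.
Proof.
by apply/funext => k; rewrite /expo big1 // => j _; rewrite iter_raddf0 scaler0.
Qed.

Lemma expoN W : expo (- W) = - expo W.
Proof. by apply/eqP; rewrite -addr_eq0 -expoD addNr expo0. Qed.

Lemma expo_eps W : expo (eps P * W) = eps P * expo W.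
Proof.
apply/funext => -[|k]; first by rewrite expo0E !epsM0.
rewrite epsMS /expo big_ord_recr /= subnn epsM0 iter_raddf0 raddf0 scaler0 addr0.
by apply: eq_bigr => j _; rewrite subSn ?epsMS // -ltnS.
Qed.

Lemma fmap_expo (M : {additive P -> P}) W : (forall x, M (L x) = L (M x)) ->
  fmap M (expo W) = expo (fmap M W).
Proof.
move=> ML; apply/funext => k; rewrite /fmap /expo raddf_sum /=.
apply: eq_bigr => j _; rewrite raddfZVnat ?factU //; congr (_ *: _).
by elim: (j : nat) (W _) => //= i IHi x; rewrite ML IHi.
Qed.

(** The flow of a derivation is multiplicative because both sides obey the same differential
    equation. The induction must range over all [V] and [W], since the equation brings in the flows
    of their [eps]-derivatives. *)
Lemma expoM V W : leibniz L -> expo (V * W) = expo V * expo W.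
Proof.
move=> LL; have fL := fmap_leibniz LL.
apply/funext => k; elim/ltn_ind: k V W => -[|k] IHk V W.
  by rewrite expo0E !fps_mul0E !expo0E.
apply: (@mulrSnI _ _ k).
rewrite -[LHS]/(fder (expo (V * W)) k) -[RHS]/(fder (expo V * expo W) k).
rewrite fder_expo fderM (fderM (expo V)) !fder_expo expoD !fpsDE !IHk //.
rewrite [fmap _ _ k](_ : _ = fmap L (expo V * expo W) k); last by rewrite /fmap IHk.
rewrite fL !mulrDl !mulrDr !fpsDE -!addrA; congr (_ + _).
by rewrite addrCA.
Qed.

Lemma expo_exps S : leibniz L -> S 0%N = 0 -> expo (exps S) = exps (expo S).
Proof.
move=> LL S0; apply: expsP; first by rewrite expo0E.
  by rewrite expo0E exps0E.
rewrite fder_expo fder_exps // fmap_expo // fmap_exps // !expoM // -fmap_expo //.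
by rewrite -mulrDl -fder_expo.
Qed.

End Expo.

(** For commuting operators exp (eps L) exp (eps L') = exp (eps (L + L')), again by comparing
    [eps]-derivatives. *)
Lemma expo_comp (L L' M : {additive P -> P}) W : (forall x, L (L' x) = L' (L x)) ->
  (forall x, M x = L x + L' x) -> expo L (expo L' W) = expo M W.
Proof.
move=> LL' ML; apply/funext => k; elim/ltn_ind: k W => -[|k] IHk W.
  by rewrite !expo0E.
apply: (@mulrSnI _ _ k).
rewrite -[LHS]/(fder (expo L (expo L' W)) k) -[RHS]/(fder (expo M W) k).
rewrite !fder_expo expoD -fmap_expo; last by move=> x; rewrite LL'.
by rewrite !fpsDE /fmap ML IHk // IHk // addrA.
Qed.

Lemma fsign_expo (L M : {additive P -> P}) x : (forall x, M x = - L x) ->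
  fsign (expo L (fcst x)) = expo M (fcst x).
Proof.
move=> ML; apply/funext => k; rewrite /fsign !expo_cstE -scalerAr.
congr (_ *: _); elim: k => [|k IHk] /=; first by rewrite mul1r.
rewrite ML -IHk exprS -mulrA mulN1r; congr (- _).
by rewrite -[in LHS]signr_odd -[in RHS]signr_odd; case: odd; rewrite ?mulN1r ?mul1r // raddfN.
Qed.

Lemma expo_id (L : {additive P -> P}) W : (forall x, L x = 0) -> expo L W = W.
Proof.
move=> L0; apply/funext => k; rewrite /expo big_ord_recl /= invr1 scale1r subn0.
by rewrite big1 ?addr0 // => i _; rewrite L0 scaler0.
Qed.

End CharZero.

(** * Polynomials in the fibre variables y, and derivations of their coefficients *)

Section MpolyComplements.
Variables (m : nat) (A : comNzRingType).
Implicit Types (p : mpoly m A) (al : multinom m).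

Lemma mcoeffXUM s p al :
  mcoeff al (mpolyX A (mnm1 s) * p) =
  if al s == 0%N then 0 else mcoeff (mnm_sub al (mnm1 s)) p.
Proof.
rewrite mulrC; case: ifPn => [/eqP als|].
  apply: memN_msupp_eq0; rewrite (perm_mem (msuppMX _ _)); apply/negP.
  by case/mapP => be _ eal; move: als; rewrite eal mnmDE mnm1E eqxx.
by rewrite -lep1mP => les; rewrite -[in LHS](submK les) addmC mcoeffMX.
Qed.

Lemma mpoly_monE (p : mpoly m A) : p = \sum_(al <- msupp p) mcoeff al p *: mpolyX A al.
Proof. exact: mpolyE. Qed.

Lemma mpoly_lin_ind (G : mpoly m A -> Prop) : G 0 ->
  (forall p q, G p -> G q -> G (p + q)) ->
  (forall a al, G (a *: mpolyX A al)) -> forall p, G p.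
Proof.
by move=> G0 GD GX p; rewrite [p]mpolyE; elim/big_ind: _ => // al _; exact: GX.
Qed.

End MpolyComplements.

Section CoefDerivation.
Variables (m : nat) (A : comNzRingType) (d : {additive A -> A}).
Hypothesis dL : leibniz d.
Implicit Types p q : mpoly m A.

(** Differentiation in the base point with the fibre variables y held constant. *)
Definition cder : mpoly m A -> mpoly m A := map_mpoly d.
HB.instance Definition _ := GRing.Additive.on cder.

Lemma mcoeff_cder al p : mcoeff al (cder p) = d (mcoeff al p).
Proof. exact: mcoeff_map_mpoly. Qed.

Lemma cderC a : cder (mpolyC m a) = mpolyC m (d a).
Proof. exact: map_mpolyC. Qed.

Lemma cderZ a p : cder (a *: p) = d a *: p + a *: cder p.
Proof.
by apply/mpolyP => al; rewrite mcoeffD !(mcoeffZ, mcoeff_cder) dL.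
Qed.

Lemma cderX al : cder (mpolyX A al) = 0.
Proof.
apply/mpolyP => be; rewrite mcoeff_cder mcoeffX mcoeff0.
by case: eqP => _; rewrite ?leibniz1 ?raddf0.
Qed.

Lemma cderXM al p : cder (mpolyX A al * p) = mpolyX A al * cder p.
Proof.
apply/mpolyP => be; rewrite mcoeff_cder [_ * p]mulrC [_ * cder p]mulrC.
have [le|nle] := boolP (mpoly.lem al be).
  by rewrite -(submK le) addmC !mcoeffMX mcoeff_cder.
have N q : be \notin msupp (q * mpolyX A al).
  rewrite (perm_mem (msuppMX _ _)); apply: contra nle => /mapP[ga _ ->].
  exact: lem_addr.
by rewrite !memN_msupp_eq0 ?raddf0.
Qed.

Lemma cder_leibniz : leibniz cder.
Proof.
move=> p q; elim/mpoly_lin_ind: p => [|p p' IHp IHp'|a al].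
- by rewrite mul0r raddf0 !mul0r addr0.
- by rewrite mulrDl !raddfD /= IHp IHp' !mulrDl addrACA.
- by rewrite -scalerAl !cderZ cderXM cderX scaler0 addr0 !scalerAl.
Qed.

Lemma cder_mderiv s p : cder (mderiv s p) = mderiv s (cder p).
Proof.
by apply/mpolyP => al; rewrite mcoeff_cder !mcoeff_mderiv mcoeff_cder raddfMn.
Qed.

End CoefDerivation.

Lemma cder_comm (m : nat) (A : comNzRingType) (d d' : {additive A -> A}) (p : mpoly m A) :
  (forall x, d (d' x) = d' (d x)) -> cder d (cder d' p) = cder d' (cder d p).
Proof. by move=> dd; apply/mpolyP => al; rewrite !mcoeff_cder dd. Qed.

(** * The formal Gaussian integral: moments, integration by parts, dependence on parameters *)

Section Gaussian.
Variables (m : nat) (A : comUnitRingType).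
Hypothesis natU : forall k, (k.+1%:R : A) \is a GRing.unit.
Local Notation P := (mpoly m A).
Local Notation "''y_' s" := (mpolyX A (mnm1 s)) (at level 8, s at level 2).
Variables (g gi : 'M[A]_m) (Q q : P).
Hypothesis gig : gi *m g = 1%:M.
Hypothesis Qhomog : Q \is @ishomog1 m A 2 mdeg.
Hypothesis dQ : forall s, mderiv s Q = \sum_t gi s t *: 'y_t.
Hypothesis dq : forall s, mderiv s q = \sum_t g s t *: 'y_t.
Implicit Types (p : P) (al be : multinom m).

Let ggi : g *m gi = 1%:M. Proof. exact: mulmx1C. Qed.

Definition mfact al : nat := (\prod_(i < m) (al i)`!)%N.

Definition expQ (N : nat) : P := \sum_(k < N.+1) (k`!%:R)^-1 *: Q ^+ k.

(** The derivative of order [al] of exp Q at the origin. Cutting the exponential at [mdeg al] is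
    harmless, since Q is homogeneous of degree 2. *)
Definition wick_moment al : A := (mfact al)%:R * mcoeff al (expQ (mdeg al)).

Definition wick p : A := \sum_(al <- msupp p) mcoeff al p * wick_moment al.

Lemma mcoeff_expQ N al : (mdeg al <= N)%N ->
  mcoeff al (expQ N) = mcoeff al (expQ (mdeg al)).
Proof.
move=> leN; rewrite /expQ !raddf_sum /=.
rewrite [RHS](big_ord_widen N.+1 (fun k => mcoeff al (k`!%:R^-1 *: Q ^+ k))) //.
rewrite [RHS]big_mkcond; apply: eq_bigr => k _; case: ifPn => //.
rewrite -leqNgt => ltk; rewrite mcoeffZ.
rewrite (dhomog_nemf_coeff (dhomogMn k Qhomog)) ?mulr0 //=.
by rewrite neq_ltn (leq_trans ltk) // leq_pmull.
Qed.

Lemma mderiv_expQ s N : mderiv s (expQ N.+1) = mderiv s Q * expQ N.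
Proof.
rewrite /expQ raddf_sum big_ord_recl /= linearZ /= expr0 -mpolyC1 mderivC.
rewrite scaler0 add0r mulr_sumr; apply: eq_bigr => k _.
rewrite linearZ /= (leibnizX _ _ (@mderivM m A s)) -scaler_nat scalerA.
rewrite mulr_natr factVS //= mulrC.
by rewrite -scalerAr.
Qed.

Lemma mfactU al s : mfact (mnm_add al (mnm1 s)) = ((al s).+1 * mfact al)%N.
Proof.
rewrite /mfact (bigD1 s) //= [in RHS](bigD1 s) //= mulnA; congr (_ * _)%N.
  by rewrite mnmDE mnm1E eqxx addn1 factS.
by apply: eq_bigr => i nis; rewrite mnmDE mnm1E eq_sym (negbTE nis) addn0.
Qed.

(** Read off from d_s exp Q = (d_s Q) exp Q, where d_s Q is the linear form given by row s of
    [gi]. *)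
Lemma wick_momentU al s : wick_moment (mnm_add al (mnm1 s)) =
  \sum_t gi s t * ((al t)%:R * wick_moment (mnm_sub al (mnm1 t))).
Proof.
rewrite /wick_moment mfactU mulnC natrM -mulrA [X in _ * X]mulr_natl -mcoeff_mderiv.
rewrite mdegD mdeg1 addn1 mderiv_expQ dQ mulr_suml raddf_sum mulr_sumr /=.
apply: eq_bigr => t _; rewrite -scalerAl mcoeffZ mcoeffXUM.
rewrite mulrCA; congr (_ * _); case: ifPn => [/eqP ->|altn0].
  by rewrite mulr0 mul0r.
have le: mpoly.lem (mnm1 t) al by rewrite lep1mP.
have eal := submK le.
rewrite mcoeff_expQ ?mdegB // mulrA; congr (_ * _).
rewrite -[in LHS]eal mfactU natrM mnmBE mnm1E eqxx subn1 prednK //.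
by rewrite lt0n.
Qed.

Lemma wickwE N p : (msize p <= N)%N ->
  wick p = \sum_(al : bmultinom m N) mcoeff al p * wick_moment al.
Proof.
pose I : subFinType _ := bmultinom m N.
move=> le_pN; rewrite /wick (ssrcomplements.big_mksub I) /=; first last.
- by move=> al /msize_mdeg_lt/leq_trans/(_ le_pN).
- exact: msupp_uniq.
by rewrite big_rmcond //= => al /memN_msupp_eq0 ->; rewrite mul0r.
Qed.

Fact wick_is_scalar : scalar wick.
Proof.
move=> a p p'; pose N := maxn (msize (a *: p + p')) (maxn (msize p) (msize p')).
have [l1 l2 l3] : [/\ msize (a *: p + p') <= N, msize p <= N & msize p' <= N]%N.
  by rewrite /N !leq_max !leqnn !orbT.
rewrite (wickwE l1) (wickwE l2) (wickwE l3) mulr_sumr -big_split /=.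
by apply: eq_bigr => al _; rewrite mcoeffD mcoeffZ mulrDl -mulrA.
Qed.

HB.instance Definition _ := GRing.isLinear.Build A P A *%R wick wick_is_scalar.

Lemma wickZ a p : wick (a *: p) = a * wick p.
Proof. exact: linearZ. Qed.

Lemma wickX al : wick (mpolyX A al) = wick_moment al.
Proof. by rewrite /wick msuppX big_seq1 mcoeffX eqxx mul1r. Qed.

Lemma wick1 : wick 1 = 1.
Proof.
rewrite -mpolyX0 wickX /wick_moment mdeg0 /expQ big_ord1 expr0 invr1 scale1r.
by rewrite mcoeff1 eqxx mulr1 /mfact big1 // => i _; rewrite mnm0E.
Qed.

(* Integration by parts against the Gaussian weight exp (- q). *)
Lemma wick_Xmul s p : wick ('y_s * p) = \sum_t gi s t * wick (mderiv t p).
Proof.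
elim/mpoly_lin_ind: p => [|p p' IHp IHp'|a al].
- rewrite mulr0 raddf0 big1 // => t _; by rewrite !raddf0 mulr0.
- rewrite mulrDr raddfD /= IHp IHp' -big_split; apply: eq_bigr => t _ /=.
  by rewrite !raddfD mulrDr.
- rewrite -scalerAr wickZ -mpolyXD addmC wickX wick_momentU mulr_sumr.
  apply: eq_bigr => t _.
  by rewrite linearZ /= mderivX scalerA wickZ wickX mulrCA !mulrA.
Qed.

Lemma wick_mderiv s p : wick (mderiv s p) = \sum_t g s t * wick ('y_t * p).
Proof.
under eq_bigr do rewrite wick_Xmul mulr_sumr.
rewrite exchange_big /=.
have E u : \sum_t g s t * (gi t u * wick (mderiv u p)) =
   (s == u)%:R * wick (mderiv u p).
  under eq_bigr do rewrite mulrA.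
  rewrite -mulr_suml; congr (_ * _).
  by have /matrixP/(_ s u) := ggi; rewrite !mxE.
under eq_bigr do rewrite E.
rewrite (bigD1 s) //= eqxx mul1r big1 ?addr0 // => u us.
by rewrite eq_sym (negbTE us) mul0r.
Qed.

(** Inverting the integration by parts relation with [gi] expresses [G] on a multiple of y_s by [G]
    on derivatives of lower degree, so induction on the degree reduces every value to [G 1]. *)
Lemma wick_unique (G : P -> A) :
  (forall a p p', G (a *: p + p') = a * G p + G p') ->
  (forall s p, G (mderiv s p) = \sum_t g s t * G ('y_t * p)) ->
  G 1 = 0 -> forall p, G p = 0.
Proof.
move=> Glin Gd G1.
have G0 : G 0 = 0 by have := Glin (-1) 0 0; rewrite scaler0 addr0 mulN1r addNr.
have GZ a p : G (a *: p) = a * G p by rewrite -[a *: p]addr0 Glin G0 addr0.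
have GD p p' : G (p + p') = G p + G p' by rewrite -[p]scale1r Glin mul1r scale1r.
have GX s p : G ('y_s * p) = \sum_t gi s t * G (mderiv t p).
  under eq_bigr do rewrite Gd mulr_sumr.
  rewrite exchange_big /=.
  have E u : \sum_t gi s t * (g t u * G ('y_u * p)) = (s == u)%:R * G ('y_u * p).
    under eq_bigr do rewrite mulrA.
    rewrite -mulr_suml; congr (_ * _).
    by have /matrixP/(_ s u) := gig; rewrite !mxE.
  under eq_bigr do rewrite E.
  rewrite (bigD1 s) //= eqxx mul1r big1 ?addr0 // => u us.
  by rewrite eq_sym (negbTE us) mul0r.
have Gmon n al : (mdeg al < n)%N -> G (mpolyX A al) = 0.
  elim: n al => // n IHn al; rewrite ltnS => leal.
  have [al0|] := eqVneq (mdeg al) 0%N.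
    have /eqP -> : al == mnm0 by rewrite -mdeg_eq0 al0.
    by rewrite mpolyX0.
  rewrite mdegE sum_nat_eq0 negb_forall => /existsP[/= s als].
  have le: mpoly.lem (mnm1 s) al by rewrite lep1mP.
  have := submK le; move: (mnm_sub al _) => be eal.
  have ltbe : (mdeg be < n)%N.
    by move: leal; rewrite -eal mdegD mdeg1 addn1.
  rewrite -eal addmC mpolyXD GX big1 // => t _.
  by rewrite mderivX GZ IHn ?mulr0 //; apply: leq_ltn_trans ltbe; exact: mdegB.
elim/mpoly_lin_ind => [|p p' Gp Gp'|a al]; first exact: G0.
  by rewrite GD Gp Gp' addr0.
by rewrite GZ (Gmon (mdeg al).+1) // mulr0.
Qed.

Section MovingGaussian.
Variables (d : {additive A -> A}) (N0 : A).
Hypothesis dL : leibniz d.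
Hypothesis N0U : N0 \is a GRing.unit.
Hypothesis dN0 : d N0 = N0 * wick (cder d q).

(* The weight [N0^-1 * exp (- q)] is transported by [d]. *)
Lemma der_wick p :
  d (N0^-1 * wick p) = N0^-1 * wick (cder d p - cder d q * p).
Proof.
have dV : d N0^-1 = - N0^-1 * wick (cder d q).
  have := leibniz1 dL; rewrite -(mulVr N0U) dL dN0 mulrA mulVr // mul1r.
  move/eqP; rewrite addr_eq0 => /eqP E.
  by rewrite -[LHS](mulrK N0U) E mulNr mulrC mulNr.
pose E p := N0^-1 * wick p.
have Elin a p1 p2 : E (a *: p1 + p2) = a * E p1 + E p2.
  by rewrite /E linearP /= mulrDr mulrCA.
have ED p1 p2 : E (p1 + p2) = E p1 + E p2 by rewrite /E raddfD mulrDr.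
have EN p1 : E (- p1) = - E p1 by rewrite /E raddfN mulrN.
have EZ a p1 : E (a *: p1) = a * E p1 by rewrite /E wickZ mulrCA.
have Ed s p1 : E (mderiv s p1) = \sum_t g s t * E ('y_t * p1).
  by rewrite /E wick_mderiv mulr_sumr; apply: eq_bigr => t _; rewrite mulrCA.
(* The defect in the claimed formula, as a functional of p, satisfies integration by parts. It
   vanishes at 1 by the assumption on the logarithmic derivative of [N0], so uniqueness of the
   Gaussian functional applies. *)
suff: d (E p) - E (cder d p) + E (cder d q * p) = 0.
  move=> H; apply/eqP; rewrite -subr_eq0 -[X in _ - X]/(E _) ED EN opprD opprK.
  by rewrite addrA H.
move: p; apply: wick_unique.
- move=> a p1 p2; rewrite Elin raddfD /= dL raddfD /= cderZ // !ED !EZ.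
  rewrite mulrDr ED -scalerAr EZ; ring.
- move=> s p1.
  have D : mderiv s (cder d q) = \sum_t d (g s t) *: 'y_t.
    rewrite -cder_mderiv dq raddf_sum; apply: eq_bigr => t _ /=.
    by rewrite cderZ // cderX // scaler0 addr0.
  have D' : \sum_t d (g s t) *: ('y_t * p1) = mderiv s (cder d q) * p1.
    by rewrite D mulr_suml; apply: eq_bigr => t _; rewrite scalerAl.
  have -> : cder d q * mderiv s p1 =
      mderiv s (cder d q * p1) - \sum_t d (g s t) *: ('y_t * p1).
    by rewrite mderivM D' addrC addKr.
  rewrite cder_mderiv.
  rewrite ED EN !Ed raddf_sum /=.
  have ES (F : 'I_m -> P) : E (\sum_t F t) = \sum_t E (F t).
    by rewrite /E raddf_sum mulr_sumr.
  rewrite ES -!sumrB -!big_split /=; apply: eq_bigr => t _.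
  rewrite dL EZ cderXM //.
  rewrite [cder d q * ('y_t * p1)]mulrCA; ring.
- rewrite mulr1 leibniz1 ?raddf0; last exact: cder_leibniz.
  by rewrite /E wick1 mulr1 dV raddf0 mulr0 subr0 mulNr addNr.
Qed.

End MovingGaussian.
End Gaussian.

(** * Jacobi's formula for the derivative of a determinant *)

Section Jacobi.
Variables (A : comUnitRingType) (d : {additive A -> A}).
Hypothesis dL : leibniz d.

Lemma leibniz_prod (I : finType) (F : I -> A) :
  d (\prod_i F i) = \sum_i d (F i) * \prod_(j | j != i) F j.
Proof.
suff E (r : seq I) : uniq r -> d (\prod_(i <- r) F i) =
    \sum_(i <- r) d (F i) * \prod_(j <- r | j != i) F j.
  exact: E (index_enum_uniq I).
elim: r => [_|i r IHr /= /andP[ir ur]]; first by rewrite !big_nil leibniz1.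
rewrite !big_cons dL IHr // eqxx /= mulr_sumr; congr (_ * _ + _).
  rewrite [RHS]big_seq_cond [LHS]big_seq; apply: eq_bigl => j.
  by rewrite andbC; case: eqVneq => [->|]; rewrite ?(negbTE ir) ?andbT //= andbT.
rewrite big_seq [RHS]big_seq; apply: eq_bigr => j jr; rewrite big_cons.
have -> : i != j by apply: contraNneq ir => ->.
by rewrite mulrCA.
Qed.

(** The determinant is differentiated one row at a time: [M i] has its row i differentiated, and
    expanding along that row leaves the cofactors of [h]. *)
Lemma der_det (k : nat) (h : 'M[A]_k) :
  d (\det h) = \sum_i \sum_j d (h i j) * cofactor h i j.
Proof.
pose M i := \matrix_(k, l) if k == i then d (h i l) else h k l.
have cofM i j : cofactor (M i) i j = cofactor h i j.
  rewrite /cofactor; congr (_ * \det _); apply/matrixP => a b; rewrite !mxE.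
  by rewrite eq_sym (negbTE (neq_lift _ _)).
have dsgn (b : bool) : d ((-1) ^+ b) = 0.
  by case: b; rewrite ?expr0 ?expr1 ?raddfN /= leibniz1 ?oppr0.
transitivity (\sum_i \det (M i)).
  rewrite /determinant raddf_sum exchange_big /=; apply: eq_bigr => s _.
  rewrite -mulr_sumr dL dsgn mul0r add0r leibniz_prod; congr (_ * _); apply: eq_bigr => i _.
  rewrite [RHS](bigD1 i) //= mxE eqxx; congr (_ * _); apply: eq_bigr => j ji.
  by rewrite mxE (negbTE ji).
apply: eq_bigr => i _; rewrite (expand_det_row _ i); apply: eq_bigr => j _.
by rewrite cofM mxE eqxx.
Qed.

Lemma jacobi_det (k : nat) (h : 'M[A]_k) : h \in unitmx ->
  d (\det h) = \det h * \sum_i \sum_j d (h i j) * invmx h^T i j.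
Proof.
move=> hU; rewrite der_det mulr_sumr; apply: eq_bigr => i _.
rewrite mulr_sumr; apply: eq_bigr => j _.
have -> : invmx h^T i j = (\det h)^-1 * cofactor h i j.
  by rewrite -trmx_inv mxE /invmx hU mxE [\adj _ _ _]mxE.
by rewrite [RHS]mulrCA mulVKr.
Qed.

End Jacobi.

(** * Formal Taylor series as flows of Euler vector fields *)

Section Taylor.
Variables (m : nat) (A : comUnitRingType) (d : 'I_m -> {additive A -> A}).
Hypothesis natU : forall k, (k.+1%:R : A) \is a GRing.unit.
Hypothesis dL : forall s, leibniz (d s).
Hypothesis dC : forall s t x, d s (d t x) = d t (d s x).
Local Notation P := (mpoly m A).
Local Notation "''y_' s" := (mpolyX A (mnm1 s)) (at level 8, s at level 2).
Implicit Types (c : 'I_m -> int) (p : P) (x y : A).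

(* [euler c] is the vector field [sum_s c_s y_s d_s], so that
   [taylor c f] is the formal series of [f (z + c eps y)]. *)
Definition euler c p : P := \sum_s ('y_s * cder (d s) p) *~ c s.

Fact euler_is_additive c : zmod_morphism (euler c).
Proof.
move=> p p'; rewrite /euler -sumrB; apply: eq_bigr => s _.
by rewrite raddfB mulrBr mulrzBl.
Qed.

HB.instance Definition _ c :=
  GRing.isZmodMorphism.Build P P (euler c) (euler_is_additive c).

Lemma euler_leibniz c : leibniz (euler c).
Proof.
move=> p p'; rewrite /euler mulr_suml mulr_sumr -big_split; apply: eq_bigr => s _ /=.
by rewrite (cder_leibniz (dL s)) mulrDr mulrzDl mulrzAl mulrzAr mulrA [p * (_ * _)]mulrCA.
Qed.

Lemma euler_mulX c t p : euler c ('y_t * p) = 'y_t * euler c p.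
Proof.
rewrite /euler mulr_sumr; apply: eq_bigr => s _.
by rewrite cderXM // mulrCA mulrzAr.
Qed.

Lemma cder_euler c s p : cder (d s) (euler c p) = euler c (cder (d s) p).
Proof.
rewrite /euler raddf_sum; apply: eq_bigr => t _ /=.
by rewrite raddfMz /= cderXM ?(cder_comm p (dC s t)).
Qed.

Lemma euler_comm c c' p : euler c (euler c' p) = euler c' (euler c p).
Proof.
rewrite {2}/euler raddf_sum [RHS]/euler; apply: eq_bigr => s _ /=.
by rewrite raddfMz /= euler_mulX cder_euler.
Qed.

Lemma eulerD c c' p : euler (fun s => c s + c' s) p = euler c p + euler c' p.
Proof. by rewrite /euler -big_split; apply: eq_bigr => s _; rewrite mulrzDr. Qed.

Lemma mderiv_euler c s p :
  mderiv s (euler c p) = euler c (mderiv s p) + cder (d s) p *~ c s.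
Proof.
rewrite /euler raddf_sum /=.
under eq_bigr => t _ do rewrite raddfMz /= mderivM -cder_mderiv mulrzDl.
rewrite big_split [RHS]addrC /=; congr (_ + _).
rewrite (bigD1 s) //= mderivX mnm1E eqxx scale1r.
rewrite big1 => [|t ts]; last first.
  by rewrite mderivX mnm1E (negbTE ts) scale0r mul0r mul0rz.
rewrite addr0 [mnm_sub _ _](_ : _ = mnm0) ?mpolyX0 ?mul1r //.
by apply/mnmP => i; rewrite mnmBE subnn mnm0E.
Qed.

Definition taylor c x : fps P := expo (euler c) (fcst (mpolyC m x)).

Lemma taylorM c x y : taylor c (x * y) = taylor c x * taylor c y.
Proof.
rewrite -expoM //; last exact: euler_leibniz.
by congr expo; apply/funext => -[|k]; rewrite fcstM ?mpolyCM ?mulr0.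
Qed.

Lemma taylorD c x y : taylor c (x + y) = taylor c x + taylor c y.
Proof.
rewrite -expoD; congr expo; apply/funext => -[|k]; rewrite fpsDE /fcst /= ?addr0 //.
by rewrite mpolyCD.
Qed.

Lemma taylor0E c x : taylor c x 0%N = mpolyC m x.
Proof. by rewrite /taylor expo0E. Qed.

Lemma cder_taylor c s x : fmap (cder (d s)) (taylor c x) = taylor c (d s x).
Proof.
rewrite /taylor (fmap_expo natU) => [|p]; last exact: cder_euler.
by rewrite fmap_cst /= cderC.
Qed.

(** The chain rule for f (z + c eps y). On coefficients, each of the k+1 commuting factors [euler c]
    contributes one derivative term, and the factor k+1 turns 1/(k+1)! into 1/k!. *)
Lemma mderiv_taylor c s x :
  fmap (mderiv s) (taylor c x) = eps P * (taylor c (d s x) *~ c s).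
Proof.
apply/funext => -[|k]; first by rewrite epsM0 /fmap taylor0E mderivC.
rewrite epsMS /fmap /taylor expo_cstE // linearZ /=.
rewrite fpsMzE expo_cstE // scalerMzr.
suff -> : mderiv s (iter k.+1 (euler c) (mpolyC m x)) =
    iter k (euler c) (mpolyC m (d s x)) *~ c s *+ k.+1.
  by rewrite -[LHS]scalerMnr scalerMnl factVS.
elim: k => [|k IHk].
  by rewrite /= mderiv_euler mderivC raddf0 add0r cderC.
rewrite iterS mderiv_euler IHk raddfMn raddfMz /= [RHS]mulrSr; congr (_ + _ *~ _).
rewrite cder_euler; congr (euler c _).
by elim: k {IHk} => [|j IHj] /=; rewrite ?cderC // cder_euler IHj.
Qed.

Lemma expo_taylor c c' x :
  expo (euler c) (taylor c' x) = taylor (fun s => c s + c' s) x.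
Proof.
by apply: expo_comp => //= p; [exact: euler_comm|exact: eulerD].
Qed.

Lemma taylor_sign c x : fsign (taylor c x) = taylor (fun s => - c s) x.
Proof.
rewrite /taylor; apply: fsign_expo => // p /=; rewrite /euler -sumrN.
by apply: eq_bigr => s _; rewrite mulrNz.
Qed.

Lemma taylor_0 x : taylor (fun=> 0) x = fcst (mpolyC m x).
Proof.
by apply: expo_id => p /=; rewrite /euler big1 // => s _; rewrite mulr0z.
Qed.

End Taylor.

(** * The quadratic forms of the metric and of its inverse *)

Section QuadraticForm.
Variables (n : nat) (A : comUnitRingType).
Local Notation P := (mpoly (n + n) A).
Local Notation "''y_' s" := (mpolyX A (mnm1 s)) (at level 8, s at level 2).

Lemma mderiv_var (s t : 'I_(n + n)) : mderiv s 'y_t = (s == t)%:R.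
Proof.
rewrite mderivX mnm1E eq_sym; case: eqVneq => [->|]; last by rewrite scale0r.
rewrite scale1r [mnm_sub _ _](_ : _ = mnm0) ?mpolyX0 //.
by apply/mnmP => i; rewrite mnmBE subnn mnm0E.
Qed.

Definition pairing (B : 'M[A]_n) : P :=
  \sum_i \sum_j B i j *: ('y_(lshift n i) * 'y_(rshift n j)).

Lemma pairing_homog B : pairing B \is @ishomog1 (n + n) A 2 mdeg.
Proof.
apply: rpred_sum => i _; apply: rpred_sum => j _; apply: rpredZ.
by rewrite -mpolyXD dhomogX /= mdegD !mdeg1.
Qed.

Lemma mderiv_pairing B s :
  mderiv s (pairing B) = \sum_t block_mx 0 B B^T 0 s t *: 'y_t.
Proof.
rewrite big_split_ord /= /pairing raddf_sum /=.
under eq_bigr => i _ do rewrite raddf_sum /=.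
case: (split_ordP s) => k ->.
  rewrite [X in _ = X + _]big1 ?add0r; last first.
    by move=> i _; rewrite block_mxEul mxE scale0r.
  rewrite (bigD1 k) //= [X in _ + X]big1 ?addr0.
    apply: eq_bigr => j _; rewrite linearZ /= mderivM !mderiv_var eqxx mul1r.
    by rewrite eq_lrshift mulr0 addr0 block_mxEur.
  move=> i ik; apply: big1 => j _; rewrite linearZ /= mderivM !mderiv_var.
  by rewrite eq_lrshift eq_lshift eq_sym (negbTE ik) mul0r mulr0 addr0 scaler0.
rewrite [X in _ = _ + X]big1 ?addr0; last first.
  by move=> i _; rewrite block_mxEdr mxE scale0r.
apply: eq_bigr => i _; rewrite (bigD1 k) //= [X in _ + X]big1 ?addr0.
  rewrite linearZ /= mderivM !mderiv_var eqxx mulr1.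
  by rewrite eq_rlshift mul0r add0r block_mxEdl mxE.
move=> j jk; rewrite linearZ /= mderivM !mderiv_var.
by rewrite eq_rlshift eq_rshift eq_sym (negbTE jk) mul0r mulr0 addr0 scaler0.
Qed.

(** With y and ybar as independent variables the Hessians of the two forms are block antidiagonal;
    here they are seen to be mutually inverse, as the Gaussian calculus requires. *)
Lemma block_inv (h hi : 'M[A]_n) : hi *m h^T = 1%:M ->
  block_mx 0 hi hi^T 0 *m block_mx 0 h h^T 0 = 1%:M.
Proof.
move=> hih; rewrite mulmx_block !mul0mx !mulmx0 !addr0 !add0r hih.
rewrite -[h in _ *m h]trmxK -trmx_mul (mulmx1C hih) trmx1.
by rewrite -scalar_mx_block.
Qed.

Lemma cder_pairing (d : {additive A -> A}) B : leibniz d ->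
  cder d (pairing B) = pairing (map_mx d B).
Proof.
move=> dL; rewrite /pairing raddf_sum; apply: eq_bigr => i _ /=.
rewrite raddf_sum; apply: eq_bigr => j _ /=.
by rewrite cderZ // cderXM cderX // mulr0 scaler0 addr0 mxE.
Qed.

End QuadraticForm.

(** * The Laplace integrand and the commutation relation of left multiplications *)

Section Star.
Variables (n : nat) (A : comUnitRingType) (d : 'I_(n + n) -> {additive A -> A}).
Hypothesis natU : forall k, (k.+1%:R : A) \is a GRing.unit.
Hypothesis dL : forall s, leibniz (d s).
Hypothesis dC : forall s t x, d s (d t x) = d t (d s x).
Variable Phi : A.
Local Notation P := (mpoly (n + n) A).
Local Notation "''y_' s" := (mpolyX A (mnm1 s)) (at level 8, s at level 2).
Implicit Types (x y : A) (V : fps P).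

Definition hmat : 'M[A]_n := \matrix_(i, j) d (lshift n i) (d (rshift n j) Phi).
Definition hinvmat : 'M[A]_n := invmx hmat^T.
Definition hdet : A := \det hmat.
Hypothesis hU : hmat \in unitmx.

Local Notation q := (pairing hmat).
Local Notation Q := (pairing hinvmat).
Local Notation E := (wick Q).
Local Notation g := (block_mx 0 hmat hmat^T 0).
Local Notation gi := (block_mx 0 hinvmat hinvmat^T 0).

Let gig : gi *m g = 1%:M.
Proof. by apply: block_inv; rewrite mulVmx // unitmx_tr. Qed.

Let hdetU : hdet \is a GRing.unit. Proof. exact: hU. Qed.

Lemma wick_var2 i j : E ('y_(lshift n i) * 'y_(rshift n j)) = hinvmat i j.
Proof.
rewrite (wick_Xmul natU (pairing_homog _) (mderiv_pairing _)) big_split_ord /=.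
rewrite big1 ?add0r => [|k _]; last by rewrite block_mxEul mxE mul0r.
rewrite (bigD1 j) //= mderiv_var eqxx wick1 mulr1 block_mxEur.
rewrite big1 ?addr0 // => k kj.
by rewrite mderiv_var eq_rshift (negbTE kj) raddf0 mulr0.
Qed.

Lemma wick_pairing B : E (pairing B) = \sum_i \sum_j B i j * hinvmat i j.
Proof.
rewrite [X in E X]/pairing raddf_sum; apply: eq_bigr => i _ /=.
by rewrite raddf_sum; apply: eq_bigr => j _ /=; rewrite wickZ wick_var2.
Qed.

(** In Jacobi's formula the entries of the inverse matrix are Gaussian second moments. This shows
    that det H is the normalizing factor [N0] of the moving Gaussian. *)
Lemma der_hdet s : d s hdet = hdet * E (cder (d s) q).
Proof.
rewrite /hdet jacobi_det //; congr (_ * _).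
rewrite cder_pairing // wick_pairing; apply: eq_bigr => i _.
by apply: eq_bigr => j _; rewrite [map_mx _ _ _ _]mxE.
Qed.

(** Formally the integral against exp (- q) times Lebesgue measure divided by pi^n. Removing det H
    from the normalization is what lets base derivatives pass under the integral. *)
Definition nwick (p : P) : A := hdet^-1 * E p.

Fact nwick_is_additive : zmod_morphism nwick.
Proof. by move=> p p'; rewrite /nwick raddfB mulrBr. Qed.
HB.instance Definition _ :=
  GRing.isZmodMorphism.Build P A nwick nwick_is_additive.

Lemma nwickZ a p : nwick (a *: p) = a * nwick p.
Proof. by rewrite /nwick wickZ mulrCA. Qed.

Lemma der_nwick s p : d s (nwick p) = nwick (cder (d s) p - cder (d s) q * p).
Proof.
exact: (der_wick natU gig (pairing_homog _) (mderiv_pairing _)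
  (mderiv_pairing _) (dL s) hdetU (der_hdet s)).
Qed.

Lemma nwick_mderiv s p : nwick (mderiv s p) = nwick (mderiv s q * p).
Proof.
rewrite /nwick (wick_mderiv natU gig (pairing_homog _) (mderiv_pairing _)).
rewrite mderiv_pairing mulr_suml raddf_sum /=; congr (_ * _).
by apply: eq_bigr => t _; rewrite -scalerAl wickZ.
Qed.

Definition sgn2 (a b : int) (s : 'I_(n + n)) : int :=
  match fintype.split s with inl _ => a | inr _ => b end.

Lemma sgn2l a b i : sgn2 a b (lshift n i) = a.
Proof. by rewrite /sgn2 -[lshift n i]/(unsplit (inl i)) unsplitK. Qed.

Lemma sgn2r a b i : sgn2 a b (rshift n i) = b.
Proof. by rewrite /sgn2 -[rshift n i]/(unsplit (inr i)) unsplitK. Qed.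

(* [fshift a b f] is the Taylor series of f (z + a eps y, zbar + b eps ybar). *)
Definition fshift (a b : int) (x : A) : fps P := taylor d (sgn2 a b) x.

Lemma shiftM a b x y : fshift a b (x * y) = fshift a b x * fshift a b y.
Proof. exact: taylorM. Qed.

Lemma shift0E a b x : fshift a b x 0%N = mpolyC _ x.
Proof. exact: taylor0E. Qed.

Lemma cder_shift a b s x : fmap (cder (d s)) (fshift a b x) = fshift a b (d s x).
Proof. exact: cder_taylor. Qed.

Lemma mderiv_shift a b s x :
  fmap (mderiv s) (fshift a b x) = eps P * (fshift a b (d s x) *~ sgn2 a b s).
Proof. exact: mderiv_taylor. Qed.

Lemma expo_shift a b a' b' x :
  expo (euler d (sgn2 a b)) (fshift a' b' x) = fshift (a + a') (b + b') x.
Proof.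
rewrite expo_taylor //; congr (taylor d _ x).
by apply/funext => s; rewrite /sgn2; case: fintype.split.
Qed.

Lemma shift_sign a b x : fsign (fshift a b x) = fshift (- a) (- b) x.
Proof.
rewrite /fshift taylor_sign //; congr (taylor d _ x).
by apply/funext => s; rewrite /sgn2; case: fintype.split.
Qed.

Lemma shift00 x : fshift 0 0 x = fcst (mpolyC _ x).
Proof.
rewrite -(taylor_0 d); congr (taylor d _ x).
by apply/funext => s; rewrite /sgn2; case: fintype.split.
Qed.

(* Phi (z, vbar) + Phi (v, zbar) - Phi (z, zbar) - Phi (v, vbar) at v = z + eps y *)
Definition diastasis : fps P :=
  fshift 0 1 Phi + fshift 1 0 Phi - fshift 0 0 Phi - fshift 1 1 Phi.

(** The exponent phi / hbar without its Gaussian part: division by [eps] squared shifts the index by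
    two, and adding [q] cancels the quadratic term, which already sits in the weight. *)
Definition phase : fps P := fun k => diastasis k.+2 + (if k == 0%N then q else 0).

Lemma shiftE a b x k :
  fshift a b x k = k`!%:R^-1 *: iter k (euler d (sgn2 a b)) (mpolyC _ x).
Proof. by rewrite /fshift /taylor expo_cstE. Qed.

Definition hol_euler (p : P) : P := \sum_i 'y_(lshift n i) * cder (d (lshift n i)) p.
Definition ahol_euler (p : P) : P := \sum_j 'y_(rshift n j) * cder (d (rshift n j)) p.

Let eulerE a b p : euler d (sgn2 a b) p = hol_euler p *~ a + ahol_euler p *~ b.
Proof.
rewrite /euler big_split_ord /= /hol_euler /ahol_euler !mulrz_suml; congr (_ + _).
  by apply: eq_bigr => i _; rewrite sgn2l.
by apply: eq_bigr => i _; rewrite sgn2r.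
Qed.

Let euler00 p : euler d (sgn2 0 0) p = 0.
Proof. by rewrite eulerE (mulr0z (hol_euler p)) (mulr0z (ahol_euler p)) addr0. Qed.

Lemma euler10 p : euler d (sgn2 1 0) p = hol_euler p.
Proof. by rewrite eulerE (mulr1z (hol_euler p)) (mulr0z (ahol_euler p)) addr0. Qed.

Lemma euler01 p : euler d (sgn2 0 1) p = ahol_euler p.
Proof. by rewrite eulerE (mulr0z (hol_euler p)) (mulr1z (ahol_euler p)) add0r. Qed.

Let euler11 p : euler d (sgn2 1 1) p = euler d (sgn2 0 1) p + euler d (sgn2 1 0) p.
Proof. by rewrite eulerE (mulr1z (hol_euler p)) (mulr1z (ahol_euler p)) euler01 euler10 addrC. Qed.

Let hol_ahol : hol_euler (ahol_euler (mpolyC _ Phi)) = q.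
Proof.
rewrite /hol_euler /pairing; apply: eq_bigr => i _.
rewrite /ahol_euler raddf_sum mulr_sumr; apply: eq_bigr => j _ /=.
by rewrite cderXM !cderC mxE -mul_mpolyC [RHS]mulrC -mulrA.
Qed.

Lemma shift1E a b x : fshift a b x 1%N = euler d (sgn2 a b) (mpolyC _ x).
Proof. by rewrite shiftE (_ : 1`! = 1)%N // invr1 scale1r. Qed.

Lemma diastasisE k : diastasis k =
  fshift 0 1 Phi k + fshift 1 0 Phi k - fshift 0 0 Phi k - fshift 1 1 Phi k.
Proof. by []. Qed.

Lemma diastasis0 : diastasis 0%N = 0.
Proof. by rewrite diastasisE !shift0E; ring. Qed.

Lemma diastasis1 : diastasis 1%N = 0.
Proof.
rewrite diastasisE !shiftE /=.
rewrite euler11 euler00 -!scalerDr -!scalerBr.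
by rewrite subr0 subrr scaler0.
Qed.

Lemma diastasis2 : diastasis 2%N = - q.
Proof.
rewrite diastasisE !shiftE /=.
have -> : euler d (sgn2 0 0) (euler d (sgn2 0 0) (mpolyC _ Phi)) = 0.
  by rewrite euler00.
have -> : euler d (sgn2 1 1) (euler d (sgn2 1 1) (mpolyC _ Phi)) =
    euler d (sgn2 0 1) (euler d (sgn2 0 1) (mpolyC _ Phi)) +
    euler d (sgn2 1 0) (euler d (sgn2 1 0) (mpolyC _ Phi)) + q *+ 2.
  rewrite !euler11 raddfD /= [euler d (sgn2 1 0) (_ + _)]raddfD /=.
  rewrite [euler d (sgn2 1 0) (euler d (sgn2 0 1) _)]euler_comm //.
  have -> : q = euler d (sgn2 0 1) (euler d (sgn2 1 0) (mpolyC _ Phi)).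
    by rewrite euler_comm // euler01 euler10 -hol_ahol.
  move: (euler d (sgn2 0 1) (euler d (sgn2 0 1) _)) => u.
  move: (euler d (sgn2 0 1) (euler d (sgn2 1 0) _)) => v.
  move: (euler d (sgn2 1 0) (euler d (sgn2 1 0) _)) => w.
  by rewrite mulr2n; ring.
rewrite scaler0 subr0 -!scalerDr -scalerBr opprD addrA subrr add0r.
by rewrite scalerN -scaler_nat scalerA (_ : 2`! = 2)%N // mulVr ?scale1r.
Qed.

Lemma eps2_phase : eps P * (eps P * phase) = diastasis + eps P * (eps P * fcst q).
Proof.
apply/funext => -[|[|k]]; rewrite fpsDE ?epsM0 ?epsMS ?epsM0 ?diastasis0 ?diastasis1 ?addr0 //.
Qed.

Lemma phase0 : phase 0%N = 0.
Proof. by rewrite /phase eqxx diastasis2 addNr. Qed.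

(* The integrand of the formal Laplace expansion: nwick (kernel f1 f2) is f1 . f2. *)
Definition kernel x y : fps P :=
  fshift 0 1 x * fshift 1 0 y * exps phase * fshift 1 1 hdet.

Definition eprod x y : fps A := fmap nwick (kernel x y).

Definition prodA x y : fps A := fun k => eprod x y k.*2.

(** With v = z + eps y fixed, moving z also moves y. The chain rule gives the z-derivative minus
    1/eps times the y-derivative, multiplied here by [eps] to avoid negative powers. *)
Definition twist s V : fps P := eps P * fmap (cder (d s)) V - fmap (mderiv s) V.

Lemma twist_leibniz s : leibniz (twist s).
Proof.
move=> V W; rewrite /twist (fmap_leibniz (cder_leibniz (dL s))).
by rewrite (fmap_leibniz (@mderivM _ _ s)); ring.
Qed.

Lemma twist_eps s V : twist s (eps P * V) = eps P * twist s V.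
Proof. by rewrite /twist !fmap_eps; ring. Qed.

Lemma twistD s V W : twist s (V + W) = twist s V + twist s W.
Proof. by rewrite /twist !fmapD; ring. Qed.

Lemma twistN s V : twist s (- V) = - twist s V.
Proof. by rewrite /twist !fmapN; ring. Qed.

Lemma twist_shift a b s x :
  twist s (fshift a b x) = eps P * (fshift a b (d s x) *~ (1 - sgn2 a b s)).
Proof.
by rewrite /twist cder_shift mderiv_shift -mulrBr mulrzBr mulr1z.
Qed.

Lemma fmap_nwick_mul a V : fmap nwick (fcst (mpolyC _ a) * V) = fcst a * fmap nwick V.
Proof.
by apply/funext => k; rewrite /fmap !fcstM mul_mpolyC nwickZ.
Qed.

(** To the derivative under the integral sign one may add the y-derivative of [V] exp (- q), whose
    integral vanishes; the sum is the twisted derivative of integrand and weight together. *)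
Lemma der_fmap_nwick s V : eps A * fmap (d s) (fmap nwick V) =
  fmap nwick (twist s V - twist s (fcst q) * V).
Proof.
have E1 : fmap (d s) (fmap nwick V) =
    fmap nwick (fmap (cder (d s)) V - fcst (cder (d s) q) * V).
  by apply/funext => k; rewrite /fmap der_nwick fpsDE fpsNE fcstM.
have E2 : fmap nwick (fmap (mderiv s) V) = fmap nwick (fcst (mderiv s q) * V).
  by apply/funext => k; rewrite /fmap nwick_mderiv fcstM.
rewrite E1 -fmap_eps /twist !fmap_cst !fmapB mulrBr !mulrBl !fmapB E2 /=.
by rewrite opprB addrA subrK mulrA.
Qed.

(* As functions of the second argument z, both sides of
   Phi (z, vbar) + Phi (v, zbar) - Phi (z, zbar) - Phi (v, vbar) are
   differentiated with v fixed: this is what [twist] does. *)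
Lemma twist_phase j : let s := rshift n j in
  eps P * (twist s phase - twist s (fcst q)) =
  fshift 1 0 (d s Phi) - fcst (mpolyC _ (d s Phi)).
Proof.
move=> s; apply: epsI; rewrite mulrBr mulrBr -!twist_eps eps2_phase twistD addrK.
rewrite /diastasis !(twistD, twistN) !twist_shift !sgn2r shift00.
rewrite subrr subr0 !mulr0z !mulr1z mulr0 add0r subr0.
by rewrite mulrBr.
Qed.

(** At fixed v, the zbar-derivative does not see x (z, vbar) or the density at v. It falls on y (v,
    zbar) and on the exponent, from which it extracts dbar_j Phi (v, zbar) - dbar_j Phi (z, zbar).
    Hence left multiplication by x commutes with hbar dbar_j + dbar_j Phi. *)
Lemma eprod_commute j x y : let s := rshift n j in
  eps A * (eps A * fmap (d s) (eprod x y)) + fcst (d s Phi) * eprod x y =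
  eps A * (eps A * eprod x (d s y)) + eprod x (d s Phi * y).
Proof.
move=> s; rewrite /eprod der_fmap_nwick -!fmap_eps -fmap_nwick_mul.
have TW : twist s (kernel x y) =
    eps P * kernel x (d s y) + twist s phase * kernel x y.
  rewrite /kernel !twist_leibniz.
  have -> : twist s (exps phase) = twist s phase * exps phase.
    rewrite {1}/twist !(fmap_exps natU _ phase0); last 2 first.
    - exact: mderivM.
    - exact: cder_leibniz.
    by rewrite mulrA -mulrBl.
  rewrite !twist_shift !sgn2r subrr subr0 !mulr0z mulr0 mulr1z mul0r add0r.
  rewrite mulr0 addr0 mulrDl; congr (_ + _); ring.
rewrite -!fmapD; congr (fmap nwick _).
have -> : kernel x (d s Phi * y) = fshift 1 0 (d s Phi) * kernel x y.
  by rewrite /kernel shiftM; ring.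
have := twist_phase j; rewrite /= -/s TW.
move: (twist s phase) (twist s (fcst q)) (kernel x y) (kernel x (d s y)) => tp tq K K'.
move: (fshift 1 0 (d s Phi)) (fcst (mpolyC _ (d s Phi))) => u v E.
have <- : eps P * (tp - tq) + v = u by rewrite E subrK.
by ring.
Qed.

Lemma kernelDr x y y' : kernel x (y + y') = kernel x y + kernel x y'.
Proof. by rewrite /kernel /fshift taylorD // !(mulrDl, mulrDr). Qed.

Lemma kernelDl x x' y : kernel (x + x') y = kernel x y + kernel x' y.
Proof. by rewrite /kernel /fshift taylorD // !(mulrDl, mulrDr). Qed.

Lemma eprodDr x y y' : eprod x (y + y') = eprod x y + eprod x y'.
Proof. by rewrite /eprod kernelDr fmapD. Qed.

Lemma eprodDl x x' y : eprod (x + x') y = eprod x y + eprod x' y.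
Proof. by rewrite /eprod kernelDl fmapD. Qed.

Lemma prodA_commute j x y k : let s := rshift n j in
  (if k is k'.+1 then d s (prodA x y k') else 0) + d s Phi * prodA x y k =
  (if k is k'.+1 then prodA x (d s y) k' else 0) + prodA x (d s Phi * y) k.
Proof.
move=> s; have := congr1 (fun a : fps A => a k.*2) (eprod_commute j x y).
rewrite /= !fpsDE fcstM; case: k => [|k]; first by rewrite !epsM0.
by rewrite doubleS !epsMS.
Qed.

End Star.

(** * Symmetry of the product up to divergences *)

Section Trace.
Variables (n : nat) (A : comUnitRingType) (d : 'I_(n + n) -> {additive A -> A}).
Hypothesis natU : forall k, (k.+1%:R : A) \is a GRing.unit.
Hypothesis dL : forall s, leibniz (d s).
Hypothesis dC : forall s t x, d s (d t x) = d t (d s x).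
Variable Phi : A.
Hypothesis hU : hmat d Phi \in unitmx.
Local Notation P := (mpoly (n + n) A).
Local Notation "''y_' s" := (mpolyX A (mnm1 s)) (at level 8, s at level 2).
Local Notation q := (pairing (hmat d Phi)).
Local Notation hdet := (hdet d Phi).
Local Notation nwick := (nwick d Phi).
Local Notation kernel := (kernel d Phi).
Local Notation phase := (phase d Phi).
Implicit Types (x y : A) (p : P) (V W : fps P).

(* A differential ideal; for us, the functions supported in a given set. *)
Variable I : A -> Prop.
Hypothesis I0 : I 0.
Hypothesis ID : forall x y, I x -> I y -> I (x + y).
Hypothesis IM : forall a x, I x -> I (a * x).
Hypothesis Ider : forall s x, I x -> I (d s x).

Definition coefs_in p : Prop := forall al, I (mcoeff al p).
Definition fcoefs_in V : Prop := forall k, coefs_in (V k).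

Let I_sum (T : Type) (r : seq T) (Q : pred T) (F : T -> A) :
  (forall i, I (F i)) -> I (\sum_(i <- r | Q i) F i).
Proof. by move=> IF; elim/big_ind: _. Qed.

Let I_mulrn x k : I x -> I (x *+ k).
Proof. by move=> Ix; rewrite -mulr_natl; exact: IM. Qed.

Lemma coefs_in0 : coefs_in 0.
Proof. by move=> al; rewrite mcoeff0. Qed.

Lemma coefs_inD p p' : coefs_in p -> coefs_in p' -> coefs_in (p + p').
Proof. by move=> Ip Ip' al; rewrite mcoeffD; apply: ID. Qed.

Lemma coefs_in_sum (T : Type) (r : seq T) (Q : pred T) (F : T -> P) :
  (forall i, coefs_in (F i)) -> coefs_in (\sum_(i <- r | Q i) F i).
Proof.
by move=> IF; elim/big_ind: _ => //; [exact: coefs_in0|exact: coefs_inD].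
Qed.

Lemma coefs_inM p p' : coefs_in p' -> coefs_in (p * p').
Proof. by move=> Ip' al; rewrite mcoeffM; apply: I_sum => i; apply: IM. Qed.

Lemma coefs_inC x : I x -> coefs_in (mpolyC _ x).
Proof.
by move=> Ix al; rewrite mcoeffC; case: eqP; rewrite ?mulr1 ?mulr0.
Qed.

Lemma coefs_in_cder s p : coefs_in p -> coefs_in (cder (d s) p).
Proof. by move=> Ip al; rewrite mcoeff_cder; apply: Ider. Qed.

Lemma coefs_in_nwick p : coefs_in p -> I (nwick p).
Proof.
by move=> Ip; apply: IM; apply: I_sum => al; rewrite mulrC; apply: IM.
Qed.

Lemma coefs_in_euler c p : coefs_in p -> coefs_in (euler d c p).
Proof.
move=> Ip; apply: coefs_in_sum => s; rewrite -mulrzl.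
by do 2! apply: coefs_inM; apply: coefs_in_cder.
Qed.

Lemma fcoefs_inM V W : fcoefs_in W -> fcoefs_in (V * W).
Proof.
by move=> IW k; rewrite fps_mulE; apply: coefs_in_sum => j; apply: coefs_inM.
Qed.

Lemma fcoefs_in_expo c W : fcoefs_in W -> fcoefs_in (expo (euler d c) W).
Proof.
move=> IW k; apply: coefs_in_sum => j; rewrite -mul_mpolyC; apply: coefs_inM.
move: (W _) (IW (k - j)%N) => w Iw; elim: (j : nat) => [|i IHi]; first exact: Iw.
by rewrite iterS; exact: coefs_in_euler IHi.
Qed.

Lemma fcoefs_in_shift a b x : I x -> fcoefs_in (fshift d a b x).
Proof.
move=> Ix; apply: fcoefs_in_expo => -[|k]; [exact: coefs_inC|exact: coefs_in0].
Qed.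

Lemma fcoefs_in_kernel x y : I x -> fcoefs_in (kernel x y).
Proof.
move=> Ix; rewrite /kernel -!mulrA mulrC.
by apply: fcoefs_inM; exact: fcoefs_in_shift.
Qed.

Definition divergence x : Prop :=
  exists2 v : 'I_(n + n) -> A, forall s, I (v s) & x = \sum_s d s (v s).

Lemma divergence0 : divergence 0.
Proof. by exists (fun=> 0) => // ; rewrite big1 // => s _; rewrite raddf0. Qed.

Lemma divergenceD x y : divergence x -> divergence y -> divergence (x + y).
Proof.
move=> [v Iv ->] [w Iw ->]; exists (fun s => v s + w s); first by move=> s; exact: ID.
by rewrite -big_split; apply: eq_bigr => s _; rewrite raddfD.
Qed.

Lemma divergenceVn x k : divergence (x *+ k.+1) -> divergence x.
Proof.
move=> [v Iv E]; exists (fun s => k.+1%:R^-1 * v s) => [s|]; first exact: IM.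
apply: (mulrI (natU k)); rewrite mulr_natl E mulr_sumr; apply: eq_bigr => s _.
by rewrite mulr_natl -raddfMn -[_ * v s *+ _]mulr_natl mulVKr.
Qed.

Lemma divergence_nwick s p : coefs_in p ->
  divergence (nwick (cder (d s) p - cder (d s) q * p)).
Proof.
move=> Ip; rewrite -der_nwick //.
exists (fun t => if t == s then nwick p else 0) => [t|].
  by case: eqP => // _; exact: coefs_in_nwick.
by rewrite (bigD1 s) //= eqxx big1 ?addr0 // => t /negbTE ->; rewrite raddf0.
Qed.

Local Notation L := (euler d (sgn2 (-1) (-1))).
Local Notation T := (expo L).

(** The factor y_s is constant for [cder (d s)], so the expression is the sum of the weighted
    derivatives of - y_s p, and each of these integrates to a derivative. *)
Lemma divergence_flow p : coefs_in p -> divergence (nwick (L p - L q * p)).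
Proof.
move=> Ip; have -> : L p - L q * p = \sum_s
    (cder (d s) ('y_s * - p) - cder (d s) q * ('y_s * - p)).
  rewrite /euler mulr_suml -sumrB; apply: eq_bigr => s _.
  have -> : sgn2 (-1) (-1) s = -1 by rewrite /sgn2; case: fintype.split.
  rewrite !mulrN1z cderXM raddfN /=.
  by move: (cder _ p) (cder _ q) ('y_s) => u v w; ring.
rewrite raddf_sum; elim/big_ind: _ => //=; [exact: divergence0|exact: divergenceD|].
move=> s _; apply: divergence_nwick; apply: coefs_inM => al.
by rewrite mcoeffN -mulN1r; exact: IM.
Qed.

Let flow_identity (K : comPzRingType) (lw w e x u v : K) :
  (lw + x) * e + w * (- u * e) = lw * e + w * ((v - u) * e) - v * (w * e) + x * e.
Proof. by ring. Qed.

(* Translating the base point of the integrand, Gaussian weight included,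
   changes it by a divergence. *)
Lemma translate_divergence W k : fcoefs_in W -> divergence
  (nwick ((T W * exps (fcst q - T (fcst q))) k) - nwick (W k)).
Proof.
elim: k W => [|k IHk] W IW.
  rewrite fps_mul0E exps0E expo0E mulr1 subrr; exact: divergence0.
(* Translating the weight exp (- q) multiplies it by the exponential of [B]. *)
set B := fcst q - _; pose U := T W * exps B.
have B0 : B 0%N = 0 by rewrite /B fpsDE fpsNE expo0E subrr.
have fL := fmap_leibniz (euler_leibniz dL (sgn2 (-1) (-1))).
(* The [eps]-derivative of the translated integrand splits into a divergence and the same expression
   for [fder W], which the induction hypothesis handles one order lower. *)
have E : fder U = fmap L U - fcst (L q) * U + T (fder W) * exps B.
  rewrite /U fderM fL fder_exps // fder_expo // (fmap_exps natU _ B0); last first.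
    exact: euler_leibniz.
  have -> : fder B = - fmap L (T (fcst q)).
    rewrite /B fderD fderN fder_cst fder_expo // fder_cst add0r.
    by rewrite expo0 addr0.
  have -> : fmap L B = fcst (L q) - fmap L (T (fcst q)).
    by rewrite /B fmapB fmap_cst.
  exact: flow_identity.
apply: (@divergenceVn _ k); rewrite mulrnBl -!raddfMn /=.
rewrite -[_ *+ k.+1]/(fder U k) -[W k.+1 *+ k.+1]/(fder W k) E.
rewrite !fpsDE fpsNE fcstM raddfD -addrA; apply: divergenceD.
  apply: divergence_flow; rewrite /U mulrC.
  by apply: fcoefs_inM; exact: fcoefs_in_expo.
apply: IHk => j al; rewrite /fder mcoeffMn; apply: I_mulrn; exact: IW.
Qed.

Let flow01 x : T (fshift d 0 1 x) = fshift d (-1) 0 x.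
Proof. by rewrite expo_shift. Qed.
Let flow10 x : T (fshift d 1 0 x) = fshift d 0 (-1) x.
Proof. by rewrite expo_shift. Qed.
Let flow11 x : T (fshift d 1 1 x) = fshift d 0 0 x.
Proof. by rewrite expo_shift. Qed.
Let flow00 x : T (fshift d 0 0 x) = fshift d (-1) (-1) x.
Proof. by rewrite expo_shift. Qed.
Let sign01 x : fsign (fshift d 0 1 x) = fshift d 0 (-1) x.
Proof. by rewrite shift_sign. Qed.
Let sign10 x : fsign (fshift d 1 0 x) = fshift d (-1) 0 x.
Proof. by rewrite shift_sign. Qed.
Let sign11 x : fsign (fshift d 1 1 x) = fshift d (-1) (-1) x.
Proof. by rewrite shift_sign. Qed.
Let sign00 x : fsign (fshift d 0 0 x) = fshift d 0 0 x.
Proof. by rewrite shift_sign. Qed.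

Let diastasis_flow (K : comPzRingType) (a b c e : K) :
  a + b - c - e = b + a - e - c.
Proof. by ring. Qed.

(** Translation by - eps y turns the pair (z, z + eps y) into (z - eps y, z): the exchanged pair
    with [eps] negated. The four-term exponent is symmetric in the two points, and the two weight
    terms correct for the part carried by [q]. The comparison is made after multiplying by [eps]
    squared. *)
Lemma expo_phase : T phase + (fcst q - T (fcst q)) = fsign phase.
Proof.
have E1 : eps P * (eps P * T phase) =
    T (diastasis d Phi) + eps P * (eps P * T (fcst q)).
  by rewrite -!expo_eps // -expoD // eps2_phase.
have sign_eps2 V : fsign (eps P * (eps P * V)) = eps P * (eps P * fsign V).
  by rewrite !fsign_eps mulrN opprK.
have E2 : eps P * (eps P * fsign phase) =
    fsign (diastasis d Phi) + eps P * (eps P * fcst q).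
  by rewrite -sign_eps2 eps2_phase // fsignD sign_eps2 fsign_cst.
have E3 : T (diastasis d Phi) = fsign (diastasis d Phi).
  rewrite /diastasis !(expoD, expoN, fsignD, fsignN).
  rewrite flow01 flow10 flow11 flow00 sign01 sign10 sign11 sign00.
  exact: diastasis_flow.
apply: epsI; apply: epsI; rewrite E2 -E3 !mulrDr E1 !mulrN.
by rewrite addrACA subrr addr0.
Qed.

Let kernel_flow (K : comPzRingType) (a b c e f g : K) :
  a * (b * c * e * f) * g = f * (c * b * (e * g) * a).
Proof. by ring. Qed.

(** The exchange of z and v in the double integral, the constant factor [hdet] being the density at
    z: translation followed by sign change swaps the arguments of x and y as well as the two
    densities. *)
Lemma flow_kernel x y :
  T (fcst (mpolyC _ hdet) * kernel x y) * exps (fcst q - T (fcst q)) =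
  fsign (fcst (mpolyC _ hdet) * kernel y x).
Proof.
have LL := euler_leibniz dL (sgn2 (-1) (-1)).
rewrite /kernel !expoM // !fsignM expo_exps // ?phase0 //.
rewrite fsign_exps -expo_phase expsD ?expo0E ?phase0 //; last first.
  by rewrite fpsDE fpsNE expo0E subrr.
rewrite -!(shift00 d) flow01 flow10 flow11 flow00 sign01 sign10 sign11 sign00.
exact: kernel_flow.
Qed.

(** Powers of hbar are even powers of [eps], where the sign change in [flow_kernel] is invisible;
    only the divergence due to the translation remains. *)
Lemma prodA_trace x y k : I x ->
  divergence (hdet * (prodA d Phi x y k - prodA d Phi y x k)).
Proof.
move=> Ix.
have IK : fcoefs_in (fcst (mpolyC _ hdet) * kernel x y).
  by apply: fcoefs_inM; exact: fcoefs_in_kernel.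
have sign_even (V : fps P) : fsign V k.*2 = V k.*2.
  by rewrite /fsign -muln2 exprM sqrr_sign mul1r.
have nwick_cst V : nwick ((fcst (mpolyC _ hdet) * V) k.*2) = hdet * nwick (V k.*2).
  by rewrite fcstM mul_mpolyC nwickZ.
rewrite -[prodA d Phi x y k]/(nwick (kernel x y k.*2)).
rewrite -[prodA d Phi y x k]/(nwick (kernel y x k.*2)).
move: (kernel x y) (kernel y x) IK (flow_kernel x y) => K K' IK flowK.
have := translate_divergence k.*2 IK; rewrite flowK sign_even.
rewrite !nwick_cst -mulrBr.
case=> v Iv E; exists (fun s => - v s) => [s|]; first by rewrite -mulN1r; exact: IM.
rewrite -opprB mulrN E -sumrN; apply: eq_bigr => s _; by rewrite raddfN.
Qed.

Lemma prodA_ideal x y k : I x -> I (prodA d Phi x y k).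
Proof. by move=> Ix; apply: coefs_in_nwick; exact: fcoefs_in_kernel. Qed.

End Trace.

(** * Holomorphic differential operators and their rigidity *)

Section Monomials.
Variable P : comPzRingType.
Implicit Types (p : P) (V : fps P).

Definition mono r p : fps P := fun k => if k == r then p else 0.

Lemma mono0E p : mono 0 p = fcst p.
Proof. by []. Qed.

Lemma monoS r p : mono r.+1 p = eps P * mono r p.
Proof. by apply/funext => -[|k]; rewrite ?epsM0 ?epsMS /mono. Qed.

Lemma monoD r p p' : mono r (p + p') = mono r p + mono r p'.
Proof. by apply/funext => k; rewrite fpsDE /mono; case: eqP; rewrite ?addr0. Qed.

Lemma fcst_mono r a p : fcst a * mono r p = mono r (a * p).
Proof.
by apply/funext => k; rewrite fcstM /mono; case: eqP; rewrite ?mulr0.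
Qed.

Lemma mono1M r p p' : mono 1 p * mono r p' = mono r.+1 (p * p').
Proof. by rewrite !monoS mono0E -mulrA fcst_mono. Qed.

Lemma mono_mulE V r p k :
  (V * mono r p) k = if (r <= k)%N then V (k - r)%N * p else 0.
Proof.
elim: r k => [|r IHr] k; first by rewrite mono0E mulrC fcstM subn0 mulrC.
rewrite monoS mulrCA; case: k => [|k]; first by rewrite epsM0.
by rewrite epsMS IHr.
Qed.

End Monomials.

Section Assoc.
Variables (n : nat) (A : comUnitRingType) (d : 'I_(n + n) -> {additive A -> A}).
Hypothesis natU : forall k, (k.+1%:R : A) \is a GRing.unit.
Hypothesis dL : forall s, leibniz (d s).
Hypothesis dC : forall s t x, d s (d t x) = d t (d s x).
Variable Phi : A.
Hypothesis hU : hmat d Phi \in unitmx.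
Local Notation P := (mpoly (n + n) A).
Local Notation "''y_' s" := (mpolyX A (mnm1 s)) (at level 8, s at level 2).
Local Notation nwick := (nwick d Phi).
Local Notation T := (fshift d 1 0).
Local Notation cf x := (fcst (mpolyC (n + n) x)).
Variable z : 'I_n -> A.
Hypothesis dz_z : forall i j, d (lshift n i) (z j) = (i == j)%:R.
Implicit Types (x y u : A) (p : P) (V W : fps P).

Definition jet_linear (F : fps P -> A) : Prop :=
  forall a V W, F ((cf a) * V + W) = a * F V + F W.

Definition jet_bounded N (F : fps P -> A) : Prop :=
  forall V W, (forall j, (j <= N)%N -> V j = W j) -> F V = F W.

(* Differential operators in the d (lshift n i), presented by their action on
   the Taylor series u (z + eps y, zbar). *)
Definition holdiff (X : A -> A) : Prop := exists (F : fps P -> A) N,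
  [/\ jet_linear F, jet_bounded N F & forall u, X u = F (T u)].

Lemma T1 : T 1 = 1.
Proof.
apply/funext => k; rewrite shiftE // fps_oneE; case: k => [|k].
  by rewrite fact0 invr1 scale1r /=.
rewrite iterSr (_ : euler _ _ _ = 0) ?iter_raddf0 ?scaler0 //.
by rewrite /euler big1 // => s _; rewrite cderC leibniz1 // raddf0 mulr0 mul0rz.
Qed.

Lemma TM x y : T (x * y) = T x * T y.
Proof. exact: shiftM. Qed.

Lemma T1E x : T x 1%N = \sum_i 'y_(lshift n i) * mpolyC _ (d (lshift n i) x).
Proof.
rewrite shiftE // (_ : 1`! = 1)%N // invr1 scale1r /= euler10 //.
by apply: eq_bigr => i _; rewrite cderC.
Qed.

Lemma T_coord i : T (z i) = (cf (z i)) + mono 1 'y_(lshift n i).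
Proof.
have L1 : euler d (sgn2 1 0) (mpolyC _ (z i)) = 'y_(lshift n i).
  rewrite euler10 // /hol_euler (bigD1 i) //= cderC dz_z eqxx mpolyC1 mulr1.
  rewrite big1 ?addr0 // => j ji.
  by rewrite cderC dz_z (negbTE ji) mpolyC0 mulr0.
have L2 : euler d (sgn2 1 0) 'y_(lshift n i) = 0.
  by rewrite /euler big1 // => s _; rewrite cderX // mulr0 mul0rz.
apply/funext => -[|[|k]]; rewrite fpsDE /mono /fcst /=.
- by rewrite shift0E // addr0.
- by rewrite add0r shiftE // (_ : 1`! = 1)%N // invr1 scale1r /= L1.
by rewrite addr0 shiftE // !iterSr L1 L2 iter_raddf0 scaler0.
Qed.

Section JetFunctional.
Variables (F : fps P -> A) (N : nat).
Hypotheses (FL : jet_linear F) (FN : jet_bounded N F).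

Lemma jet0 : F 0 = 0.
Proof.
have := FL (-1) 0 0; rewrite mulr0 addr0 mulN1r => E.
by rewrite {1}E addNr.
Qed.

Lemma jetD V W : F (V + W) = F V + F W.
Proof.
have := FL 1 V W; rewrite mpolyC1 mul1r => <-; congr F; congr (_ + _).
by apply/funext => k; rewrite fcstM mul1r.
Qed.

Lemma jetZ a V : F ((cf a) * V) = a * F V.
Proof. by rewrite -[_ * V]addr0 FL jet0 addr0. Qed.

Lemma jetN V : F (- V) = - F V.
Proof. by apply/eqP; rewrite -addr_eq0 -jetD addNr jet0. Qed.

Lemma jet_sum (I : Type) (r : seq I) (Q : pred I) (G : I -> fps P) :
  F (\sum_(i <- r | Q i) G i) = \sum_(i <- r | Q i) F (G i).
Proof.
by elim/big_rec2: _ => [|i x V _ <-]; [exact: jet0|rewrite jetD].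
Qed.

Lemma jet_mono V : F V = \sum_(k < N.+1) F (mono k (V k)).
Proof.
rewrite -jet_sum; apply: FN => j lejN; rewrite fps_sumE.
rewrite (bigD1 (Ordinal (lejN : j < N.+1)%N)) //= {1}/mono eqxx big1 ?addr0 //.
move=> i ij; rewrite /mono; case: eqP => // ji; case/eqP: ij; exact: val_inj.
Qed.

End JetFunctional.

(* Polynomials in the holomorphic variables y_(lshift n i), homogeneous of degree r. *)
Fixpoint hol_homog (r : nat) (p : P) : Prop :=
  if r is r'.+1 then
    exists2 G : 'I_n -> P, forall i, hol_homog r' (G i)
      & p = \sum_i 'y_(lshift n i) * G i
  else exists x, p = mpolyC _ x.

Lemma hol_homogZ a r p : hol_homog r p -> hol_homog r (a *: p).
Proof.
elim: r p => [|r IHr] p /=.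
  by move=> [x ->]; exists (a * x); rewrite mpolyCM mul_mpolyC.
move=> [G hG ->]; exists (fun i => a *: G i) => [i|]; first exact: IHr.
by rewrite scaler_sumr; apply: eq_bigr => i _; rewrite scalerAr.
Qed.

Lemma hol_homog_cder s r p : hol_homog r p -> hol_homog r (cder (d s) p).
Proof.
elim: r p => [|r IHr] p /=; first by move=> [x ->]; exists (d s x); rewrite cderC.
move=> [G hG ->]; exists (fun i => cder (d s) (G i)) => [i|]; first exact: IHr.
by rewrite raddf_sum; apply: eq_bigr => i _ /=; rewrite cderXM.
Qed.

Lemma hol_homogM r r' p p' : hol_homog r p -> hol_homog r' p' ->
  hol_homog (r + r') (p * p').
Proof.
move=> + hp'; elim: r p => [|r IHr] p /=.
  by move=> [x ->]; rewrite mul_mpolyC; exact: hol_homogZ.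
move=> [G hG ->]; exists (fun i => G i * p') => [i|]; first exact: IHr.
by rewrite mulr_suml; apply: eq_bigr => i _; rewrite mulrA.
Qed.

Lemma hol_homogT u k : hol_homog k (T u k).
Proof.
rewrite shiftE //; apply: hol_homogZ.
elim: k => [|k IHk]; first by exists u.
rewrite iterS euler10 //; exists (fun i => cder (d (lshift n i))
  (iter k (euler d (sgn2 1 0)) (mpolyC _ u))) => // i.
exact: hol_homog_cder.
Qed.

Section Kill.
Variables (F : fps P -> A) (N : nat).
Hypotheses (FL : jet_linear F) (FN : jet_bounded N F).
Let potential j := d (rshift n j) Phi.
Hypothesis Fp : forall j u, F (T (potential j) * T u) = potential j * F (T u).

Inductive jet_span : fps P -> Prop :=
| JetSpanT u : jet_span (T u)
| JetSpanL a V W : jet_span V -> jet_span W -> jet_span ((cf a) * V + W).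

Let spanK V : jet_span V -> forall j, F ((T (potential j) - (cf (potential j))) * V) = 0.
Proof.
move=> spV j; elim: spV => [u|a V' W' _ IHV _ IHW].
  by rewrite mulrBl jetD // jetN // jetZ // Fp subrr.
by rewrite mulrDr mulrCA FL IHV IHW mulr0 addr0.
Qed.

Let span0 : jet_span 0.
Proof.
(* The zero series is written as - T 1 + T 1, built from the two constructors. *)
have -> : (0 : fps P) = (cf (-1)) * T 1 + T 1.
  by rewrite T1 mulr1; apply/funext => -[|k]; rewrite fpsDE /fcst fps_oneE /= ?addr0 // mpolyCN mpolyC1 addNr.
apply: JetSpanL; exact: JetSpanT.
Qed.

Let spanD V W : jet_span V -> jet_span W -> jet_span (V + W).
Proof.
move=> hV hW; have -> : V + W = (cf 1) * V + W.
  by congr (_ + _); apply/funext => k; rewrite fcstM mpolyC1 mul1r.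
exact: JetSpanL.
Qed.

(** T is multiplicative and T (z_i) - z_i = eps y_i, so the coordinate functions give access to
    every monomial in the holomorphic y's. *)
Let span_y i V : jet_span V -> jet_span (mono 1 'y_(lshift n i) * V).
Proof.
have -> : mono 1 'y_(lshift n i) = T (z i) - (cf (z i)) by rewrite T_coord addrC addKr.
elim=> [u|a V' W' hV IHV hW IHW]; last by rewrite mulrDr mulrCA; exact: JetSpanL.
rewrite mulrBl -TM addrC -mulNr.
have -> : - (cf (z i)) = (cf (- z i)).
  by apply/funext => -[|k]; rewrite fpsNE /fcst /= ?mpolyCN ?oppr0.
by apply: JetSpanL; exact: JetSpanT.
Qed.

Let span_mono r p : hol_homog r p -> jet_span (mono r p).
Proof.
elim: r p => [|r IHr] p /=.
  move=> [x ->]; rewrite mono0E -[fcst _]mulr1 -T1 -[_ * _]addr0.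
  by apply: JetSpanL => //; exact: JetSpanT.
move=> [G hG ->]; rewrite (_ : mono r.+1 _ = \sum_i mono 1 'y_(lshift n i) * mono r (G i)).
  by elim/big_ind: _ => // i _; apply: span_y; exact: IHr.
elim/big_rec2: _ => [|i V q _ <-]; last by rewrite monoD mono1M.
by apply/funext => k; rewrite /mono; case: eqP.
Qed.

(** A symbol argument by descending induction on the order r, starting above the bound [N].
    Commuting with dbar_j Phi kills [F] on (T p_j - p_j) times any monomial in the span. The lowest
    term of that product is the contraction of H with the y_i, the higher terms vanish by induction,
    and invertibility of H kills the lowest term for each i separately. *)
Lemma jet_mono_kill r p : (0 < r)%N -> hol_homog r p -> F (mono r p) = 0.
Proof.
have [m] := ubnP (N.+1 - r); elim: m r p => // m IHm [//|r] p ltm _ /=.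
have [ltNr|lerN] := ltnP N r.+1.
  move=> _; rewrite -(jet0 FL); apply: FN => j lejN.
  by rewrite /mono ltn_eqF //; exact: leq_ltn_trans ltNr.
move=> [G hG ->].
suff FG q : hol_homog r q -> forall i, F (mono r.+1 ('y_(lshift n i) * q)) = 0.
  rewrite (_ : mono r.+1 _ = \sum_i mono r.+1 ('y_(lshift n i) * G i)).
    by rewrite jet_sum // big1 // => i _; exact: FG.
  elim/big_rec2: _ => [|i V q _ <-]; last by rewrite monoD.
  by apply/funext => k; rewrite /mono; case: eqP.
move=> hq.
(* The values of [F] on the multiples of q by the y_i, as a row vector; the claim is that this row
   is annihilated by H. *)
pose v : 'rV[A]_n := \row_i F (mono r.+1 ('y_(lshift n i) * q)).
suff v0 : v *m hmat d Phi = 0.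
  move=> i; have : v = 0 by rewrite -[v](mulmxK hU) v0 mul0mx.
  by move/matrixP/(_ 0 i); rewrite !mxE.
apply/matrixP => i0 j; rewrite !mxE.
have := spanK (span_mono hq) j; rewrite (jet_mono FL FN).
have lerN' : (r.+1 < N.+1)%N by [].
rewrite (bigD1 (Ordinal lerN')) //= mono_mulE leqnSn subSnn.
rewrite big1 ?addr0 => [|[k ltk] /= kr]; last first.
  rewrite mono_mulE; case: leqP => [lerk|_]; last first.
    by rewrite -(jet0 FL); congr F; apply/funext => l; rewrite /mono; case: eqP.
  rewrite fpsDE fpsNE; case E : (k - r)%N => [|l].
    rewrite shift0E // /fcst /= subrr mul0r -(jet0 FL); congr F.
    by apply/funext => l; rewrite /mono; case: eqP.
  rewrite /fcst /= subr0.
  have ltrk : (r.+1 < k)%N.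
    rewrite ltn_neqAle -[(r < k)%N]subn_gt0 E andbT.
    by apply: contraNneq kr => ek; apply/eqP/val_inj; rewrite /= -ek.
  apply: IHm; [|exact: ltn_trans ltrk|].
    by rewrite ltnS in ltm; apply: leq_trans ltm; rewrite ltn_sub2l // ltnW.
  have -> : k = (l.+1 + r)%N by rewrite -E subnK.
  apply: hol_homogM => //; exact: hol_homogT.
rewrite fpsDE fpsNE /fcst /= subr0 T1E mulr_suml => E0.
rewrite -[RHS]E0 (_ : mono r.+1 _ = \sum_i (cf (hmat d Phi i j)) * mono r.+1 ('y_(lshift n i) * q)).
  by rewrite jet_sum //; apply: eq_bigr => i _; rewrite jetZ // mxE mulrC.
elim/big_rec2: _ => [|i V p' _ <-].
  by apply/funext => k; rewrite /mono; case: eqP.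
by rewrite monoD fcst_mono mxE -mulrA mulrCA.
Qed.

Lemma jet_kill u : F (T u) = u * F 1.
Proof.
rewrite (jet_mono FL FN) big_ord_recl big1 ?addr0 => [|i _]; last first.
  by apply: jet_mono_kill => //; exact: hol_homogT.
by rewrite shift0E // mono0E -jetZ // mulr1.
Qed.

End Kill.

Lemma holdiff_scalar X : holdiff X ->
  (forall j u, X (d (rshift n j) Phi * u) = d (rshift n j) Phi * X u) ->
  forall u, X u = u * X 1.
Proof.
move=> [F [N [FL FN XF]]] Xp u; rewrite !XF T1; apply: jet_kill FN _ _ => //.
by move=> j w; rewrite -TM -!XF Xp.
Qed.

Lemma holdiff0 : holdiff (fun=> 0).
Proof. by exists (fun=> 0), 0%N; split=> // a V W; rewrite mulr0 addr0. Qed.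

Lemma holdiffD X Y : holdiff X -> holdiff Y -> holdiff (fun u => X u + Y u).
Proof.
move=> [F [N [FL FN XF]]] [G [M [GL GM YG]]].
exists (fun V => F V + G V), (maxn N M); split=> [a V W|V W VW|u].
- by rewrite FL GL mulrDr addrACA.
- by rewrite (FN V W) ?(GM V W) // => j lej; apply: VW; rewrite leq_max lej ?orbT.
- by rewrite XF YG.
Qed.

Lemma holdiff_sum (I : Type) (r : seq I) (Q : pred I) (X : I -> A -> A) :
  (forall i, holdiff (X i)) -> holdiff (fun u => \sum_(i <- r | Q i) X i u).
Proof.
move=> hX; elim: r => [|i r IHr].
  by rewrite (_ : (fun u => _) = fun=> 0); [exact: holdiff0|apply/funext => u; rewrite big_nil].
rewrite (_ : (fun u => _) = fun u => (if Q i then X i u else 0) + \sum_(j <- r | Q j) X j u).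
  by apply: holdiffD => //; case: (Q i) => //; exact: holdiff0.
by apply/funext => u; rewrite big_cons; case: (Q i) => //; rewrite add0r.
Qed.

Lemma holdiffN X : holdiff X -> holdiff (fun u => - X u).
Proof.
move=> [F [N [FL FN XF]]]; exists (fun V => - F V), N; split=> [a V W|V W /FN ->|u] //.
- by rewrite FL opprD mulrN.
- by rewrite XF.
Qed.

Definition jet_der s V : fps P := fun k => mderiv s (V k.+1).

(** On the Taylor series of u the last two terms of [G] cancel and leave d_s of the value of [F].
    They are there to make [G] linear over [A]: the middle one absorbs the derivative of the
    coefficient, the last one restores the value. *)
Lemma holdiff_der i X : holdiff X -> holdiff (fun u => d (lshift n i) (X u)).
Proof.
move=> [F [N [FL FN XF]]]; set s := lshift n i.
pose G V := d s (F V) - F (fmap (cder (d s)) V) + F (jet_der s V).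
exists G, N.+1; split=> [a V W|V W VW|u].
- rewrite /G.
  have -> : fmap (cder (d s)) (cf a * V + W) =
      cf a * fmap (cder (d s)) V + (cf (d s a) * V + fmap (cder (d s)) W).
    apply/funext => k; rewrite /fmap !fpsDE !fcstM raddfD /= !mul_mpolyC cderZ //.
    by rewrite -addrA [RHS]addrCA.
  have -> : jet_der s (cf a * V + W) = cf a * jet_der s V + jet_der s W.
    apply/funext => k; rewrite /jet_der !fpsDE !fcstM raddfD /= !mul_mpolyC.
    by rewrite linearZ.
  rewrite !FL [d s (_ + _)]raddfD dL.
  move: (F V) (F W) (F (fmap _ V)) (F (fmap _ W)) => x1 x2 x3 x4.
  move: (F (jet_der s V)) (F (jet_der s W)) (d s x1) (d s x2) (d s a) => x5 x6 x7 x8 x9.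
  by ring.
- rewrite /G (FN V W); last by move=> j lej; apply: VW; exact: leqW.
  rewrite (FN (fmap _ V) (fmap (cder (d s)) W)); last first.
    by move=> j lej; rewrite /fmap VW // leqW.
  rewrite (FN (jet_der s V) (jet_der s W)) // => j lej.
  by rewrite /jet_der VW.
- rewrite /G XF cder_shift // addrAC (_ : jet_der s (T u) = T (d s u)); first by rewrite addrK.
  apply/funext => k.
  rewrite -[LHS]/(fmap (mderiv s) (T u) k.+1) mderiv_shift // epsMS.
  by rewrite /s sgn2l mulr1z.
Qed.

(** The Taylor coefficient of [X u] of order k consists of holomorphic derivatives of [X u] of order
    k; these are reached by applying [holdiff_der] k times. *)
Lemma holdiff_taylor X k (G : P -> A) : (forall a p p', G (a *: p + p') = a * G p + G p') ->
  holdiff X -> holdiff (fun u => G (T (X u) k)).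
Proof.
move=> GL hX.
suff hI G' : (forall a p p', G' (a *: p + p') = a * G' p + G' p') ->
    holdiff (fun u => G' (iter k (euler d (sgn2 1 0)) (mpolyC _ (X u)))).
  have E : (fun u => G (T (X u) k)) = fun u =>
     G (k`!%:R^-1 *: iter k (euler d (sgn2 1 0)) (mpolyC _ (X u))).
    by apply/funext => u; rewrite shiftE.
  rewrite E; apply: (hI (fun p => G (k`!%:R^-1 *: p))) => a p p'.
  by rewrite scalerDr scalerA mulrC -scalerA GL.
elim: k X hX G' {G GL} => [|k IHk] X hX G GL.
  have G0 : G 0 = 0 by have := GL (-1) 0 0; rewrite scaler0 addr0 mulN1r addNr.
  move: hX => [F [N [FL FN XF]]].
  exists (fun V => G (mpolyC _ (F V))), N; split=> [a V W|V W /FN -> //|u /=].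
    by rewrite FL mpolyCD mpolyCM mul_mpolyC GL.
  by rewrite XF.
have GD : {morph G : p p' / p + p'}.
  by move=> p p'; rewrite -[p]scale1r GL scale1r mul1r.
have G0 : G 0 = 0 by apply: (addrI (G 0)); rewrite -GD !addr0.
rewrite (_ : (fun u => _) = fun u => \sum_i G ('y_(lshift n i) *
    iter k (euler d (sgn2 1 0)) (mpolyC _ (d (lshift n i) (X u))))); last first.
  apply/funext => u; rewrite iterSr euler10 // /hol_euler.
  rewrite -(big_morph G GD G0); congr G.
  rewrite (_ : iter k _ _ = \sum_i iter k (euler d (sgn2 1 0))
      ('y_(lshift n i) * mpolyC _ (d (lshift n i) (X u)))); last first.
    under eq_bigr do rewrite cderC.
    elim/big_rec2: _ => [|i p p' _ <-]; first exact: iter_raddf0.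
    exact: iter_raddfD.
  apply: eq_bigr => i _; elim: (k) => // l IHl.
  by rewrite !iterS IHl euler_mulX.
apply: holdiff_sum => i.
apply: (IHk _ (holdiff_der i hX) (fun p => G ('y_(lshift n i) * p))) => a p p'.
by rewrite mulrDr -scalerAr GL.
Qed.

(** X depends on Y u only through its Taylor coefficients up to order [N], and each of these is
    already a holomorphic differential operator applied to u. *)
Lemma holdiff_comp X Y : holdiff X -> holdiff Y -> holdiff (X \o Y).
Proof.
move=> [F [N [FL FN XF]]] hY.
rewrite (_ : X \o Y = fun u => \sum_(k < N.+1) F (mono k (T (Y u) k))).
  apply: holdiff_sum => k; apply: (@holdiff_taylor Y k (fun p => F (mono k p))) => // a p p'.
  by rewrite monoD -mul_mpolyC -fcst_mono FL.
by apply/funext => u; rewrite /= XF (jet_mono FL FN).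
Qed.

(** The second factor enters the integrand only through its holomorphic Taylor series, and order k
    in hbar involves no coefficient beyond 2k. *)
Lemma holdiff_prodA x k : holdiff (fun u => prodA d Phi x u k).
Proof.
exists (fun V => nwick ((fshift d 0 1 x * V * exps (phase d Phi) *
  fshift d 1 1 (hdet d Phi)) k.*2)), k.*2; split=> [a V W|V W VW|u //].
  rewrite !(mulrDl, mulrDr) fpsDE raddfD /=; congr (_ + _).
  rewrite mulrCA -!(mulrA (cf a)) fcstM mul_mpolyC nwickZ //.
congr nwick; do 3! [apply: eq_fps_mul => // ? ?].
by apply: VW; do 2! [apply: leq_trans; first eassumption].
Qed.

End Assoc.

(* [conv G] is sum_i eps^i G_i. *)
Definition conv (A : comPzRingType) (G : nat -> fps A) : fps A :=
  fun k => \sum_(i < k.+1) G i (k - i)%N.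

(** * Extension of the product to power series in hbar, and associativity *)

Section Conv.
Variable A : comPzRingType.
Implicit Types (G : nat -> fps A) (c : fps A).

Lemma eq_conv G G' : (forall i, G i = G' i) -> conv G = conv G'.
Proof. by move=> GG; apply/funext => k; apply: eq_bigr => i _; rewrite GG. Qed.

Lemma convD G G' : conv (fun i => G i + G' i) = conv G + conv G'.
Proof. by apply/funext => k; rewrite fpsDE /conv -big_split. Qed.

Lemma convS G : conv G = G 0%N + eps A * conv (fun i => G i.+1).
Proof.
apply/funext => k; rewrite fpsDE /conv big_ord_recl subn0.
by case: k => [|k]; rewrite ?epsM0 ?epsMS ?big_ord0.
Qed.

Lemma conv_eps G : conv (fun i => eps A * G i) = eps A * conv G.
Proof.
apply/funext => -[|k]; first by rewrite /conv big_ord1 !epsM0.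
rewrite epsMS /conv big_ord_recr /= subnn epsM0 addr0.
by apply: eq_bigr => i _; rewrite subSn ?epsMS // -ltnS.
Qed.

Lemma conv_fcst x G : conv (fun i => fcst x * G i) = fcst x * conv G.
Proof.
apply/funext => k; rewrite fcstM /conv mulr_sumr.
by apply: eq_bigr => i _; rewrite fcstM.
Qed.

Lemma conv_fmap (M : {additive A -> A}) G :
  conv (fun i => fmap M (G i)) = fmap M (conv G).
Proof. by apply/funext => k; rewrite /fmap /conv raddf_sum. Qed.

Lemma fps_shiftE c : c = fcst (c 0%N) + eps A * (fun k => c k.+1 : A).
Proof.
by apply/funext => -[|k]; rewrite fpsDE ?epsM0 ?epsMS /fcst /= ?addr0 ?add0r.
Qed.

End Conv.

Section SeriesProduct.
Variables (A : comPzRingType) (prod : A -> A -> fps A).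
Hypothesis prodDr : forall x y y', prod x (y + y') = prod x y + prod x y'.
Hypothesis prodDl : forall x x' y, prod (x + x') y = prod x y + prod x' y.
Implicit Types (x y u : A) (a b c : fps A).

Definition sprod a b : fps A :=
  conv (fun i => conv (fun j => prod (a i) (b j))).

Let prod0r x : prod x 0 = 0.
Proof. by apply: (addrI (prod x 0)); rewrite -prodDr !addr0. Qed.

Let prod0l x : prod 0 x = 0.
Proof. by apply: (addrI (prod 0 x)); rewrite -prodDl !addr0. Qed.

Lemma sprod_0E a b : sprod a b 0%N = prod (a 0%N) (b 0%N) 0%N.
Proof. by rewrite /sprod /conv !big_ord1. Qed.

Lemma sprod_1E a b : sprod a b 1%N =
  prod (a 0%N) (b 0%N) 1%N + prod (a 0%N) (b 1%N) 0%N + prod (a 1%N) (b 0%N) 0%N.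
Proof.
rewrite /sprod /conv big_ord_recr big_ord1 /= subnn subn0 big_ord1.
by rewrite big_ord_recr big_ord1 /= subnn subn0.
Qed.

Lemma sprodDr a b b' : sprod a (b + b') = sprod a b + sprod a b'.
Proof.
rewrite /sprod -convD; apply: eq_conv => i; rewrite -convD.
by apply: eq_conv => j; rewrite fpsDE prodDr.
Qed.

Lemma sprodDl a a' b : sprod (a + a') b = sprod a b + sprod a' b.
Proof.
rewrite /sprod -convD; apply: eq_conv => i; rewrite -convD.
by apply: eq_conv => j; rewrite fpsDE prodDl.
Qed.

Let conv0 : conv (fun=> 0) = 0 :> fps A.
Proof. by apply/funext => k; rewrite /conv big1. Qed.

Let conv_prod_eps x b : conv (fun j => prod x ((eps A * b) j)) =
  eps A * conv (fun j => prod x (b j)).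
Proof.
rewrite convS epsM0 prod0r add0r; congr (_ * _).
by apply: eq_conv => j; rewrite epsMS.
Qed.

Lemma sprod_epsr a b : sprod a (eps A * b) = eps A * sprod a b.
Proof. by rewrite /sprod -conv_eps; apply: eq_conv => i. Qed.

Lemma sprod_epsl a b : sprod (eps A * a) b = eps A * sprod a b.
Proof.
rewrite /sprod convS epsM0.
rewrite [X in X + _](_ : _ = 0) ?add0r; last first.
  by rewrite -conv0; apply: eq_conv => j; rewrite prod0l.
by congr (_ * _); apply: eq_conv => i; rewrite epsMS.
Qed.

Lemma sprod_fcst a x k : sprod a (fcst x) k = \sum_(i < k.+1) prod (a i) x (k - i)%N.
Proof.
apply: eq_bigr => i _; rewrite convS /fcst /= fpsDE.
rewrite [X in _ * X](_ : _ = 0) ?mulr0 ?addr0 //.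
by rewrite -conv0; apply: eq_conv => j; rewrite prod0r.
Qed.

Variables (J : Type) (p : J -> A) (d : J -> {additive A -> A}).

(* hbar d_j + p_j *)
Definition heis j c : fps A := fcst (p j) * c + eps A * fmap (d j) c.

Lemma heisD j c c' : heis j (c + c') = heis j c + heis j c'.
Proof. by rewrite /heis fmapD !mulrDr addrACA. Qed.

Lemma conv_heis j G : conv (fun i => heis j (G i)) = heis j (conv G).
Proof. by rewrite /heis convD conv_fcst conv_eps conv_fmap. Qed.

Hypothesis prod_heis : forall j x u,
  prod x (p j * u) + eps A * prod x (d j u) = heis j (prod x u).

Lemma sprod_heis j a c : sprod a (heis j c) = heis j (sprod a c).
Proof.
rewrite /sprod -conv_heis; apply: eq_conv => i.
rewrite -conv_heis.
transitivity (conv (fun l => prod (a i) (p j * c l)) +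
    conv (fun l => prod (a i) ((eps A * fmap (d j) c) l))).
  by rewrite -convD; apply: eq_conv => l; rewrite -prodDr -fcstM.
rewrite conv_prod_eps -conv_eps -convD; apply: eq_conv => l.
exact: prod_heis.
Qed.

(* A class of operators; for us, the differential operators in the
   holomorphic variables. *)
Variable H : (A -> A) -> Prop.
Hypothesis HD : forall X Y, H X -> H Y -> H (fun u => X u + Y u).
Hypothesis HN : forall X, H X -> H (fun u => - X u).
Hypothesis Hsum : forall k (X : 'I_k -> A -> A), (forall i, H (X i)) ->
  H (fun u => \sum_(i < k) X i u).
Hypothesis Hcomp : forall X Y, H X -> H Y -> H (X \o Y).
Hypothesis Hprod : forall x k, H (fun u => prod x u k).
Hypothesis Hscalar : forall X, H X -> (forall j u, X (p j * u) = p j * X u) ->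
  forall u, X u = u * X 1.

Let H_sprod a k : H (fun u => sprod a (fcst u) k).
Proof.
rewrite (_ : (fun u => _) = fun u => \sum_(i < k.+1) prod (a i) u (k - i)%N).
  exact: Hsum.
by apply/funext => u; rewrite sprod_fcst.
Qed.

Let H_sprod2 a b k : H (fun u => sprod a (sprod b (fcst u)) k).
Proof.
apply: Hsum => i; apply: Hsum => j.
exact: (Hcomp (Hprod (a i) _) (H_sprod b j)).
Qed.

Variable e : fps A.
Hypothesis e0 : e 0%N = 1.
Hypothesis unitr : forall x, sprod (fcst x) e = fcst x.

Lemma sprod_unitr c : sprod c e = c.
Proof.
apply/funext => k; elim: k c => [|k IHk] c; rewrite [c in LHS]fps_shiftE.
  by rewrite sprodDl sprod_epsl fpsDE epsM0 addr0 unitr.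
by rewrite sprodDl sprod_epsl fpsDE epsMS IHk unitr /fcst /= add0r.
Qed.

Hypothesis unitl : forall x, sprod e (fcst x) = fcst x.

Lemma sprod_unitl c : sprod e c = c.
Proof.
apply/funext => k; elim: k c => [|k IHk] c; rewrite [c in LHS]fps_shiftE.
  by rewrite sprodDr sprod_epsr fpsDE epsM0 addr0 unitl.
by rewrite sprodDr sprod_epsr fpsDE epsMS IHk unitl /fcst /= add0r.
Qed.

(* Karabegov's argument: left multiplications are exactly the formal
   differential operators in the d (lshift n i) which commute with heis j; such
   an operator is determined by its value on the unit. *)
Theorem sprodA a b c : sprod (sprod a b) c = sprod a (sprod b c).
Proof.
(* The associator as an operator on its last argument; it is additive and commutes with
   multiplication by the formal parameter and with [heis j]. *)
pose X c := sprod (sprod a b) c - sprod a (sprod b c).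
have XD c1 c2 : X (c1 + c2) = X c1 + X c2.
  by rewrite /X !sprodDr opprD addrACA.
have Xeps c1 : X (eps A * c1) = eps A * X c1 by rewrite /X !sprod_epsr mulrBr.
have Xheis j c1 : X (heis j c1) = heis j (X c1).
  rewrite /X !sprod_heis; apply/eqP; rewrite subr_eq -heisD addrNK; exact/eqP.
have Xcst k : (forall l u, (l <= k)%N -> X (fcst u) l = 0) ->
    forall l c1, (l <= k)%N -> X c1 l = 0.
  move=> Xk; elim=> [|l IHl] c1 lek; rewrite [c1]fps_shiftE XD Xeps fpsDE Xk //.
    by rewrite epsM0 addr0.
  by rewrite epsMS IHl ?addr0 // ltnW.
suff X0 k u : X (fcst u) k = 0.
  apply/eqP; rewrite -subr_eq0; apply/eqP/funext => k.
  by apply: (Xcst k) => // l u _.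
elim/ltn_ind: k u => k IHk.
have Xlt l c1 : (l < k)%N -> X c1 l = 0.
  case: k IHk => // k IHk; rewrite ltnS; apply: Xcst => l' u lel'.
  exact: IHk.
have hX : H (fun u => X (fcst u) k).
  exact: HD (H_sprod _ _) (HN (H_sprod2 _ _ _)).
(* At order k the derivative part of [heis] involves the associator at order k - 1, zero by
   induction, so only multiplication by [p j] is left. *)
have Xp j u : X (fcst (p j * u)) k =
    p j * X (fcst u) k.
  have := congr1 (fun v : fps A => v k) (Xheis j (fcst u)).
  rewrite /heis XD Xeps !fpsDE fcstM.
  have -> : fcst (p j) * fcst u = fcst (p j * u) :> fps A.
    by apply/funext => l; rewrite fcstM /fcst; case: eqP => //; rewrite mulr0.
  case: k {IHk hX} Xlt => [|k] Xlt; first by rewrite !epsM0 !addr0.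
  rewrite !epsMS -[fmap _ (X _) k]/(d j (X (fcst u) k)).
  by rewrite !(Xlt k) // raddf0 !addr0.
have Xu u : X (fcst u) k = u * X (fcst 1) k.
  exact: (Hscalar hX Xp).
move=> u; rewrite Xu.
(* Since e = 1 + O(hbar) and the lower orders vanish, the value at order k on 1 is the value on the
   unit. *)
have : X e k = 0 by rewrite /X !sprod_unitr subrr.
rewrite [e]fps_shiftE e0 XD Xeps fpsDE.
case: k {IHk hX Xp Xu} Xlt => [|k] Xlt; first by rewrite epsM0 addr0 => ->; rewrite mulr0.
by rewrite epsMS (Xlt k) // addr0 => ->; rewrite mulr0.
Qed.

End SeriesProduct.

(** * Normalization by the unit, and the first-order term *)

Section GeometricSeries.
Variable A : comPzRingType.
Implicit Types a b c : fps A.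

Lemma fps_mul3_2 a b c : a 0%N = 0 -> b 0%N = 0 ->
  (a * b * c) 2%N = a 1%N * b 1%N * c 0%N.
Proof.
move=> a0 b0.
rewrite fps_mulE !big_ord_recl big_ord0 /= !fps_mulE.
rewrite !big_ord_recl !big_ord0 /= !a0 !b0.
by rewrite !(mul0r, mulr0, add0r, addr0).
Qed.

(** The Neumann series for the inverse of [a] when its constant term is 1; terms with m > k have no
    coefficient of order k. *)
Definition geom a : fps A := fun k => \sum_(m < k.+1) ((1 - a) ^+ m) k.

Lemma mul_geom a : a 0%N = 1 -> a * geom a = 1.
Proof.
move=> a0; pose b := 1 - a; have b0 : b 0%N = 0.
  by rewrite /b fpsDE fpsNE fps_oneE a0 subrr.
apply/funext => k.
have E : (a * geom a) k = (a * \sum_(m < k.+1) b ^+ m) k.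
  apply: eq_fps_mul => // j lejk; rewrite fps_sumE /geom -/b.
  rewrite (big_ord_widen k.+1 (fun m => (b ^+ m) j)) // big_mkcond.
  by apply: eq_bigr => m _; case: ltnP => // ltjm; rewrite fps_expr_lt.
rewrite E; have -> : a = 1 - b by rewrite /b subKr.
rewrite -opprB mulNr -subrX1 opprB fpsDE fpsNE fps_expr_lt ?subr0 //.
Qed.

End GeometricSeries.

Section ConjugateProduct.
Variables (K : comPzRingType) (sp : K -> K -> K) (e g : K).
Hypothesis ge : g * e = 1.
Hypothesis spA : forall a b c, sp (sp a b) c = sp a (sp b c).
Hypothesis spel : forall a, sp e a = a.
Hypothesis sper : forall a, sp a e = a.

(** The transport of [sp] along multiplication by [e]; it therefore inherits associativity, and its
    unit is the preimage 1 of [e]. *)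
Definition conj_prod a b : K := g * sp (a * e) (b * e).

Let conj_prod_e a b : conj_prod a b * e = sp (a * e) (b * e).
Proof. by rewrite /conj_prod mulrAC ge mul1r. Qed.

Lemma conj_prodA a b c : conj_prod a (conj_prod b c) = conj_prod (conj_prod a b) c.
Proof.
by rewrite [in RHS]/conj_prod [in LHS]/conj_prod !conj_prod_e spA.
Qed.

Lemma conj_prod1l a : conj_prod 1 a = a.
Proof. by rewrite /conj_prod mul1r spel mulrCA ge mulr1. Qed.

Lemma conj_prod1r a : conj_prod a 1 = a.
Proof. by rewrite /conj_prod mul1r sper mulrCA ge mulr1. Qed.

End ConjugateProduct.

Section StarAlgebra.
Variables (n : nat) (A : comUnitRingType) (d : 'I_(n + n) -> {additive A -> A}).
Hypothesis natU : forall k, (k.+1%:R : A) \is a GRing.unit.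
Hypothesis dL : forall s, leibniz (d s).
Hypothesis dC : forall s t x, d s (d t x) = d t (d s x).
Variable Phi : A.
Hypothesis hU : hmat d Phi \in unitmx.
Variable z : 'I_n -> A.
Hypothesis dz_z : forall i j, d (lshift n i) (z j) = (i == j)%:R.
Implicit Types (x y : A) (a b c : fps A).
Local Notation P := (mpoly (n + n) A).
Local Notation hdet := (hdet d Phi).
Local Notation nwick := (nwick d Phi).
Local Notation prod := (prodA d Phi).
Local Notation sprod := (sprod prod).

Lemma prodADr x y y' : prod x (y + y') = prod x y + prod x y'.
Proof. by apply/funext => k; rewrite /prodA eprodDr. Qed.

Lemma prodADl x x' y : prod (x + x') y = prod x y + prod x' y.
Proof. by apply/funext => k; rewrite /prodA eprodDl. Qed.

Lemma prodA_heis j x u : prod x (d (rshift n j) Phi * u) +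
  eps A * prod x (d (rshift n j) u) =
  heis (fun j => d (rshift n j) Phi) (fun j => d (rshift n j)) j (prod x u).
Proof.
have E k := prodA_commute natU dL dC hU j x u k.
apply/funext => k; have := E k; rewrite /= /heis !fpsDE fcstM.
case: k => [|k]; first by rewrite !epsM0 !add0r !addr0 => ->.
by rewrite !epsMS => H; rewrite [LHS]addrC -H addrC.
Qed.

Lemma nwickC x : nwick (mpolyC _ (hdet * x)) = x.
Proof.
by rewrite mulrC mpolyCM mul_mpolyC nwickZ /nwick -[mpolyC _ _]mulr1 mul_mpolyC wickZ wick1 mulr1 mulVr ?mulr1.
Qed.

Lemma shift1 (r s : int) : fshift d r s 1 = 1.
Proof.
apply/funext => k; rewrite shiftE // fps_oneE; case: k => [|k].
  by rewrite fact0 invr1 scale1r /=.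
rewrite iterSr (_ : euler _ _ _ = 0) ?iter_raddf0 ?scaler0 //.
by rewrite /euler big1 // => t _; rewrite cderC leibniz1 // raddf0 mulr0 mul0rz.
Qed.

Lemma prodA_0 x y : prod x y 0%N = x * y.
Proof.
rewrite /prodA /eprod /fmap /kernel !fps_mul0E exps0E !shift0E // mulr1.
by rewrite -!mpolyCM mulrC nwickC.
Qed.

(** Subtract the constant terms x and y from the two Taylor series. At order 2 in [eps] only the
    product of linear terms survives, with Gaussian mean given by the inverse metric. Expanding the
    differences produces the products in which x or y is replaced by 1. *)
Lemma prodA_1 x y : prod x y 1%N =
  \sum_i \sum_j hinvmat d Phi i j * d (rshift n j) x * d (lshift n i) y
  + y * prod x 1 1%N + x * prod 1 y 1%N - x * y * prod 1 1 1%N.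
Proof.
pose G := exps (phase d Phi) * fshift d 1 1 hdet.
pose K u v := fshift d 0 1 u * fshift d 1 0 v * G.
have E u v : prod u v 1%N = nwick (K u v 2%N) by rewrite /K /G mulrA.
pose cf u : fps P := fcst (mpolyC _ u).
have nwickZk u V k : nwick ((cf u * V) k) = u * nwick (V k).
  by rewrite /cf fcstM mul_mpolyC nwickZ.
have expand : (fshift d 0 1 x - cf x) * (fshift d 1 0 y - cf y) * G =
    K x y - cf y * K x 1 - cf x * K 1 y + cf x * (cf y * K 1 1).
  rewrite /K !shift1; move: (fshift d 0 1 x) (fshift d 1 0 y) (cf x) (cf y) => u v w t.
  by ring.
have lead : nwick (((fshift d 0 1 x - cf x) * (fshift d 1 0 y - cf y) * G) 2%N) =
    \sum_i \sum_j hinvmat d Phi i j * d (rshift n j) x * d (lshift n i) y.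
  have -> : ((fshift d 0 1 x - cf x) * (fshift d 1 0 y - cf y) * G) 2%N =
      fshift d 0 1 x 1%N * fshift d 1 0 y 1%N * mpolyC _ hdet.
    have u0 : (fshift d 0 1 x - cf x) 0%N = 0 by rewrite fpsDE fpsNE shift0E // subrr.
    have v0 : (fshift d 1 0 y - cf y) 0%N = 0 by rewrite fpsDE fpsNE shift0E // subrr.
    have u1 : (fshift d 0 1 x - cf x) 1%N = fshift d 0 1 x 1%N by rewrite fpsDE fpsNE subr0.
    have v1 : (fshift d 1 0 y - cf y) 1%N = fshift d 1 0 y 1%N by rewrite fpsDE fpsNE subr0.
    have G0 : G 0%N = mpolyC _ hdet by rewrite /G fps_mul0E exps0E mul1r shift0E.
    rewrite -u1 -v1 -G0; exact: fps_mul3_2.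
  rewrite !shift1E // mulrC mul_mpolyC nwickZ euler10 // euler01 //.
  rewrite /nwick mulVKr //.
  have -> : ahol_euler d (mpolyC _ x) * hol_euler d (mpolyC _ y) =
      pairing (\matrix_(i, j) (d (rshift n j) x * d (lshift n i) y)).
    rewrite mulrC /hol_euler /ahol_euler mulr_suml; apply: eq_bigr => i _.
    rewrite mulr_sumr; apply: eq_bigr => j _; rewrite !cderC mxE -mul_mpolyC mpolyCM.
    by rewrite mulrACA mulrC [mpolyC _ _ * mpolyC _ _]mulrC.
  rewrite wick_pairing //; apply: eq_bigr => i _; apply: eq_bigr => j _.
  by rewrite mxE mulrC mulrA.
rewrite -lead expand !E; clear lead expand E; clearbody K.
move: (K x y) (K x 1) (K 1 y) (K 1 1) => K1 K2 K3 K4.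
have fps4E (a b c e : fps P) k : (a - b - c + e) k = a k - b k - c k + e k by [].
have nwick4E (p1 p2 p3 p4 : P) :
    nwick (p1 - p2 - p3 + p4) = nwick p1 - nwick p2 - nwick p3 + nwick p4.
  by rewrite raddfD !raddfB.
have nwick4 (r1 r2 r3 r4 : A) :
    r1 = r1 - y * r2 - x * r3 + x * (y * r4) + y * r2 + x * r3 - x * y * r4 by ring.
rewrite fps4E nwick4E !nwickZk; exact: nwick4.
Qed.

Variable e : fps A.
Hypothesis unitP : forall x, sprod e (fcst x) = fcst x /\ sprod (fcst x) e = fcst x.

Lemma sprod_0 a b : sprod a b 0%N = a 0%N * b 0%N.
Proof. by rewrite sprod_0E prodA_0. Qed.

Lemma sprod_1 a b : sprod a b 1%N =
  prod (a 0%N) (b 0%N) 1%N + a 0%N * b 1%N + a 1%N * b 0%N.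
Proof. by rewrite sprod_1E (prodA_0 (a 0%N)) (prodA_0 (a 1%N)). Qed.

Lemma unit_0 : e 0%N = 1.
Proof.
have [+ _] := unitP 1 => /(congr1 (fun a : fps A => a 0%N)).
by rewrite sprod_0 mulr1.
Qed.

Lemma series_prodA a b c : sprod (sprod a b) c = sprod a (sprod b c).
Proof.
apply: (sprodA prodADr prodADl prodA_heis (H := holdiff d)) unit_0 _ _ _ _.
- exact: holdiffD.
- exact: holdiffN.
- by move=> k X hX; exact: holdiff_sum.
- exact: holdiff_comp.
- exact: holdiff_prodA.
- by move=> X hX Xp; apply: holdiff_scalar hX Xp.
- by move=> x; case: (unitP x).
Qed.

Lemma series_unitr a : sprod a e = a.
Proof.
by apply: (sprod_unitr prodADl) => x; case: (unitP x).
Qed.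

Lemma series_unitl a : sprod e a = a.
Proof.
by apply: (sprod_unitl prodADr) => x; case: (unitP x).
Qed.

Definition nstar : fps A -> fps A -> fps A := conj_prod sprod e (geom e).

Let geomK : geom e * e = 1.
Proof. by rewrite mulrC mul_geom // unit_0. Qed.

Lemma nstarA a b c : nstar a (nstar b c) = nstar (nstar a b) c.
Proof. exact: (conj_prodA geomK series_prodA). Qed.

Lemma nstar1l a : nstar 1 a = a.
Proof. exact: (conj_prod1l geomK series_unitl). Qed.

Lemma nstar1r a : nstar a 1 = a.
Proof. exact: (conj_prod1r geomK series_unitr). Qed.

Lemma geom_0 : geom e 0%N = 1.
Proof. by rewrite /geom big_ord1 expr0. Qed.

Lemma geom_1 : geom e 1%N = - e 1%N.
Proof.
rewrite /geom !big_ord_recl big_ord0 expr0 expr1 /= addr0.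
by rewrite fpsDE fpsNE !fps_oneE /= !add0r.
Qed.

Lemma nstar_cst_0 x y : nstar (fcst x) (fcst y) 0%N = x * y.
Proof.
by rewrite /nstar /conj_prod fps_mul0E geom_0 mul1r sprod_0 !fcstM unit_0 !mulr1.
Qed.

(** The unit equations at order one evaluate the products with 1 in terms of the first coefficient
    of [e], and these cancel against the normalizing factors. *)
Lemma nstar_cst_1 x y : nstar (fcst x) (fcst y) 1%N =
  \sum_i \sum_j hinvmat d Phi i j * d (rshift n j) x * d (lshift n i) y.
Proof.
have unit1l u : prod 1 u 1%N = - (e 1%N * u).
  have [+ _] := unitP u => /(congr1 (fun a : fps A => a 1%N)).
  rewrite sprod_1 unit_0 /fcst /= mulr0 addr0 => /eqP.
  by rewrite addr_eq0 => /eqP.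
have unit1r u : prod u 1 1%N = - (u * e 1%N).
  have [_] := unitP u => /(congr1 (fun a : fps A => a 1%N)).
  rewrite sprod_1 unit_0 /fcst /= mul0r addr0 => /eqP.
  by rewrite addr_eq0 => /eqP.
rewrite /nstar /conj_prod fps_mulE !big_ord_recl big_ord0 /= addr0 geom_0 mul1r.
rewrite geom_1 sprod_0 sprod_1 !fcstM unit_0 !mulr1 prodA_1 unit1r !unit1l.
rewrite ?mulr1. move: (\sum_i _) (e 1%N) => s e1; ring.
Qed.

End StarAlgebra.

(** * Comparison of flows with multi-index sums *)

Section TaylorCoefficients.
Variables (m : nat) (A : comUnitRingType) (d : 'I_m -> {additive A -> A}).
Hypothesis natU : forall k, (k.+1%:R : A) \is a GRing.unit.
Hypothesis dL : forall s, leibniz (d s).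
Hypothesis dC : forall s t x, d s (d t x) = d t (d s x).
Implicit Types (c : 'I_m -> int) (x y : A) (al : multinom m) (r : seq 'I_m).

Definition multi_der r al x : A := foldr (fun s y => iter (al s) (d s) y) x r.

Lemma der_iter s t k x : d s (iter k (d t) x) = iter k (d t) (d s x).
Proof. by elim: k => //= k <-; rewrite dC. Qed.

Lemma multi_derU r al s x : uniq r ->
  multi_der r (mnm_add al (mnm1 s)) x =
  if s \in r then multi_der r al (d s x) else multi_der r al x.
Proof.
elim: r => //= t r IHr /andP[tr ur]; rewrite /multi_der /= -!/(multi_der _ _ _).
rewrite IHr // inE mnmDE mnm1E; have [<-|ts] /= := eqVneq t s; last first.
  by rewrite addn0; case: ifP.
rewrite (negbTE tr) addn1 iterSr; congr (iter _ _ _).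
elim: r {IHr tr ur} => //= s' r IHr; by rewrite der_iter IHr.
Qed.

Lemma mcoeff0_euler c p : mcoeff mnm0 (euler d c p) = 0.
Proof.
rewrite /euler raddf_sum big1 // => s _ /=.
rewrite raddfMz /= mcoeffXUM mnm0E eqxx mul0rz //.
Qed.

(** Induction on the degree of [al]: lowering one exponent corresponds to a y-derivative, which acts
    on the Taylor series as a derivation of its argument. As the derivations commute, any
    duplicate-free enumeration [r] of all variables will do. *)
Lemma mcoeff_taylor c r al k x : uniq r -> (forall s, s \in r) ->
  mcoeff al (taylor d c x k) =
  if mdeg al == k then (mfact al)%:R^-1 * (\prod_s c s ^+ al s)%:~R * multi_der r al x
  else 0.
Proof.
move=> ur rT; move alN: (mdeg al) => N; elim: N al alN k x => [|N IHN] al alN k x.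
  have /eqP -> : al == mnm0 by rewrite -mdeg_eq0 -alN.
  rewrite /taylor expo_cstE; case: k => [|k]; last first.
    by rewrite mcoeffZ /= mcoeff0_euler mulr0.
  rewrite fact0 invr1 scale1r /= mcoeffC eqxx mulr1.
  rewrite /mfact big1 ?invr1 => [|i _]; last by rewrite mnm0E.
  rewrite big1 => [|i _]; last by rewrite mnm0E expr0.
  rewrite mul1r mul1r /multi_der; elim: (r) => //= s r' <-; by rewrite mnm0E.
have : mdeg al != 0%N by rewrite alN.
rewrite mdegE sum_nat_eq0 negb_forall => /existsP[/= s als].
have le: mpoly.lem (mnm1 s) al by rewrite lep1mP.
have := submK le; move: (mnm_sub al _) => be eal.
have beN : mdeg be = N by apply/succn_inj; rewrite -alN -eal mdegD mdeg1 addn1.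
rewrite -eal.
apply: (@mulrI _ (be s).+1%:R); first exact: natU.
rewrite mulr_natl -mcoeff_mderiv.
have /(congr1 (fun V => V k)) := mderiv_taylor natU dC c s x.
rewrite /fmap => ->.
case: k => [|k]; first by rewrite epsM0 mcoeff0 mulr0.
rewrite epsMS fpsMzE raddfMz /= (IHN be) // eqSS.
case: ifP; last by rewrite mul0rz mulr0.
move=> _; rewrite multi_derU // rT mfactU natrM invrM; last 2 first.
- exact: natU.
- have : (0 < mfact be)%N by apply: prodn_gt0 => i; exact: fact_gt0.
  by case: (mfact be).
rewrite (bigD1 s) //= [in RHS](bigD1 s) //= mnmDE mnm1E eqxx addn1 exprS.
have -> : \prod_(i < m | i != s) c i ^+ (mnm_add be (mnm1 s)) i = \prod_(i < m | i != s) c i ^+ be i.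
  by apply: eq_bigr => i nis; rewrite mnmDE mnm1E eq_sym (negbTE nis) addn0.
move: (\prod_(_ < _ | _) _) (c s ^+ _) => u v.
rewrite -mulrzl !intrM; move: (natU (be s)) => /mulVr; move: ((be s).+1%:R) => w; move: (w^-1) => w' W.
move: (multi_der _ _ _) (_^-1) => D F.
transitivity (w' * w * ((c s)%:~R * (F * (v%:~R * u%:~R) * D))); first by rewrite W mul1r.
ring.
Qed.

End TaylorCoefficients.

Section Bigraded.
Variables (n : nat) (A : comNzRingType).
Implicit Types (I J : multinom n) (al : multinom (n + n)).

Definition mjoin I J : multinom (n + n) :=
  Multinom (mktuple (fun s => match fintype.split s with inl i => I i | inr j => J j end)).
Definition mhol al : multinom n := Multinom (mktuple (fun i => al (lshift n i))).
Definition mahol al : multinom n := Multinom (mktuple (fun i => al (rshift n i))).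

Lemma mjoinl I J i : mjoin I J (lshift n i) = I i.
Proof. by rewrite mnmE -[lshift n i]/(unsplit (inl i)) unsplitK. Qed.

Lemma mjoinr I J i : mjoin I J (rshift n i) = J i.
Proof. by rewrite mnmE -[rshift n i]/(unsplit (inr i)) unsplitK. Qed.

Lemma mholK I J : mhol (mjoin I J) = I.
Proof. by apply/mnmP => i; rewrite mnmE mjoinl. Qed.

Lemma maholK I J : mahol (mjoin I J) = J.
Proof. by apply/mnmP => i; rewrite mnmE mjoinr. Qed.

Lemma mjoinK al : mjoin (mhol al) (mahol al) = al.
Proof.
apply/mnmP => s; case: (split_ordP s) => i ->; by rewrite ?mjoinl ?mjoinr mnmE.
Qed.

Lemma mdeg_mjoin I J : mdeg (mjoin I J) = (mdeg I + mdeg J)%N.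
Proof.
rewrite !mdegE big_split_ord /=; congr (_ + _)%N; apply: eq_bigr => i _.
  by rewrite mjoinl.
by rewrite mjoinr.
Qed.

Lemma mfact_mjoin I J : mfact (mjoin I J) = (mfact I * mfact J)%N.
Proof.
rewrite /mfact big_split_ord /=; congr (_ * _)%N; apply: eq_bigr => i _.
  by rewrite mjoinl.
by rewrite mjoinr.
Qed.

Lemma mpolyX_mjoin I J : mpolyX A (mjoin I J) =
  (\prod_(i < n) mpolyX A (mnm1 (lshift n i)) ^+ I i) *
  (\prod_(j < n) mpolyX A (mnm1 (rshift n j)) ^+ J j).
Proof.
rewrite mpolyXE_id big_split_ord /=; congr (_ * _); apply: eq_bigr => i _.
  by rewrite mjoinl.
by rewrite mjoinr.
Qed.

Lemma mcoeff_sum2 N (Q : multinom n -> multinom n -> bool) (c : multinom n -> multinom n -> A) al :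
  (forall I J, Q I J -> (mdeg I + mdeg J < N)%N) ->
  mcoeff al (\sum_(I : bmultinom n N) \sum_(J : bmultinom n N | Q I J)
               c I J *: mpolyX A (mjoin I J)) =
  if Q (mhol al) (mahol al) then c (mhol al) (mahol al) else 0.
Proof.
move=> QN; rewrite raddf_sum /=.
under eq_bigr => I _ do rewrite raddf_sum /=.
case: ifP => Qal; last first.
  rewrite big1 // => I _; rewrite big1 // => J QIJ.
  rewrite mcoeffZ mcoeffX; case: eqP => [E|]; last by rewrite mulr0.
  by move: Qal; rewrite -E mholK maholK QIJ.
have lt := QN _ _ Qal.
have ltI : (mdeg (mhol al) < N)%N by apply: leq_ltn_trans lt; exact: leq_addr.
have ltJ : (mdeg (mahol al) < N)%N by apply: leq_ltn_trans lt; exact: leq_addl.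
rewrite (bigD1 (BMultinom ltI)) //= (bigD1 (BMultinom ltJ)) //=.
rewrite mcoeffZ mcoeffX mjoinK eqxx mulr1 !big1 ?addr0 //.
  move=> I nI; rewrite big1 // => J QIJ; rewrite mcoeffZ mcoeffX.
  case: eqP => [E|]; last by rewrite mulr0.
  by case/eqP: nI; apply: val_inj; rewrite /= -E mholK.
move=> J /andP[QIJ nJ]; rewrite mcoeffZ mcoeffX.
case: eqP => [E|]; last by rewrite mulr0.
by case/eqP: nJ; apply: val_inj; rewrite /= -E maholK.
Qed.

Lemma mcoeff_sum1 (emb : multinom n -> multinom (n + n)) (pr : multinom (n + n) -> multinom n)
  N (Q : multinom n -> bool) (c : multinom n -> A) al :
  (forall I, pr (emb I) = I) -> (forall I, Q I -> (mdeg I < N)%N) ->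
  mcoeff al (\sum_(I : bmultinom n N | Q I) c I *: mpolyX A (emb I)) =
  if (emb (pr al) == al) && Q (pr al) then c (pr al) else 0.
Proof.
move=> embK QN; rewrite raddf_sum /=; case: ifP => [/andP[/eqP Ea Qal]|Qal]; last first.
  rewrite big1 // => I QI; rewrite mcoeffZ mcoeffX; case: eqP => [E|]; last by rewrite mulr0.
  by move: Qal; rewrite -E embK eqxx QI.
rewrite (bigD1 (BMultinom (QN _ Qal))) //= mcoeffZ mcoeffX Ea eqxx mulr1 big1 ?addr0 //.
move=> I /andP[_ nI]; rewrite mcoeffZ mcoeffX; case: eqP => [E|]; last by rewrite mulr0.
by case/eqP: nI; apply: val_inj; rewrite /= -E embK.
Qed.

End Bigraded.

Section WickMorphism.
Variables (m : nat) (A B : comUnitRingType) (f : {rmorphism A -> B}).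
Hypothesis natU : forall k, (k.+1%:R : A) \is a GRing.unit.
Variable Q : mpoly m A.

Lemma map_expQ N : map_mpoly f (expQ Q N) = expQ (map_mpoly f Q) N.
Proof.
rewrite /expQ raddf_sum; apply: eq_bigr => k _ /=.
by rewrite map_mpolyZ rmorphXn /= rmorphV ?factU // rmorph_nat.
Qed.

Lemma map_wick_moment al : f (wick_moment Q al) = wick_moment (map_mpoly f Q) al.
Proof. by rewrite /wick_moment rmorphM rmorph_nat -map_expQ mcoeff_map_mpoly. Qed.

Lemma map_wick p : f (wick Q p) = wick (map_mpoly f Q) (map_mpoly f p).
Proof.
(* The morphism may annihilate coefficients, so the two sums are compared over a common degree range
   rather than over supports. *)
pose N := maxn (msize p) (msize (map_mpoly f p)).
rewrite (@wickwE _ _ _ N) ?leq_maxl // (@wickwE _ _ _ N) ?leq_maxr // raddf_sum.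
by apply: eq_bigr => al _ /=; rewrite rmorphM mcoeff_map_mpoly map_wick_moment.
Qed.

Lemma mcoeff_map_mpoly4 (u v w t : mpoly m A) al :
  mcoeff al (map_mpoly f (u + v - w - t)) =
  mcoeff al (map_mpoly f u) + mcoeff al (map_mpoly f v) -
  mcoeff al (map_mpoly f w) - mcoeff al (map_mpoly f t).
Proof. by rewrite !mcoeff_map_mpoly mcoeffB mcoeffB mcoeffD !raddfB raddfD. Qed.

End WickMorphism.

Lemma phaseS n (A : comUnitRingType) (d : 'I_(n + n) -> {additive A -> A}) (Phi : A) k :
  phase d Phi k.+1 = fshift d 0 1 Phi k.+3 + fshift d 1 0 Phi k.+3 -
    fshift d 0 0 Phi k.+3 - fshift d 1 1 Phi k.+3.
Proof. by rewrite /phase addr0. Qed.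

Lemma map_fps_mul (P Q : comPzRingType) (f : {rmorphism P -> Q}) (a b : nat -> Q)
    (a' b' : fps P) k : (forall j, a j = f (a' j)) -> (forall j, b j = f (b' j)) ->
  fps_mul a b k = f ((a' * b') k).
Proof.
move=> ea eb; rewrite fps_mulE rmorph_sum; apply: eq_bigr => j _ /=.
by rewrite rmorphM ea eb.
Qed.

Lemma fps_mulZr (A : comUnitRingType) m (c : A) (a b : fps (mpoly m A)) k :
  (a * ((fun j => c *: b j) : fps (mpoly m A))) k = c *: (a * b) k.
Proof.
by rewrite !fps_mulE scaler_sumr; apply: eq_bigr => j _; rewrite scalerAr.
Qed.

(** * Constants as scalars; the trace property for series *)

Section ScalarBilinearity.
Variables (n : nat) (A : comUnitRingType) (d : 'I_(n + n) -> {additive A -> A}).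
Hypothesis natU : forall k, (k.+1%:R : A) \is a GRing.unit.
Hypothesis dL : forall s, leibniz (d s).
Variables (Phi c : A).
Hypothesis dc : forall s, d s c = 0.
Local Notation P := (mpoly (n + n) A).
Local Notation prod := (prodA d Phi).

Lemma shift_scalar (r s : int) : fshift d r s c = fcst (mpolyC _ c).
Proof.
apply/funext => k; rewrite shiftE //; case: k => [|k].
  by rewrite fact0 invr1 scale1r.
rewrite iterSr (_ : euler _ _ _ = 0) ?iter_raddf0 ?scaler0 //.
by rewrite /euler big1 // => t _; rewrite cderC dc raddf0 mulr0 mul0rz.
Qed.

Let scalar_even (V : fps A) : (fun k => (fcst c * V) k.*2) = fcst c * (fun k => V k.*2).
Proof. by apply/funext => k; rewrite !fcstM. Qed.

Lemma prodA_scalarl x y : prod (c * x) y = fcst c * prod x y.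
Proof.
rewrite /prodA -scalar_even /eprod -fmap_nwick_mul; apply/funext => k.
by rewrite /kernel shiftM // shift_scalar -!mulrA.
Qed.

Lemma prodA_scalarr x y : prod x (c * y) = fcst c * prod x y.
Proof.
rewrite /prodA -scalar_even /eprod -fmap_nwick_mul; apply/funext => k.
rewrite /kernel shiftM // shift_scalar -!mulrA.
by rewrite [fshift d 0 1 x * (_ * _)]mulrCA.
Qed.

Lemma sprod_scalarl a b : sprod prod (fcst c * a) b = fcst c * sprod prod a b.
Proof.
rewrite /sprod -conv_fcst; apply: eq_conv => i; rewrite -conv_fcst; apply: eq_conv => j.
by rewrite fcstM prodA_scalarl.
Qed.

Lemma sprod_scalarr a b : sprod prod a (fcst c * b) = fcst c * sprod prod a b.
Proof.
rewrite /sprod -conv_fcst; apply: eq_conv => i; rewrite -conv_fcst; apply: eq_conv => j.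
by rewrite fcstM prodA_scalarr.
Qed.

Lemma nstar_linearl e a b u :
  nstar d Phi e (fcst c * a + b) u = fcst c * nstar d Phi e a u + nstar d Phi e b u.
Proof.
rewrite /nstar /conj_prod mulrDl -mulrA (sprodDl (prodADl d Phi)) sprod_scalarl.
by rewrite mulrDr mulrCA.
Qed.

Lemma nstar_linearr e a b u :
  nstar d Phi e u (fcst c * a + b) = fcst c * nstar d Phi e u a + nstar d Phi e u b.
Proof.
rewrite /nstar /conj_prod mulrDl -mulrA (sprodDr (prodADr d Phi)) sprod_scalarr.
by rewrite mulrDr mulrCA.
Qed.

End ScalarBilinearity.

Lemma sum_ord_triangleC (V : nmodType) (F : nat -> nat -> nat -> V) k :
  \sum_(i < k.+1) \sum_(j < (k - i).+1) F i j (k - i - j)%N =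
  \sum_(i < k.+1) \sum_(j < (k - i).+1) F j i (k - i - j)%N.
Proof.
rewrite -(sum_ord_triangle F) -(sum_ord_triangle (fun j i => F i j)).
apply: eq_bigr => i _; rewrite (reindex_inj rev_ord_inj).
apply: eq_bigr => j _; rewrite /= subSS subKn //; exact: leq_ord.
Qed.

Section SeriesIdeal.
Variables (n : nat) (A : comUnitRingType) (d : 'I_(n + n) -> {additive A -> A}).
Hypothesis natU : forall k, (k.+1%:R : A) \is a GRing.unit.
Hypothesis dL : forall s, leibniz (d s).
Hypothesis dC : forall s t x, d s (d t x) = d t (d s x).
Variables (Phi : A).
Hypothesis hU : hmat d Phi \in unitmx.
Variable I : A -> Prop.
Hypothesis I0 : I 0.
Hypothesis ID : forall x y, I x -> I y -> I (x + y).
Hypothesis IM : forall a x, I x -> I (a * x).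
Hypothesis Ider : forall s x, I x -> I (d s x).
Local Notation prod := (prodA d Phi).
Local Notation sprod := (sprod prod).

Let Isum (T : Type) (r : seq T) (F : T -> A) : (forall i, I (F i)) -> I (\sum_(i <- r) F i).
Proof. by move=> IF; elim/big_ind: _. Qed.

(** A truncated condition: the supports of the coefficients of a series may grow with the order, so
    one compact set is available only up to a given order. *)
Definition ideal_upto (k : nat) (a : fps A) : Prop := forall i, (i <= k)%N -> I (a i).

Lemma ideal_uptoM k a b : ideal_upto k b -> ideal_upto k (a * b).
Proof.
move=> Ib i ik; rewrite fps_mulE; apply: Isum => j; apply: IM; apply: Ib.
exact: leq_trans (leq_subr _ _) ik.
Qed.

Lemma ideal_upto_sprod k a b : ideal_upto k a -> ideal_upto k (sprod a b).
Proof.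
move=> Ia i ik; rewrite /sprod /conv; apply: Isum => j; apply: Isum => l.
apply: prodA_ideal => //; apply: Ia; apply: leq_trans ik.
by rewrite -ltnS ltn_ord.
Qed.

Lemma sprod_trace k a b : ideal_upto k a ->
  divergence d I (hdet d Phi * (sprod a b k - sprod b a k)).
Proof.
move=> Ia.
have E : sprod b a k = \sum_(i < k.+1) \sum_(j < (k - i).+1) prod (b j) (a i) (k - i - j)%N.
  exact: (sum_ord_triangleC (fun i j m => prod (b i) (a j) m)).
rewrite E /sprod /conv -sumrB mulr_sumr.
elim/big_ind: _ => [|x y|i _]; first exact: divergence0.
  exact: divergenceD.
rewrite -sumrB mulr_sumr.
elim/big_ind: _ => [|x y|j _]; first exact: divergence0.
  exact: divergenceD.
exact: (prodA_trace natU dL dC hU I0 ID IM Ider (b j) _ (Ia i (leq_ord i))).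
Qed.

End SeriesIdeal.

Lemma map_fps_pow (P Q : comPzRingType) (f : {rmorphism P -> Q}) (a : nat -> Q)
    (a' : fps P) m k : (forall j, a j = f (a' j)) -> fps_pow a m k = f ((a' ^+ m) k).
Proof.
move=> ea; elim: m k => [|m IHm] k; first by rewrite expr0 fps_oneE rmorph_nat.
by rewrite exprS; exact: map_fps_mul.
Qed.

(** * Symmetry of second directional derivatives *)

Section MixedDerivatives.
Variables (R : realType) (V : normedModType R).
Implicit Types (f : V -> R) (v w x z : V).

Lemma is_derive_line f v x (h : R) : derivable f (x + h *: v) v ->
  is_derive h 1 (fun t : R => f (x + t *: v)) ('D_v f (x + h *: v)).
Proof.
move=> df.
have E : (fun k : R => k^-1 *: (((fun t : R => f (x + t *: v)) \o shift h) (k *: 1)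
      - f (x + h *: v))) =
    (fun k : R => k^-1 *: ((f \o shift (x + h *: v)) (k *: v) - f (x + h *: v))).
  apply/funext => k /=; congr (_ *: (f _ - _)).
  by rewrite [k *: 1]mulr1 scalerDl addrCA addrA.
by apply: DeriveDef; [rewrite /derivable E|rewrite /derive E].
Qed.

Lemma MVT_line f v x (h : R) : 0 < h -> (forall y, derivable f y v) ->
  exists2 c, 0 < c < h & f (x + h *: v) - f x = h * 'D_v f (x + c *: v).
Proof.
move=> h0 df.
have [||c] := @MVT R (fun t => f (x + t *: v)) (fun t => 'D_v f (x + t *: v)) 0 h h0.
- by move=> t _; exact: is_derive_line.
- apply: derivable_within_continuous => t _.
  by have /@ex_derive := is_derive_line (df (x + t *: v)).
rewrite in_itv /= => ch; rewrite scale0r addr0 subr0 mulrC => E.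
by exists c.
Qed.

(** The mean value theorem is used twice: along v for the increment of f in direction w, then along
    w for the derivative of f along v. *)
Lemma second_difference f v w z (h : R) : 0 < h ->
  (forall y, derivable f y v) -> (forall y, derivable ('D_v f) y w) ->
  exists c c', [/\ 0 < c < h, 0 < c' < h &
    f (z + h *: w + h *: v) - f (z + h *: v) - (f (z + h *: w) - f z) =
    h * (h * 'D_w ('D_v f) (z + c *: v + c' *: w))].
Proof.
move=> h0 df ddf.
pose u y := f (y + h *: w) - f y.
have du y : is_derive y v u ('D_v f (y + h *: w) - 'D_v f y).
  apply: is_deriveB; last exact: derivableP.
  have := derivableP (df (y + h *: w)) => -[d1 d2].
  have E : (fun k : R => k^-1 *: (((fun y => f (y + h *: w)) \o shift y) (k *: v)
       - f (y + h *: w))) =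
     (fun k : R => k^-1 *: ((f \o shift (y + h *: w)) (k *: v) - f (y + h *: w))).
    by apply/funext => k /=; rewrite addrA.
  by apply: DeriveDef; [rewrite /derivable E|rewrite /derive E].
have [c ch E] := MVT_line z h0 (fun y => @ex_derive _ _ _ _ _ _ _ (du y)).
have [c' ch' E'] := MVT_line (z + c *: v) h0 ddf.
exists c, c'; split=> //.
rewrite -E' -(@derive_val _ _ _ _ _ _ _ (du _)) -E /u; congr (f _ - _ - _).
by rewrite addrAC.
Qed.

Let close_trans (x a e : R) : `|a - x| < e -> forall b, `|b - x| < e -> `|a - b| < e + e.
Proof.
move=> ax c cx; rewrite -(subrKA x); apply: le_lt_trans (ler_normD _ _) _.
by rewrite ltrD // distrC.
Qed.

(** The second difference is symmetric in v and w, so the two mixed derivatives agree at suitable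
    points as close to z as desired; continuity carries this to z. *)
Lemma schwarz f v w z :
  (forall y, derivable f y v) -> (forall y, derivable f y w) ->
  (forall y, derivable ('D_v f) y w) -> (forall y, derivable ('D_w f) y v) ->
  {for z, continuous ('D_w ('D_v f))} -> {for z, continuous ('D_v ('D_w f))} ->
  'D_w ('D_v f) z = 'D_v ('D_w f) z.
Proof.
move=> dv dw dvw dwv cvw cwv.
apply/eqP; apply: contraT => neq.
pose e := `|'D_w ('D_v f) z - 'D_v ('D_w f) z| / 2.
have e0 : 0 < e by rewrite divr_gt0 // normr_gt0 subr_eq0.
have [r /= r0 H1] := (nbhs_ballP _ _).1 ((cvgrPdist_lt _ _).1 cvw e e0).
have [r' /= r'0 H2] := (nbhs_ballP _ _).1 ((cvgrPdist_lt _ _).1 cwv e e0).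
pose m := Num.min r r'.
have m0 : 0 < m by rewrite lt_min r0.
(* With h = m / K all intermediate points lie within m of z; adding 1 keeps K positive even if both
   directions vanish. *)
pose K := `|v| + `|w| + 1.
have K0 : 0 < K by rewrite ltr_wpDl // addr_ge0.
pose h := m / K.
have h0 : 0 < h by rewrite divr_gt0.
have near_z (a b : R) (v' w' : V) : (`|v'| + `|w'| = `|v| + `|w|) ->
    0 < a < h -> 0 < b < h -> `|z - (z + a *: v' + b *: w')| < m.
  move=> vw /andP[a0 ah] /andP[b0 bh].
  rewrite -addrA opprD addrA subrr sub0r normrN.
  apply: le_lt_trans (ler_normD _ _) _; rewrite !normrZ !gtr0_norm //.
  apply: (@le_lt_trans _ _ (h * (`|v| + `|w|))).
    by rewrite -vw mulrDr lerD // ler_wpM2r // ltW.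
  by rewrite /h mulrAC ltr_pdivrMr // ltr_pM2l // /K ltrDl.
have [c [c' [ch c'h E]]] := second_difference z h0 dv dvw.
have [d [d' [dh d'h E']]] := second_difference z h0 dw dwv.
have EE : 'D_w ('D_v f) (z + c *: v + c' *: w) = 'D_v ('D_w f) (z + d *: w + d' *: v).
  have hn0 : h != 0 by rewrite gt_eqF.
  have swap (a1 a2 a3 a4 : R) : a1 - a2 - (a3 - a4) = a1 - a3 - (a2 - a4) by ring.
  have Z : z + h *: v + h *: w = z + h *: w + h *: v by rewrite addrAC.
  rewrite Z in E'; have EE' := etrans (esym E) (etrans (swap _ _ _ _) E').
  exact: (mulfI hn0 (mulfI hn0 EE')).
have B1 := H1 (z + c *: v + c' *: w).
have B2 := H2 (z + d *: w + d' *: v).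
have {}B1 : `|'D_w ('D_v f) z - 'D_w ('D_v f) (z + c *: v + c' *: w)| < e.
  by apply: B1; rewrite -ball_normE /=; apply: lt_le_trans (near_z _ _ _ _ erefl ch c'h) _; rewrite ge_min lexx.
have {}B2 : `|'D_v ('D_w f) z - 'D_v ('D_w f) (z + d *: w + d' *: v)| < e.
  apply: B2; rewrite -ball_normE /=; apply: lt_le_trans (near_z _ _ _ _ (addrC _ _) dh d'h) _.
  by rewrite ge_min lexx orbT.
have := close_trans B1; rewrite {1}EE => /(_ _ B2).
by rewrite /e -splitr ltxx.
Qed.

End MixedDerivatives.

(** * Closure properties of smooth functions *)

Section SmoothReal.
Variables (R : realType) (n : nat).
Implicit Types (f g : Cn R n -> R) (s : 'I_n + 'I_n).
Local Notation dir s := (coord_dir R s).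

Lemma Ck_cont k f : Ck_fun k f -> continuous f.
Proof. by case: k => [|k] []. Qed.

Lemma Ck_le k f : Ck_fun k.+1 f -> Ck_fun k f.
Proof.
elim: k f => [|k IHk] f [cf df]; first by split.
by split=> // s; have [dfs /IHk] := df s.
Qed.

Lemma Ck_cst k (c : R) : Ck_fun k (fun _ : Cn R n => c).
Proof.
elim: k c => [|k IHk] c; split=> //; try exact: cst_continuous.
move=> s; split=> [z|]; first exact: derivable_cst.
rewrite (_ : (fun z => 'D_(dir s) _ z) = fun=> 0); first exact: IHk.
by apply/funext => z; rewrite derive_cst.
Qed.

Lemma CkD k f g : Ck_fun k f -> Ck_fun k g -> Ck_fun k (fun z => f z + g z).
Proof.
elim: k f g => [|k IHk] f g [cf df] [cg dg]; split=> //.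
- by move=> z; apply: cvgD; [exact: cf|exact: cg].
- by move=> z; apply: cvgD; [exact: cf|exact: cg].
- move=> s; have [dfs kf] := df s; have [dgs kg] := dg s; split=> [z|].
    by apply: derivableD; [exact: dfs|exact: dgs].
  rewrite (_ : (fun z => 'D_(dir s) _ z) = fun z => 'D_(dir s) f z + 'D_(dir s) g z).
    exact: IHk.
  by apply/funext => z; rewrite -deriveD.
Qed.

Lemma CkM k f g : Ck_fun k f -> Ck_fun k g -> Ck_fun k (fun z => f z * g z).
Proof.
elim: k f g => [|k IHk] f g Cf Cg.
  by split=> // z; apply: cvgM; [exact: Cf.1|exact: Cg.1].
have [cf df] := Cf; have [cg dg] := Cg; split.
  by move=> z; apply: cvgM; [exact: cf|exact: cg].
move=> s; have [dfs kf] := df s; have [dgs kg] := dg s; split=> [z|].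
  by apply: derivableM; [exact: dfs|exact: dgs].
rewrite (_ : (fun z => 'D_(dir s) _ z) =
    fun z => f z * 'D_(dir s) g z + g z * 'D_(dir s) f z).
  by apply: CkD; apply: IHk => //; exact: Ck_le.
by apply/funext => z; rewrite -[LHS]/('D_(dir s) (f * g) z) deriveM.
Qed.

Lemma CkN k f : Ck_fun k f -> Ck_fun k (fun z => - f z).
Proof.
move=> Cf; rewrite (_ : (fun z => _) = fun z => -1 * f z).
  by apply: CkM => //; exact: Ck_cst.
by apply/funext => z; rewrite mulN1r.
Qed.

Lemma CkV k f : (forall z, f z != 0) -> Ck_fun k f -> Ck_fun k (fun z => (f z)^-1).
Proof.
move=> f0; elim: k => [|k IHk] Cf.
  by split=> // z; apply: cvgV => //; exact: Cf.1.
have [cf df] := Cf; split.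
  by move=> z; apply: cvgV => //; exact: cf.
move=> s; have [dfs kf] := df s; split=> [z|]; first exact: derivableV.
rewrite (_ : (fun z => 'D_(dir s) _ z) =
    fun z => - ((f z)^-1 * (f z)^-1 * 'D_(dir s) f z)).
  by apply: CkN; apply: CkM => //; apply: CkM; apply: IHk; exact: Ck_le.
by apply/funext => z; rewrite deriveV // -exprVn expr2 [LHS]mulNr.
Qed.

Lemma smooth_real_cst c : smooth_real (fun _ : Cn R n => c).
Proof. by move=> k; exact: Ck_cst. Qed.

Lemma smooth_realD f g : smooth_real f -> smooth_real g ->
  smooth_real (fun z => f z + g z).
Proof. by move=> Cf Cg k; exact: CkD. Qed.

Lemma smooth_realM f g : smooth_real f -> smooth_real g ->
  smooth_real (fun z => f z * g z).
Proof. by move=> Cf Cg k; exact: CkM. Qed.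

Lemma smooth_realN f : smooth_real f -> smooth_real (fun z => - f z).
Proof. by move=> Cf k; exact: CkN. Qed.

Lemma smooth_realV f : (forall z, f z != 0) -> smooth_real f ->
  smooth_real (fun z => (f z)^-1).
Proof. by move=> f0 Cf k; exact: CkV. Qed.

Lemma smooth_real_derivable f s z : smooth_real f -> derivable f z (dir s).
Proof. by move=> Cf; have [_ /(_ s) []] := Cf 1%N. Qed.

Lemma smooth_real_derive f s : smooth_real f -> smooth_real ('D_(dir s) f).
Proof. by move=> Cf k; have [_ /(_ s) []] := Cf k.+1. Qed.

Lemma smooth_real_cont f : smooth_real f -> continuous f.
Proof. by move=> /(_ 0%N) []. Qed.

Lemma smooth_real_schwarz f s t z : smooth_real f ->
  'D_(dir s) ('D_(dir t) f) z = 'D_(dir t) ('D_(dir s) f) z.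
Proof.
move=> Cf; have CD u := smooth_real_derive u Cf.
apply: schwarz.
- by move=> y; exact: smooth_real_derivable.
- by move=> y; exact: smooth_real_derivable.
- by move=> y; exact: smooth_real_derivable (CD t).
- by move=> y; exact: smooth_real_derivable (CD s).
- exact: (smooth_real_cont (smooth_real_derive s (CD t))).
- exact: (smooth_real_cont (smooth_real_derive t (CD s))).
Qed.

Lemma derive_affine (f : Cn R n -> R) (a : R) s :
  (forall z (h : R), f (h *: dir s + z) = h * a + f z) -> forall z, is_derive z (dir s) f a.
Proof.
move=> fa z.
have E : ((fun h : R => h^-1 *: ((f \o shift z) (h *: dir s) - f z)) @ 0^' --> a)%classic.
  apply: cvg_near_cst; near=> h.
  rewrite /= fa addrK [_ *: _]mulrA mulVf ?mul1r //.
  by near: h; exact: nbhs_dnbhs_neq.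
by apply: DeriveDef; [apply/cvg_ex; exists a|exact: cvg_lim E].
Unshelve. all: by end_near. Qed.

End SmoothReal.

Section ComplexParts.
Variable R : rcfType.
Implicit Types x y : R[i].

Lemma ReD x y : complex.Re (x + y) = complex.Re x + complex.Re y.
Proof. by case: x => a b; case: y. Qed.
Lemma ImD x y : complex.Im (x + y) = complex.Im x + complex.Im y.
Proof. by case: x => a b; case: y. Qed.
Lemma ReN x : complex.Re (- x) = - complex.Re x.
Proof. by case: x. Qed.
Lemma ImN x : complex.Im (- x) = - complex.Im x.
Proof. by case: x. Qed.
Lemma ReM x y : complex.Re (x * y) =
  complex.Re x * complex.Re y - complex.Im x * complex.Im y.
Proof. by case: x => a b; case: y. Qed.
Lemma ImM x y : complex.Im (x * y) =
  complex.Re x * complex.Im y + complex.Im x * complex.Re y.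
Proof. by case: x => a b; case: y. Qed.
Lemma ReV x : complex.Re x^-1 = complex.Re x / (complex.Re x ^+ 2 + complex.Im x ^+ 2).
Proof. by case: x. Qed.
Lemma ImV x : complex.Im x^-1 = - complex.Im x / (complex.Re x ^+ 2 + complex.Im x ^+ 2).
Proof. by case: x => a b /=; rewrite mulNr. Qed.

Lemma normsq_neq0 x : x != 0 -> complex.Re x ^+ 2 + complex.Im x ^+ 2 != 0.
Proof.
case: x => a b /=; apply: contraNneq => /eqP.
rewrite paddr_eq0 ?sqr_ge0 // !sqrf_eq0 => /andP[/eqP -> /eqP ->].
by rewrite eq_complex /= eqxx.
Qed.

Lemma complexP x y : complex.Re x = complex.Re y -> complex.Im x = complex.Im y -> x = y.
Proof. by case: x => a b; case: y => c d /= -> ->. Qed.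

End ComplexParts.

(** * The ring of complex smooth functions *)

Section SmoothComplex.
Variables (R : realType) (n : nat).
Implicit Types f g : Cn R n -> R[i].

Lemma smooth_cst (c : R[i]) : smooth (fun _ : Cn R n => c).
Proof. by split; exact: smooth_real_cst. Qed.

Lemma smoothD f g : smooth f -> smooth g -> smooth (fun z => f z + g z).
Proof.
move=> [rf jf] [rg jg]; split.
  by under eq_fun do rewrite ReD; exact: smooth_realD.
by under eq_fun do rewrite ImD; exact: smooth_realD.
Qed.

Lemma smoothN f : smooth f -> smooth (fun z => - f z).
Proof.
move=> [rf jf]; split.
  by under eq_fun do rewrite ReN; exact: smooth_realN.
by under eq_fun do rewrite ImN; exact: smooth_realN.
Qed.

Lemma smoothM f g : smooth f -> smooth g -> smooth (fun z => f z * g z).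
Proof.
move=> [rf jf] [rg jg]; split.
  under eq_fun do rewrite ReM; apply: smooth_realD; first exact: smooth_realM.
  exact/smooth_realN/smooth_realM.
by under eq_fun do rewrite ImM; apply: smooth_realD; exact: smooth_realM.
Qed.

Lemma smoothV f : (forall z, f z != 0) -> smooth f -> smooth (fun z => (f z)^-1).
Proof.
move=> f0 [rf jf].
have sq : smooth_real (fun z => (complex.Re (f z) ^+ 2 + complex.Im (f z) ^+ 2)^-1).
  apply: smooth_realV => [z|]; first exact: normsq_neq0.
  by apply: smooth_realD; exact: smooth_realM.
split.
  by under eq_fun do rewrite ReV; exact: smooth_realM.
under eq_fun do rewrite ImV; apply: smooth_realM => //.
exact: smooth_realN.
Qed.

(** Smoothness is stored as a boolean, so that two elements are equal as soon as the underlying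
    functions are. *)
Record smooth_fun := SmoothFun { sfun :> Cn R n -> R[i]; _ : `[< smooth sfun >] }.
HB.instance Definition _ := [isSub for sfun].
HB.instance Definition _ := [Choice of smooth_fun by <:].

Implicit Types x y : smooth_fun.

Lemma sfunP x : smooth x. Proof. by case: x => f /= /asboolP. Qed.

Definition mk_smooth f (sf : smooth f) : smooth_fun := SmoothFun (introT (asboolP _) sf).

Lemma sfun_ext x y : (forall z, x z = y z) -> x = y.
Proof. by move=> xy; apply/val_inj/funext. Qed.

Definition sfun_add x y := mk_smooth (smoothD (sfunP x) (sfunP y)).
Definition sfun_opp x := mk_smooth (smoothN (sfunP x)).
Definition sfun_mul x y := mk_smooth (smoothM (sfunP x) (sfunP y)).
Definition sfun_cst c := mk_smooth (smooth_cst c).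

Fact sfun_addA : associative sfun_add.
Proof. by move=> x y t; apply: sfun_ext => z /=; rewrite addrA. Qed.
Fact sfun_addC : commutative sfun_add.
Proof. by move=> x y; apply: sfun_ext => z /=; rewrite addrC. Qed.
Fact sfun_add0 : left_id (sfun_cst 0) sfun_add.
Proof. by move=> x; apply: sfun_ext => z /=; rewrite add0r. Qed.
Fact sfun_addN : left_inverse (sfun_cst 0) sfun_opp sfun_add.
Proof. by move=> x; apply: sfun_ext => z /=; rewrite addNr. Qed.
HB.instance Definition _ := GRing.isZmodule.Build smooth_fun
  sfun_addA sfun_addC sfun_add0 sfun_addN.

Fact sfun_mulA : associative sfun_mul.
Proof. by move=> x y t; apply: sfun_ext => z /=; rewrite mulrA. Qed.
Fact sfun_mulC : commutative sfun_mul.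
Proof. by move=> x y; apply: sfun_ext => z /=; rewrite mulrC. Qed.
Fact sfun_mul1 : left_id (sfun_cst 1) sfun_mul.
Proof. by move=> x; apply: sfun_ext => z /=; rewrite mul1r. Qed.
Fact sfun_mulDl : left_distributive sfun_mul +%R.
Proof. by move=> x y t; apply: sfun_ext => z /=; rewrite mulrDl. Qed.
Fact sfun_1_neq0 : sfun_cst 1 != 0.
Proof.
apply/eqP => /(congr1 (fun x : smooth_fun => x 0)) /= /eqP.
by rewrite oner_eq0.
Qed.
HB.instance Definition _ := GRing.Zmodule_isComNzRing.Build smooth_fun
  sfun_mulA sfun_mulC sfun_mul1 sfun_mulDl sfun_1_neq0.

Definition sfun_unit : pred smooth_fun := fun x => `[< forall z, x z != 0 >].

(** Functions with a zero are returned unchanged, as the ring structure prescribes for non-units. *)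
Definition sfun_inv x : smooth_fun :=
  if pselect (forall z, x z != 0) is left x0 then mk_smooth (smoothV x0 (sfunP x)) else x.

Fact sfun_mulV : {in sfun_unit, left_inverse 1 sfun_inv *%R}.
Proof.
move=> x /asboolP x0; rewrite /sfun_inv; case: pselect => // x0'.
by apply: sfun_ext => z /=; rewrite mulVf.
Qed.

Fact sfun_unitP x y : y * x = 1 -> sfun_unit x.
Proof.
move=> yx; apply/asboolP => z; have /(congr1 (fun x : smooth_fun => x z)) /= E := yx.
by apply/eqP => x0; move: E; rewrite x0 mulr0 => /esym/eqP; rewrite oner_eq0.
Qed.

Fact sfun_inv_out : {in [predC sfun_unit], sfun_inv =1 id}.
Proof.
move=> x /= /asboolPn x0; rewrite /sfun_inv; by case: pselect.
Qed.

HB.instance Definition _ := GRing.ComNzRing_hasMulInverse.Build smooth_fun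
  sfun_mulV sfun_unitP sfun_inv_out.

Lemma sfunDE x y z : (x + y) z = x z + y z. Proof. by []. Qed.
Lemma sfunME x y z : (x * y) z = x z * y z. Proof. by []. Qed.
Lemma sfunNE x z : (- x) z = - x z. Proof. by []. Qed.

Lemma sfun_unitE x : (x \is a GRing.unit) = `[< forall z, x z != 0 >].
Proof. by []. Qed.

Definition sfun_eval (z : Cn R n) x : R[i] := x z.

Fact sfun_eval_additive z : zmod_morphism (sfun_eval z).
Proof. by []. Qed.
Fact sfun_eval_multiplicative z : monoid_morphism (sfun_eval z).
Proof. by []. Qed.
HB.instance Definition _ z := GRing.isZmodMorphism.Build smooth_fun R[i]
  (sfun_eval z) (sfun_eval_additive z).
HB.instance Definition _ z := GRing.isMonoidMorphism.Build smooth_fun R[i]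
  (sfun_eval z) (sfun_eval_multiplicative z).

Lemma sfun_natE k z : (k%:R : smooth_fun) z = k%:R.
Proof. exact: (rmorph_nat (sfun_eval z)). Qed.

Lemma sfun_natU k : (k.+1%:R : smooth_fun) \is a GRing.unit.
Proof. by rewrite sfun_unitE; apply/asboolP => z; rewrite sfun_natE pnatr_eq0. Qed.

End SmoothComplex.

(** * Wirtinger derivatives as commuting derivations *)

Section Wirtinger.
Variables (R : realType) (n : nat).
Implicit Types (f g : Cn R n -> R[i]) (s t : 'I_n + 'I_n).

Lemma smooth_partial s f : smooth f -> smooth (real_partial s f).
Proof.
by move=> [rf jf]; split; apply: smooth_real_derive.
Qed.

Lemma real_partialD s f g z : smooth f -> smooth g ->
  real_partial s (fun w => f w + g w) z = real_partial s f z + real_partial s g z.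
Proof.
move=> [rf jf] [rg jg]; rewrite /real_partial.
have -> : (fun w => complex.Re (f w + g w)) =
    (fun w => complex.Re (f w)) + (fun w => complex.Re (g w)).
  by apply/funext => w; rewrite ReD.
have -> : (fun w => complex.Im (f w + g w)) =
    (fun w => complex.Im (f w)) + (fun w => complex.Im (g w)).
  by apply/funext => w; rewrite ImD.
by rewrite !deriveD //; exact: smooth_real_derivable.
Qed.

Lemma real_partialM s f g z : smooth f -> smooth g ->
  real_partial s (fun w => f w * g w) z =
  real_partial s f z * g z + f z * real_partial s g z.
Proof.
move=> [rf jf] [rg jg]; rewrite /real_partial.
rewrite (_ : (fun w => complex.Re (f w * g w)) = fun w =>
    complex.Re (f w) * complex.Re (g w) - complex.Im (f w) * complex.Im (g w)); last first.
  by apply/funext => w; rewrite ReM.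
rewrite (_ : (fun w => complex.Im (f w * g w)) = fun w =>
    complex.Re (f w) * complex.Im (g w) + complex.Im (f w) * complex.Re (g w)); last first.
  by apply/funext => w; rewrite ImM.
have drf := @smooth_real_derivable _ _ _ s z rf; have djf := @smooth_real_derivable _ _ _ s z jf.
have drg := @smooth_real_derivable _ _ _ s z rg; have djg := @smooth_real_derivable _ _ _ s z jg.
have M (a b : Cn R n -> R) : derivable a z (coord_dir R s) -> derivable b z (coord_dir R s) ->
    is_derive z (coord_dir R s) (fun w => a w * b w)
      (a z * 'D_(coord_dir R s) b z + b z * 'D_(coord_dir R s) a z).
  by move=> da db; apply: DeriveDef; [exact: derivableM|exact: deriveM].
have DRe := is_deriveB (M _ _ drf drg) (M _ _ djf djg).
have DIm := is_deriveD (M _ _ drf djg) (M _ _ djf drg).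
rewrite (@derive_val _ _ _ _ _ _ _ DRe) (@derive_val _ _ _ _ _ _ _ DIm).
apply: complexP; rewrite !(ReD, ReM, ImD, ImM) /=; ring.
Qed.

Lemma real_partial_comm s t f z : smooth f ->
  real_partial s (real_partial t f) z = real_partial t (real_partial s f) z.
Proof.
move=> [rf jf].
exact: (congr2 (@Complex R) (@smooth_real_schwarz _ _ _ s t z rf)
                            (@smooth_real_schwarz _ _ _ s t z jf)).
Qed.

(** One formula for both types of derivative: c = - i is the holomorphic case and c = i the
    antiholomorphic one. *)
Definition wirtinger (c : R[i]) (i : 'I_n) f (z : Cn R n) : R[i] :=
  (real_partial (inl i) f z + c * real_partial (inr i) f z) / 2%:R.

Lemma dzE i f : dz i f = wirtinger (- 'i%C) i f.
Proof. by apply/funext => z; rewrite /dz /wirtinger mulNr. Qed.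

Lemma dzbarE i f : dzbar i f = wirtinger 'i%C i f.
Proof. by []. Qed.

Lemma smooth_wirtinger c i f : smooth f -> smooth (wirtinger c i f).
Proof.
move=> sf; apply: smoothM; last exact: smooth_cst.
apply: smoothD; first exact: smooth_partial.
by apply: smoothM; [exact: smooth_cst|exact: smooth_partial].
Qed.

Lemma wirtingerD c i f g z : smooth f -> smooth g ->
  wirtinger c i (fun w => f w + g w) z = wirtinger c i f z + wirtinger c i g z.
Proof. by move=> sf sg; rewrite /wirtinger !real_partialD //; ring. Qed.

Lemma wirtingerM c i f g z : smooth f -> smooth g ->
  wirtinger c i (fun w => f w * g w) z =
  wirtinger c i f z * g z + f z * wirtinger c i g z.
Proof. by move=> sf sg; rewrite /wirtinger !real_partialM //; ring. Qed.

Lemma real_partial_cst s (a : R[i]) z : real_partial s (fun=> a) z = 0.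
Proof. by rewrite /real_partial !derive_cst. Qed.

Lemma real_partialZ s (a : R[i]) f z : smooth f ->
  real_partial s (fun w => a * f w) z = a * real_partial s f z.
Proof.
move=> sf; rewrite real_partialM //; last exact: smooth_cst.
by rewrite real_partial_cst mul0r add0r.
Qed.

Lemma real_partial_wirtinger s c i f z : smooth f ->
  real_partial s (wirtinger c i f) z = wirtinger c i (real_partial s f) z.
Proof.
move=> sf; have sp t := smooth_partial t sf.
have E : wirtinger c i f = fun w =>
    2%:R^-1 * (real_partial (inl i) f w + c * real_partial (inr i) f w).
  by apply/funext => w; rewrite /wirtinger mulrC.
have scp t : smooth (fun w => c * real_partial t f w).
  by apply: smoothM => //; exact: smooth_cst.
rewrite E real_partialZ; last by apply: smoothD.
rewrite real_partialD // real_partialZ //.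
by rewrite (real_partial_comm s (inl i)) // (real_partial_comm s (inr i)) // /wirtinger mulrC.
Qed.

Lemma wirtinger_comm c c' i j f z : smooth f ->
  wirtinger c i (wirtinger c' j f) z = wirtinger c' j (wirtinger c i f) z.
Proof.
move=> sf.
have E (a b : R[i]) k l : wirtinger a k (wirtinger b l f) z =
    (wirtinger b l (real_partial (inl k) f) z + a * wirtinger b l (real_partial (inr k) f) z)
    / 2%:R.
  by rewrite -!real_partial_wirtinger.
rewrite !E /wirtinger.
rewrite (@real_partial_comm (inl j) (inl i) f z sf) (@real_partial_comm (inl j) (inr i) f z sf).
rewrite (@real_partial_comm (inr j) (inl i) f z sf) (@real_partial_comm (inr j) (inr i) f z sf).
move: (real_partial (inl i) _ z) (real_partial (inl i) _ z) (real_partial (inr i) _ z).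
by move: (real_partial (inr i) _ z) => p q r s; ring.
Qed.

Local Notation A := (smooth_fun R n).

Definition holder (s : 'I_(n + n)) (x : A) : A :=
  match fintype.split s with
  | inl i => mk_smooth (smooth_wirtinger (- 'i%C) i (sfunP x))
  | inr j => mk_smooth (smooth_wirtinger 'i%C j (sfunP x))
  end.

Lemma holder_l i x z : holder (lshift n i) x z = dz i x z.
Proof. by rewrite /holder -[lshift n i]/(unsplit (inl i)) unsplitK dzE. Qed.

Lemma holder_r j x z : holder (rshift n j) x z = dzbar j x z.
Proof. by rewrite /holder -[rshift n j]/(unsplit (inr j)) unsplitK. Qed.

Fact holder_additive (s : 'I_(n + n)) : zmod_morphism (holder s).
Proof.
move=> x y; apply: sfun_ext => z; rewrite /holder.
have sN : smooth (fun w => - y w) by exact: smoothN (sfunP y).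
have N c i : wirtinger c i (fun w => - y w) z = - wirtinger c i y z.
  have := wirtingerD c i z (sfunP y) sN; under eq_fun do rewrite subrr.
  rewrite {1}/wirtinger !real_partial_cst mulr0 addr0 mul0r => /esym/eqP.
  by rewrite addrC addr_eq0 => /eqP.
by case: fintype.split => i /=; rewrite wirtingerD ?N //; exact: sfunP.
Qed.
HB.instance Definition _ (s : 'I_(n + n)) := GRing.isZmodMorphism.Build A A (holder s) (holder_additive s).

Lemma holder_leibniz (s : 'I_(n + n)) : leibniz (holder s).
Proof.
move=> x y; apply: sfun_ext => z; rewrite /holder.
by case: fintype.split => i /=; rewrite wirtingerM //; exact: sfunP.
Qed.

Lemma holder_comm (s t : 'I_(n + n)) x : holder s (holder t x) = holder t (holder s x).
Proof.
apply: sfun_ext => z; rewrite /holder.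
by case: fintype.split => i; case: fintype.split => j /=; apply: wirtinger_comm; exact: sfunP.
Qed.

Definition coordinate (j : 'I_n) (z : Cn R n) : R[i] := (z.1 0 j +i* z.2 0 j)%C.

Let is_derive_re j s (z : Cn R n) :
  is_derive z (coord_dir R s) (fun w : Cn R n => w.1 0 j)
    (if s is inl i then (i == j)%:R else 0).
Proof.
apply: derive_affine => {}z h; case: s => i /=.
  by rewrite !mxE eqxx andTb eq_sym.
by rewrite !mxE mulr0.
Qed.

Let is_derive_im j s (z : Cn R n) :
  is_derive z (coord_dir R s) (fun w : Cn R n => w.2 0 j)
    (if s is inr i then (i == j)%:R else 0).
Proof.
apply: derive_affine => {}z h; case: s => i /=.
  by rewrite !mxE mulr0.
by rewrite !mxE eqxx andTb eq_sym.
Qed.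

Let smooth_affine (f : Cn R n -> R) : continuous f ->
  (forall s, exists a, forall z, is_derive z (coord_dir R s) f a) -> smooth_real f.
Proof.
move=> cf df; case=> [|k]; first by split.
split=> // s; have [a da] := df s; split=> [z|]; first exact: (@ex_derive _ _ _ _ _ _ _ (da z)).
rewrite (_ : (fun z => 'D_(coord_dir R s) _ z) = fun=> a); first exact: Ck_cst.
by apply/funext => z; exact: (@derive_val _ _ _ _ _ _ _ (da z)).
Qed.

Lemma smooth_coordinate j : smooth (coordinate j).
Proof.
split; apply: smooth_affine => /=.
- move=> z; apply: (@continuous_comp _ _ _ fst (fun v : 'rV[R]_n => v 0 j)).
    exact: cvg_fst.
  exact: coord_continuous.
- by move=> s; exists (if s is inl i then (i == j)%:R else 0) => z; exact: is_derive_re.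
- move=> z; apply: (@continuous_comp _ _ _ snd (fun v : 'rV[R]_n => v 0 j)).
    exact: cvg_snd.
  exact: coord_continuous.
- by move=> s; exists (if s is inr i then (i == j)%:R else 0) => z; exact: is_derive_im.
Qed.

Definition coordA j : A := mk_smooth (smooth_coordinate j).

Lemma holder_coord i j : holder (lshift n i) (coordA j) = (i == j)%:R.
Proof.
apply: sfun_ext => z; rewrite holder_l sfun_natE dzE.
have E s : real_partial s (coordA j) z =
    ((if s is inl i then (i == j)%:R else 0) +i* (if s is inr i then (i == j)%:R else 0))%C.
  exact: (congr2 (@Complex R) (@derive_val _ _ _ _ _ _ _ (is_derive_re j s z))
                              (@derive_val _ _ _ _ _ _ _ (is_derive_im j s z))).
rewrite /wirtinger !E.
case: eqP => _; apply: complexP; rewrite !(ReM, ImM, ReD, ImD, ReN, ImN, ReV, ImV) /=; by field.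
Qed.

End Wirtinger.

Lemma prod_sgn2 n (a b : int) (al : multinom (n + n)) :
  \prod_s sgn2 a b s ^+ al s = a ^+ mdeg (mhol al) * b ^+ mdeg (mahol al).
Proof.
rewrite big_split_ord /= !mdegE; congr (_ * _).
  rewrite -prodrXr; apply: eq_bigr => i _; by rewrite sgn2l mnmE.
rewrite -prodrXr; apply: eq_bigr => i _; by rewrite sgn2r mnmE.
Qed.

(** * Identification of the given product with the algebraic one *)

Section Concrete.
Variables (R : realType) (n : nat).
Local Notation A := (smooth_fun R n).
Definition wder (s : 'I_(n + n)) : {additive A -> A} := holder s.
Local Notation d := wder.
Implicit Types (x y : A) (al : multinom (n + n)) (z : Cn R n).

Local Notation vars := (map (@lshift n n) (enum 'I_n) ++ map (@rshift n n) (enum 'I_n)).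

Let vars_uniq : uniq vars.
Proof.
rewrite cat_uniq (map_inj_uniq (@lshift_inj _ _)) (map_inj_uniq (@rshift_inj _ _)) !enum_uniq.
rewrite andbT /=; apply/hasPn => _ /mapP[i _ ->]; apply/mapP => -[j _ /eqP].
by rewrite eq_rlshift.
Qed.

Let mem_vars s : s \in vars.
Proof.
rewrite mem_cat; case: (split_ordP s) => i ->; apply/orP; [left|right];
  by rewrite map_f ?mem_enum.
Qed.

Lemma dzM_sfun al x :
  dzM (mhol al) x = multi_der d (map (@lshift n n) (enum 'I_n)) al x.
Proof.
rewrite /dzM /multi_der; elim: (enum 'I_n) => //= i r ->.
rewrite [mhol al i]mnmE; elim: (al _) => //= k ->.
by apply/funext => z; rewrite holder_l.
Qed.

Lemma dzbarM_sfun al x :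
  dzbarM (mahol al) x = multi_der d (map (@rshift n n) (enum 'I_n)) al x.
Proof.
rewrite /dzbarM /multi_der; elim: (enum 'I_n) => //= i r ->.
rewrite [mahol al i]mnmE; elim: (al _) => //= k ->.
by apply/funext => z; rewrite holder_r.
Qed.

Lemma dzM_dzbarM_sfun al x :
  dzM (mhol al) (dzbarM (mahol al) x) = multi_der d vars al x.
Proof. by rewrite dzbarM_sfun dzM_sfun /multi_der foldr_cat. Qed.

Lemma dzM0 (f : Cn R n -> R[i]) : dzM mnm0 f = f.
Proof. by rewrite /dzM; elim: (enum _) => //= i r ->; rewrite mnm0E. Qed.

Lemma dzbarM0 (f : Cn R n -> R[i]) : dzbarM mnm0 f = f.
Proof. by rewrite /dzbarM; elim: (enum _) => //= i r ->; rewrite mnm0E. Qed.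

(** Since 0 to the power 0 is 1, a zero in place of [a] or [b] selects exactly the multi-indices
    with no holomorphic, or no antiholomorphic, part; one formula thus serves all four shifts. *)
Lemma mcoeff_shift a b al k x z :
  mcoeff al (map_mpoly (sfun_eval z) (fshift d a b x k)) =
  if (mdeg (mhol al) + mdeg (mahol al) == k)%N then
    (mfactorial (mhol al) * mfactorial (mahol al))%:R^-1 *
    (a ^+ mdeg (mhol al) * b ^+ mdeg (mahol al))%:~R *
    dzM (mhol al) (dzbarM (mahol al) x) z
  else 0.
Proof.
have dL s := @holder_leibniz R n s; have dC s t u := @holder_comm R n s t u.
rewrite mcoeff_map_mpoly (mcoeff_taylor (@sfun_natU R n) dC _ _ _ _ vars_uniq mem_vars).
rewrite -mdeg_mjoin mjoinK; case: ifP => _; last by [].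
have muU : ((mfact al)%:R : A) \is a GRing.unit.
  have : (0 < mfact al)%N by apply: prodn_gt0 => i; exact: fact_gt0.
  by case: (mfact al) => // k' _; exact: sfun_natU.
have E (f : {rmorphism A -> R[i]}) c u :
    f ((mfact al)%:R^-1 * c%:~R * u) = (mfact al)%:R^-1 * c%:~R * f u.
  by rewrite !rmorphM rmorphV // rmorph_nat rmorph_int.
apply: (etrans (E (sfun_eval z) _ _)); rewrite prod_sgn2 dzM_dzbarM_sfun.
by rewrite -[in LHS](mjoinK al) mfact_mjoin mjoinK.
Qed.


Lemma mfactorial0 : mfactorial (@mnm0 n) = 1%N.
Proof. by rewrite /mfactorial big1 // => i _; rewrite mnm0E. Qed.

Lemma ymonE (I : multinom n) : ymon R I = mpolyX R[i] (mjoin I mnm0).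
Proof.
rewrite mpolyX_mjoin [X in _ * X]big1 ?mulr1 // => i _; by rewrite mnm0E expr0.
Qed.

Lemma ybarmonE (J : multinom n) : ybarmon R J = mpolyX R[i] (mjoin mnm0 J).
Proof.
rewrite mpolyX_mjoin [X in X * _]big1 ?mul1r // => i _; by rewrite mnm0E expr0.
Qed.

Lemma ymon_ybarmonE (I J : multinom n) : ymon R I * ybarmon R J = mpolyX R[i] (mjoin I J).
Proof. by rewrite mpolyX_mjoin. Qed.

Lemma series_F1E x z k :
  series_F1 x z k = map_mpoly (sfun_eval z) (fshift d 0 1 x k).
Proof.
apply/mpolyP => al; rewrite mcoeff_shift /series_F1.
under eq_bigr => J _ do rewrite ybarmonE.
rewrite (@mcoeff_sum1 _ _ (mjoin mnm0) (@mahol n) _ (fun J => mdeg J == k)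
  (fun J => (mfactorial J)%:R^-1 * dzbarM J x z)); last 2 first.
- exact: maholK.
- by move=> J /eqP ->.
rewrite expr1n mulr1.
have [al0|al0] := eqVneq (mhol al) mnm0.
  rewrite -[in X in X == al]al0 mjoinK eqxx andTb al0 mdeg0 add0n; case: ifP => // _.
  by rewrite expr0 mulr1 dzM0 mfactorial0 mul1n.
rewrite (_ : (_ == al) = false) /=; last first.
  by apply: contraNF al0 => /eqP <-; rewrite mholK.
by rewrite expr0n mdeg_eq0 (negbTE al0) mulr0 mul0r if_same.
Qed.

Lemma series_F2E x z k :
  series_F2 x z k = map_mpoly (sfun_eval z) (fshift d 1 0 x k).
Proof.
apply/mpolyP => al; rewrite mcoeff_shift /series_F2.
under eq_bigr => J _ do rewrite ymonE.
rewrite (@mcoeff_sum1 _ _ (fun I : multinom n => mjoin I mnm0) (@mhol n) _ (fun J => mdeg J == k)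
  (fun J => (mfactorial J)%:R^-1 * dzM J x z)); last 2 first.
- by move=> I; exact: mholK.
- by move=> J /eqP ->.
rewrite expr1n mul1r.
have [al0|al0] := eqVneq (mahol al) mnm0.
  rewrite -[in X in X == al]al0 mjoinK eqxx andTb al0 mdeg0 addn0; case: ifP => // _.
  by rewrite expr0 mulr1 dzbarM0 mfactorial0 muln1.
rewrite (_ : (_ == al) = false) /=; last first.
  by apply: contraNF al0 => /eqP <-; rewrite maholK.
by rewrite expr0n mdeg_eq0 (negbTE al0) mulr0 mul0r if_same.
Qed.

Variables (Phi : Cn R n -> R) (hPhi : kahler_potential Phi).

Lemma smooth_cplx_fun : smooth (cplx_fun Phi).
Proof. by split; [exact: hPhi.1|exact: smooth_real_cst]. Qed.

Definition PhiA : A := mk_smooth smooth_cplx_fun.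

Local Notation hmat := (hmat d PhiA).
Local Notation hdet := (hdet d PhiA).
Local Notation hinvmat := (hinvmat d PhiA).

Lemma metricE z : metric Phi z = map_mx (sfun_eval z) hmat.
Proof.
apply/matrixP => i j; rewrite !mxE /sfun_eval holder_l; congr (dz i _ z).
by apply/funext => w; rewrite holder_r.
Qed.

Lemma det_metricE : det_metric Phi = hdet.
Proof.
by apply/funext => z; rewrite /det_metric metricE det_map_mx.
Qed.

(** A nonzero vector in the left kernel would make the Hermitian form vanish on itself. *)
Lemma pos_def_det (M : 'M[R[i]]_n) : pos_def M -> \det M != 0.
Proof.
move=> Mpos; rewrite -unitfE -[_ \is a _]/(M \in unitmx) -row_free_unit -kermx_eq0.
apply/eqP/row_matrixP => k; rewrite row0; apply/eqP/negPn/negP => k0.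
have := Mpos _ k0; set v := row k _.
have vM : v *m M = 0 by rewrite -row_mul mulmx_ker row0.
rewrite exchange_big /= big1 ?ltxx // => j _; rewrite -mulr_suml.
have /matrixP/(_ 0 j) := vM; rewrite !mxE => ->; by rewrite mul0r.
Qed.

Lemma hmatU : hmat \in unitmx.
Proof.
rewrite unitmxE sfun_unitE; apply/asboolP => z.
by rewrite -[\det _]/hdet -det_metricE; apply: pos_def_det; exact: hPhi.2.
Qed.

Lemma inv_metricE z : inv_metric Phi z = map_mx (sfun_eval z) hinvmat.
Proof.
rewrite /inv_metric metricE map_trmx.
have : hinvmat *m hmat^T = 1%:M by rewrite mulVmx // unitmx_tr hmatU.
move=> /(congr1 (map_mx (sfun_eval z))); rewrite map_mxM map_mx1 => E.
have [_ U] := mulmx1_unit E.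
by rewrite -[RHS](mulmxK U) E mul1mx.
Qed.

Lemma meval0E (p : mpoly (n + n) R[i]) : meval (fun=> 0) p = mcoeff mnm0 p.
Proof.
elim/mpoly_lin_ind: p => [|p p' IHp IHp'|a al].
- by rewrite !raddf0.
- by rewrite !raddfD /= IHp IHp'.
rewrite mevalZ mcoeffZ mcoeffX mevalX; congr (_ * _).
have [->|al0] := eqVneq al mnm0.
  by rewrite big1 // => i _; rewrite mnm0E expr0.
move: al0; rewrite -mdeg_eq0 mdegE sum_nat_eq0 negb_forall => /existsP[/= s als].
by rewrite (bigD1 s) //= expr0n (negbTE als) mul0r.
Qed.

Lemma gauss_momentE z al : gauss_moment Phi z al = wick_moment (inv_metric_form Phi z) al.
Proof.
rewrite /gauss_moment /wick_moment -/(expQ _ _) meval0E mcoeff_mderivm addm0 mulr_natl.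
by congr (_ *+ _); apply: eq_bigr => i _; rewrite ffactnn.
Qed.

Lemma inv_metric_formE z :
  inv_metric_form Phi z = map_mpoly (sfun_eval z) (pairing hinvmat).
Proof.
rewrite /pairing raddf_sum; apply: eq_bigr => i _ /=; rewrite raddf_sum.
apply: eq_bigr => j _ /=; rewrite map_mpolyZ inv_metricE mxE -mpolyXD map_mpolyX.
by rewrite mpolyXD.
Qed.

Lemma gauss_E_map z p :
  gauss_E Phi z (map_mpoly (sfun_eval z) p) = sfun_eval z (wick (pairing hinvmat) p).
Proof.
rewrite (map_wick _ (@sfun_natU R n)) -inv_metric_formE /gauss_E /wick.
by apply: eq_bigr => al _; rewrite gauss_momentE.
Qed.

(** Inclusion and exclusion: at (I, J) the four shifts contribute [I = 0] + [J = 0] - [I = J = 0] -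
    1, which is -1 when both indices are nonzero and 0 otherwise. *)
Lemma series_SE z k : series_S Phi z k = map_mpoly (sfun_eval z) (phase d PhiA k).
Proof.
have dL s := @holder_leibniz R n s; have dC s t u := @holder_comm R n s t u.
apply/mpolyP => al; rewrite /series_S mcoeffN.
under eq_bigr => I _ do under eq_bigr => J _ do rewrite ymon_ybarmonE.
rewrite (@mcoeff_sum2 _ _ _ (fun I J => [&& (1 <= mdeg I)%N, (1 <= mdeg J)%N,
   (3 <= mdeg I + mdeg J)%N & (mdeg I + mdeg J == k.+2)%N]) (fun I J =>
   (mfactorial I * mfactorial J)%:R^-1 * dzM I (dzbarM J (cplx_fun Phi)) z)); last first.
  by move=> I J /and4P[_ _ _ /eqP ->].
case: k => [|k].
  rewrite (phase0 (@sfun_natU R n) dC) raddf0 mcoeff0; case: ifP; rewrite ?oppr0 //.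
  by move=> /and4P[_ _ + /eqP e]; rewrite e.
have E (u v w t : mpoly (n + n) A) cu cv cw ct (g := fun p => mcoeff al (map_mpoly (sfun_eval z) p)) :
    g u = cu -> g v = cv -> g w = cw -> g t = ct -> g (u + v - w - t) = cu + cv - cw - ct.
  by move=> <- <- <- <-; exact: (mcoeff_map_mpoly4 (sfun_eval z)).
rewrite phaseS (E _ _ _ _ _ _ _ _ (mcoeff_shift 0 1 _ _ _ _) (mcoeff_shift 1 0 _ _ _ _)
  (mcoeff_shift 0 0 _ _ _ _) (mcoeff_shift 1 1 _ _ _ _)).
rewrite !(expr1n, expr0n).
have -> : dzM (mhol al) (dzbarM (mahol al) PhiA) z =
    dzM (mhol al) (dzbarM (mahol al) (cplx_fun Phi)) z by [].
move: (dzM _ _ _) (_^-1) => D F.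
case: (mdeg (mhol al)) (mdeg (mahol al)) => [|a] [|b]; case: eqP => //= abk;
  rewrite ?(mulr0, mul0r, mulr1, mul1r, addr0, add0r, subr0, sub0r, oppr0, subrr) //.
  by rewrite abk.
by rewrite andbF oppr0.
Qed.

Lemma series_expSE z k :
  series_expS Phi z k = map_mpoly (sfun_eval z) (exps (phase d PhiA) k).
Proof.
rewrite /series_expS /exps raddf_sum; apply: eq_bigr => m _ /=.
rewrite map_mpolyZ fps_powE rmorphV; last by apply: factU; exact: sfun_natU.
rewrite rmorph_nat; congr (_ *: _).
move: {m}(m : nat) => m; elim: m k => [|j IHj] k; first by rewrite !expr0 !fps_oneE rmorph_nat.
rewrite !exprS !fps_mulE raddf_sum; apply: eq_bigr => i _ /=.
by rewrite [RHS]rmorphM IHj series_SE.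
Qed.

Lemma series_ME z k : series_M Phi z k =
  (sfun_eval z hdet)^-1 *: map_mpoly (sfun_eval z) (fshift d 1 1 hdet k).
Proof.
rewrite /series_M det_metricE; congr (_ *: _); apply/mpolyP => al.
under eq_bigr => I _ do under eq_bigr => J _ do rewrite ymon_ybarmonE.
rewrite (@mcoeff_sum2 _ _ _ (fun I J => (mdeg I + mdeg J == k)%N) (fun I J =>
   (mfactorial I * mfactorial J)%:R^-1 * dzM I (dzbarM J hdet) z)); last first.
  by move=> I J /eqP ->.
by rewrite mcoeff_shift !expr1n mulr1 mulr1.
Qed.

(** The series match factor by factor after evaluation at z; the factor 1 / det H of [series_M] is
    the one built into [nwick]. *)
Lemma bullet_funE x y k : bullet_fun Phi x y k = prodA d PhiA x y k.
Proof.
apply/funext => z; rewrite /bullet_fun /prodA /eprod /fmap /kernel /nwick.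
pose ev (p : mpoly (n + n) A) := map_mpoly (sfun_eval z) p.
pose M : fps (mpoly (n + n) A) := fun j => hdet^-1 *: fshift d 1 1 hdet j.
have E : fps_mul (fps_mul (fps_mul (series_F1 x z) (series_F2 y z))
    (series_expS Phi z)) (series_M Phi z) k.*2 =
    ev ((fshift d 0 1 x * fshift d 1 0 y * exps (phase d PhiA) * M) k.*2).
  apply: map_fps_mul => [i|i]; last first.
    have U : hdet \is a GRing.unit by exact: hmatU.
    rewrite series_ME -[(_ z hdet)^-1](rmorphV (sfun_eval z) U).
    exact/esym/(map_mpolyZ (sfun_eval z)).
  apply: map_fps_mul => [{}i|{}i]; last exact: series_expSE.
  by apply: map_fps_mul => [{}i|{}i]; [exact: series_F1E|exact: series_F2E].
by rewrite E gauss_E_map fps_mulZr wickZ.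
Qed.

End Concrete.

(** * The iterated Lebesgue measure on tuples *)

Section LebesgueTuple.
Variable R : realType.
Local Open Scope classical_set_scope.
Local Notation mR := (measurableTypeR R).

Definition box m (k : nat) : set (m.-tuple mR) :=
  [set t | forall i, `|tnth t i| <= k%:R].

Definition tuple_cons m (p : mR * m.-tuple mR) : m.+1.-tuple mR := cons_tuple p.1 p.2.

Lemma measurable_tuple_cons m : measurable_fun setT (@tuple_cons m).
Proof. exact: measurable_cons. Qed.

Lemma tnth_tuple_cons0 m p : tnth (@tuple_cons m p) ord0 = p.1.
Proof. by rewrite (tnth_nth p.1). Qed.

Lemma tnth_tuple_consS m p i : tnth (@tuple_cons m p) (lift ord0 i) = tnth p.2 i.
Proof. by rewrite !(tnth_nth p.1). Qed.

Lemma box_cons m k : @tuple_cons m @^-1` box k = `[- k%:R, k%:R] `*` box k.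
Proof.
apply/seteqP; split=> [[x t] /= H|[x t] /= [xk tk] i].
  split; first by have := H ord0; rewrite tnth_tuple_cons0 ler_norml in_itv.
  by move=> i; have := H (lift ord0 i); rewrite tnth_tuple_consS.
case: (unliftP ord0 i) => [j ->|->]; first by rewrite tnth_tuple_consS.
by rewrite tnth_tuple_cons0 ler_norml; move: xk; rewrite in_itv.
Qed.

Lemma measurable_box m k : measurable (@box m k).
Proof.
have -> : @box m k = \bigcap_(i in [set: 'I_m]) ((@tnth m mR)^~ i @^-1` `[- k%:R, k%:R]).
  apply/seteqP; split=> [t H i _|t H i] /=.
    by rewrite in_itv /= -ler_norml.
  by have /= := H i I; rewrite in_itv /= -ler_norml.
apply: fin_bigcap_measurable => [|i _]; first exact: finite_finset.
rewrite -[X in measurable X]setTI; apply: measurable_tnth => //.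
Qed.

Lemma bigcup_box m : \bigcup_k @box m k = setT.
Proof.
apply/seteqP; split=> // t _.
exists (\max_(i < m) (Num.truncn `|tnth t i|).+1)%N => // i /=.
apply/ltW/(lt_le_trans (truncnS_gt _)); rewrite ler_nat.
exact: (@leq_bigmax _ (fun i => (Num.truncn `|tnth t i|).+1) i).
Qed.

Section NextMeasure.
Variables (m : nat) (mu : {sigma_finite_measure set (m.-tuple mR) -> \bar R}).
Hypothesis mubox : forall k, (mu (box k) < +oo)%E.

Definition next_measure : set (m.+1.-tuple mR) -> \bar R :=
  pushforward (product_measure1 (@lebesgue_measure R) mu) (@tuple_cons m).

HB.instance Definition _ := Measure.copy next_measure
  (measure_function_pushforward__canonical__measure_function_Measure
    (product_measure1 (@lebesgue_measure R) mu) (@measurable_tuple_cons m)).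

Lemma next_measure_box k : (next_measure (box k) < +oo)%E.
Proof.
rewrite /next_measure /pushforward box_cons.
rewrite product_measure1E //; last exact: measurable_box.
apply: lte_mul_pinfty (mubox k) => //.
have E : lebesgue_measure `[- k%:R, k%:R] \is a @fin_num R.
  by rewrite lebesgue_measure_itv; case: ifP.
exact: E.
Qed.

Let next_sigma_finite : sigma_finite setT next_measure.
Proof.
exists (@box m.+1); first by rewrite bigcup_box.
by move=> k; split; [exact: measurable_box|exact: next_measure_box].
Qed.
HB.instance Definition _ := Measure_isSigmaFinite.Build _ _ _ next_measure
  next_sigma_finite.

Definition next_sigma_finite_measure :
  {sigma_finite_measure set (m.+1.-tuple mR) -> \bar R} := next_measure.

End NextMeasure.

(** The recursive definition gives a bare set function. The induction supplies the sigma-finite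
    measure structure needed for Fubini, and finiteness on boxes for integrability. *)
Lemma lebesgue_tupleP m :
  exists mu : {sigma_finite_measure set (m.-tuple mR) -> \bar R},
    (mu : set _ -> \bar R) = @lebesgue_tuple R m /\ forall k, (mu (box k) < +oo)%E.
Proof.
elim: m => [|m [mu [Emu mubox]]].
  exists (\d_([tuple] : 0.-tuple mR)); split=> // k.
  by rewrite /= diracE; case: (_ \in _); rewrite ltry.
exists (next_sigma_finite_measure mubox); split=> [|k]; last exact: next_measure_box.
by rewrite /= -Emu.
Qed.

End LebesgueTuple.

Lemma bounded_integrable d (T : measurableType d) (R : realType)
    (mu : {measure set T -> \bar R}) (F : T -> R) (D : set T) (k : nat) :
  measurable_fun setT F -> measurable D -> (mu D < +oo)%E ->
  (forall t, (F t != 0 -> D t) /\ `|F t| <= k%:R) ->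
  mu.-integrable setT (EFin \o F).
Proof.
move=> mF mD Doo FD.
apply: (@le_integrable _ _ _ _ _ measurableT _ (fun t => k%:R%:E * (\1_D t)%:E)%E).
- exact/measurable_EFinP.
- move=> t _ /=; have [FDt Fk] := FD t.
  rewrite lee_fin normrM (ger0_norm (ler0n _ _)) indicE.
  have [tD|tD] := boolP (t \in D); first by rewrite normr1 mulr1.
  rewrite normr0 mulr0 normr_le0; apply: contraNT tD => F0.
  by rewrite inE; exact: FDt.
apply: integrableZl => //; apply/integrableP; split.
  by apply/measurable_EFinP; exact: measurable_indic.
under eq_integral => t _ do rewrite gee0_abs ?lee_fin //.
by rewrite integral_indic // setIT.
Qed.

(** * Fubini for bounded measurable functions vanishing off a box *)

Section BoxBounded.
Variable R : realType.
Local Open Scope classical_set_scope.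
Local Notation mR := (measurableTypeR R).
Local Notation leb := (@lebesgue_measure R).

(** A class of integrable functions that is stable under freezing a coordinate, so that induction on
    the dimension goes through. *)
Definition box_bounded m (F : m.-tuple mR -> R) : Prop :=
  measurable_fun setT F /\
  exists k : nat, forall t, (F t != 0 -> box k t) /\ `|F t| <= k%:R.

Definition replace m (s : 'I_m) (x : R) (t : m.-tuple mR) : m.-tuple mR :=
  [tuple if i == s then x else tnth t i | i < m].

Lemma replace_cons0 m x y (t : m.-tuple mR) :
  replace ord0 x (tuple_cons (y, t)) = tuple_cons (x, t).
Proof.
apply: eq_from_tnth => i; rewrite tnth_mktuple.
case: (unliftP ord0 i) => [j ->|->]; last by rewrite eqxx tnth_tuple_cons0.
by rewrite !tnth_tuple_consS.
Qed.

Lemma replace_consS m (s : 'I_m) x y (t : m.-tuple mR) :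
  replace (lift ord0 s) x (tuple_cons (y, t)) = tuple_cons (y, replace s x t).
Proof.
apply: eq_from_tnth => i; rewrite tnth_mktuple.
case: (unliftP ord0 i) => [j ->|->].
  by rewrite !tnth_tuple_consS tnth_mktuple (inj_eq lift_inj).
by rewrite !tnth_tuple_cons0 (negbTE (neq_lift _ _)).
Qed.

Lemma box_bounded_slice m (F : m.+1.-tuple mR -> R) x :
  box_bounded F -> box_bounded (fun t => F (tuple_cons (x, t))).
Proof.
move=> [mF [k Fk]]; split.
  have mg : measurable_fun setT (fun t : m.-tuple mR => tuple_cons (x, t)).
    apply: (@measurable_cons _ _ _ _ (fun=> x) m id); first exact: measurable_cst.
    exact: measurable_id.
  exact: measurableT_comp mF mg.
exists k => t; have [Fbox Fle] := Fk (tuple_cons (x, t)); split=> // F0.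
by have := Fbox F0; rewrite -[box k _]/((@tuple_cons R m @^-1` box k) (x, t)) box_cons => -[].
Qed.

Lemma box_bounded_integrable m (F : m.-tuple mR -> R)
    (mu : {measure set (m.-tuple mR) -> \bar R}) :
  (forall k, (mu (box k) < +oo)%E) -> box_bounded F -> mu.-integrable setT (EFin \o F).
Proof.
move=> mubox [mF [k Fk]].
exact: (@bounded_integrable _ _ _ mu F (box k) k mF (@measurable_box R m k) (mubox k) Fk).
Qed.

Lemma integral_tuple_cons m (mu : {sigma_finite_measure set (m.-tuple mR) -> \bar R})
    (F : m.+1.-tuple mR -> R) :
  (mu : set _ -> \bar R) = @lebesgue_tuple R m -> (forall k, (mu (box k) < +oo)%E) ->
  box_bounded F ->
  (\int[@lebesgue_tuple R m.+1]_t (F t)%:E =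
    \int[leb]_x \int[@lebesgue_tuple R m]_t (F (tuple_cons (x, t)))%:E)%E /\
  (\int[@lebesgue_tuple R m.+1]_t (F t)%:E =
    \int[@lebesgue_tuple R m]_t \int[leb]_x (F (tuple_cons (x, t)))%:E)%E.
Proof.
move=> Emu mubox [mF [k Fk]].
pose G p := (F (@tuple_cons R m p))%:E.
have iG : (leb \x mu)%E.-integrable setT G.
  apply: (@bounded_integrable _ _ _ _ (fun p => F (tuple_cons p)) (@tuple_cons R m @^-1` box k) k).
  - exact: measurableT_comp mF (@measurable_tuple_cons R m).
  - rewrite -[X in measurable X]setTI; apply: measurable_tuple_cons => //.
    exact: measurable_box.
  - exact: (next_measure_box mubox).
  - by move=> p; exact: Fk.
have -> : (\int[@lebesgue_tuple R m.+1]_t (F t)%:E = \int[leb \x mu]_p G p)%E.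
  rewrite (_ : @lebesgue_tuple R m.+1 = pushforward (leb \x mu)%E (@tuple_cons R m)).
    rewrite integral_pushforward ?preimage_setT //; first exact: measurable_tuple_cons.
    exact/measurable_EFinP.
  by rewrite /= -Emu.
rewrite -Emu; split.
  by rewrite -(integral12_prod_meas1 iG).
by rewrite -(integral21_prod_meas1 iG).
Qed.

(** If [s] is the first coordinate, Fubini integrates it innermost; otherwise it freezes the first
    coordinate and recurses on the remaining ones. *)
Lemma integral_tuple_eq0 m (s : 'I_m) (F : m.-tuple mR -> R) : box_bounded F ->
  (forall t, \int[leb]_x (F (replace s x t))%:E = 0)%E ->
  (\int[@lebesgue_tuple R m]_t (F t)%:E = 0)%E.
Proof.
elim: m s F => [[]//|m IHm] s F FB F0.
have [mu [Emu mubox]] := lebesgue_tupleP R m.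
have [E1 E2] := integral_tuple_cons Emu mubox FB.
case: (unliftP ord0 s) F0 => [j ->|->] F0.
  rewrite E1; apply: integral0_eq => x _; apply: (IHm j); first exact: box_bounded_slice.
  move=> t; rewrite -(F0 (tuple_cons (x, t))); apply: eq_integral => y _.
  by rewrite replace_consS.
rewrite E2 -Emu; apply: integral0_eq => t _.
rewrite -(F0 (tuple_cons (0, t))); apply: eq_integral => x _.
by rewrite replace_cons0.
Qed.

End BoxBounded.

(** * Measurability and bounds for continuous functions with compact support *)

Section CompactSupport.
Variables (R : realType) (n : nat).
Local Open Scope classical_set_scope.
Local Notation mR := (measurableTypeR R).
Local Notation point := (@point_of_tuple R n).
Implicit Types (g : Cn R n -> R) (K : set (Cn R n)).

Lemma compact_image_bound g K : compact K -> continuous g ->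
  exists k : nat, forall z, K z -> `|g z| <= k%:R.
Proof.
move=> cK cg; have : compact (g @` K).
  by apply: continuous_compact => //; exact: continuous_subspaceT.
move=> /compact_bounded[M [Mreal MK]].
exists (Num.truncn (M + 1)).+1 => z Kz.
have H : `|g z| <= M + 1 by apply: (MK (M + 1)); [rewrite ltrDl|exists z].
exact: (le_trans H (ltW (truncnS_gt _))).
Qed.

Definition floor_tuple m (k : nat) (t : m.-tuple mR) : m.-tuple int :=
  [tuple Num.floor (k.+1%:R * tnth t i : R) | i < m].

(** Integer tuples are countable, and each fibre is a half-open cube. *)
Lemma measurable_floor_tuple m k (B : set (m.-tuple int)) :
  measurable (@floor_tuple m k @^-1` B).
Proof.
pose F z := if `[< B z >] then @floor_tuple m k @^-1` [set z] else set0.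
have -> : @floor_tuple m k @^-1` B = \bigcup_z F z.
  apply/seteqP; split=> [t /= Bt|t [z _]].
    by exists (floor_tuple k t) => //; rewrite /F asboolT.
  by rewrite /F; case: asboolP => // Bz /= ->.
apply: countable_bigcupT_measurable => [|z]; first exact: countableP.
rewrite /F; case: asboolP => _; last exact: measurable0.
pose c : R := k.+1%:R; have c0 : 0 < c by rewrite ltr0n.
have -> : @floor_tuple m k @^-1` [set z] =
    \bigcap_(i in [set: 'I_m]) ((@tnth m mR)^~ i @^-1`
       `[(tnth z i)%:~R / c, (tnth z i + 1)%:~R / c[).
  apply/seteqP; split=> [t <- i _ /=|t H /=].
    rewrite in_itv /= tnth_mktuple ler_pdivrMr // ltr_pdivlMr // mulrC.
    exact: floor_itv.
  apply: eq_from_tnth => i; rewrite tnth_mktuple; apply: floor_def.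
  have /= := H i I; rewrite in_itv /= ler_pdivrMr // ltr_pdivlMr //.
  by rewrite mulrC.
apply: fin_bigcap_measurable => [|i _]; first exact: finite_finset.
by rewrite -[X in measurable X]setTI; apply: measurable_tnth.
Qed.

Definition lattice_point m (k : nat) (z : m.-tuple int) : m.-tuple mR :=
  [tuple (tnth z i)%:~R / k.+1%:R | i < m].

Lemma lattice_approx m k (t : m.-tuple mR) i :
  `|tnth t i - tnth (lattice_point k (floor_tuple k t)) i| <= k.+1%:R^-1.
Proof.
rewrite !tnth_mktuple; pose c : R := k.+1%:R; have c0 : 0 < c by rewrite ltr0n.
have /andP[l u] := floor_itv (c * tnth t i); rewrite intrD in u.
move: (tnth t i) (Num.floor _) l u => y f l u.
have -> : y - f%:~R / c = (c * y - f%:~R) / c.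
  by rewrite mulrBl mulrAC mulfV ?mul1r // gt_eqF.
rewrite -/c ger0_norm; last by rewrite divr_ge0 ?subr_ge0 // ltW.
rewrite ler_pdivrMr // mulVf ?gt_eqF // lerBlDl; exact: ltW.
Qed.

(** The tuples carry the product sigma-algebra. Continuity makes [g] the pointwise limit of its
    values at lattice points of mesh 1/(k+1), and these are measurable because they factor through
    the integer tuple of floors. *)
Lemma measurable_continuous_point g : continuous g -> measurable_fun setT (g \o point).
Proof.
move=> cg; pose h k t := g (point (lattice_point k (floor_tuple k t))).
apply: (@measurable_fun_cvg _ _ _ _ h).
  move=> k _ Y mY; rewrite setTI.
  exact: (@measurable_floor_tuple _ k [set z | Y (g (point (lattice_point k z)))]).
move=> t _; apply: continuous_cvg; first exact: cg.
apply/cvg_ballP => e e0.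
near=> k.
have H i : `|tnth t i - tnth (lattice_point k (floor_tuple k t)) i| < e.
  apply: le_lt_trans (lattice_approx _ _ _) _.
  by near: k; exact: (near_infty_natSinv_lt (PosNum e0)).
by split; split=> // i j; rewrite !mxE; exact: H.
Unshelve. all: by end_near. Qed.

Lemma continuous_coord_l j : continuous (fun z : Cn R n => z.1 0 j).
Proof.
move=> z; apply: (@continuous_comp _ _ _ fst (fun v : 'rV[R]_n => v 0 j)).
  exact: cvg_fst.
exact: coord_continuous.
Qed.

Lemma continuous_coord_r j : continuous (fun z : Cn R n => z.2 0 j).
Proof.
move=> z; apply: (@continuous_comp _ _ _ snd (fun v : 'rV[R]_n => v 0 j)).
  exact: cvg_snd.
exact: coord_continuous.
Qed.

Lemma box_bounded_continuous g K : compact K -> continuous g ->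
  (forall z, ~ K z -> g z = 0) -> box_bounded (g \o point).
Proof.
move=> cK cg gK; split; first exact: measurable_continuous_point.
have [k0 Hk0] := compact_image_bound cK cg.
have /choice[kl Hl] : forall j : 'I_n, exists k : nat, forall z, K z -> `|z.1 0 j| <= k%:R.
  by move=> j; apply: compact_image_bound => //; exact: continuous_coord_l.
have /choice[kr Hr] : forall j : 'I_n, exists k : nat, forall z, K z -> `|z.2 0 j| <= k%:R.
  by move=> j; apply: compact_image_bound => //; exact: continuous_coord_r.
pose k := maxn k0 (maxn (\max_j kl j) (\max_j kr j)).
have KP z : g z != 0 -> K z.
  by move=> gz; have [//|/gK g0] := pselect (K z); rewrite g0 eqxx in gz.
exists k => t; split=> [/KP Kt i|] /=.
  case: (split_ordP i) => j ->.
    have := Hl j _ Kt; rewrite mxE => /le_trans; apply; rewrite ler_nat /k.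
    by rewrite !leq_max (leq_bigmax j) ?orbT.
  have := Hr j _ Kt; rewrite mxE => /le_trans; apply; rewrite ler_nat /k.
  by rewrite !leq_max (leq_bigmax j) ?orbT.
have [->|/KP /Hk0 /le_trans] := eqVneq (g (point t)) 0; first by rewrite normr0.
by apply; rewrite ler_nat leq_maxl.
Qed.

Lemma point_replace (s : 'I_(n + n)) x t :
  point (replace s x t) = point (replace s 0 t) + x *: coord_dir R (fintype.split s).
Proof.
rewrite /point_of_tuple; case: (split_ordP s) => j -> /=.
  congr (_, _).
    apply/rowP => i; rewrite !mxE !tnth_mktuple eq_lshift eqxx /=.
    by case: eqP => _; rewrite ?mulr1 ?add0r ?mulr0 ?addr0.
  by apply/rowP => i; rewrite !mxE !tnth_mktuple eq_rlshift mulr0 addr0.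
congr (_, _).
  by apply/rowP => i; rewrite !mxE !tnth_mktuple eq_lrshift mulr0 addr0.
apply/rowP => i; rewrite !mxE !tnth_mktuple eq_rshift eqxx /=.
by case: eqP => _; rewrite ?mulr1 ?add0r ?mulr0 ?addr0.
Qed.

Lemma integral_derivative_eq0 (h h' : R -> R) (k : nat) : continuous h' ->
  (forall x : R, is_derive x 1 h (h' x)) ->
  (forall x, k%:R < `|x| -> h x = 0) -> (forall x, k%:R < `|x| -> h' x = 0) ->
  (\int[@lebesgue_measure R]_x (h' x)%:E = 0)%E.
Proof.
(* The endpoints - (k+1) and k+1 lie strictly beyond the bound, so [h] vanishes at both. *)
move=> ch' dh hk h'k; pose a : R := k.+1%:R.
have a0 : 0 < a by rewrite ltr0n.
have ka : k%:R < a by rewrite ltr_nat.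
have ch x : {for x, continuous h}.
  by apply/differentiable_continuous/derivable1_diffP; case: (dh x).
have E : (\int[@lebesgue_measure R]_x (h' x)%:E =
    \int[@lebesgue_measure R]_(x in `[(- a)%R, a]) (h' x)%:E)%E.
  rewrite [RHS]integral_mkcond; apply: eq_integral => x _; rewrite patchE.
  case: ifPn => // xa; congr _%:E; apply: h'k; apply: (lt_le_trans ka).
  move: xa; rewrite notin_setE /= in_itv /= -ler_norml => /negP.
  by rewrite -ltNge => /ltW.
rewrite E (@continuous_FTC2 _ h' h (- a) a).
- by rewrite !hk ?normrN ?(gtr0_norm a0) // subee.
- by rewrite gtrN.
- exact: continuous_subspaceT.
- split=> [x _||]; first by case: (dh x).
    exact: cvg_at_right_filter (ch _).
  exact: cvg_at_left_filter (ch _).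
- by move=> x _; rewrite derive1E; exact: (@derive_val _ _ _ _ _ _ _ (dh x)).
Qed.

End CompactSupport.

(** * Integrals of derivatives supported in a compact set *)

Section Integration.
Variables (R : realType) (n : nat) (K : set (Cn R n)).
Local Open Scope classical_set_scope.
Hypothesis cK : compact K.
Hypothesis clK : closed K.
Local Notation A := (smooth_fun R n).
Local Notation point := (@point_of_tuple R n).
Implicit Types (x y v : A) (f g : Cn R n -> R).

Let zero_outside f : Prop := forall z, ~ K z -> f z = 0.

Lemma zero_outside_integrable f (mu : {measure set ((n + n).-tuple (measurableTypeR R)) -> \bar R}) :
  (forall k, (mu (box k) < +oo)%E) -> continuous f -> zero_outside f ->
  mu.-integrable setT (EFin \o (f \o point)).
Proof.
move=> mubox cf f0; apply: box_bounded_integrable => //.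
exact: box_bounded_continuous cK cf f0.
Qed.

Lemma real_integralDZ a f g : continuous f -> continuous g ->
  zero_outside f -> zero_outside g ->
  real_integral (fun z => a * f z + g z) = a * real_integral f + real_integral g.
Proof.
move=> cf cg f0 g0; have [mu [Emu mubox]] := lebesgue_tupleP R (n + n).
have iF := zero_outside_integrable mubox cf f0.
have iG := zero_outside_integrable mubox cg g0.
rewrite /real_integral -Emu.
rewrite -[LHS]/(Rintegral mu setT (fun t => a * (f \o point) t + (g \o point) t)).
rewrite -[X in a * X]/(Rintegral mu setT (f \o point)).
rewrite -[X in _ + X]/(Rintegral mu setT (g \o point)).
rewrite RintegralD // ?RintegralZl //.
exact: (integrableZl _ a iF).
Qed.

Lemma zero_outside_derive f s : zero_outside f ->
  zero_outside ('D_(coord_dir R s) f).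
Proof.
move=> f0 z Kz; rewrite -(derive_cst 0 z (coord_dir R s)); apply: near_eq_derive.
have : nbhs z (~` K) by apply: open_nbhs_nbhs; split=> //; exact: closed_openC.
by apply: filterS => w; exact: f0.
Qed.

(** Integrating first along the coordinate line in direction s gives zero on every line by the
    fundamental theorem of calculus. *)
Lemma real_integral_derive f s : smooth_real f -> zero_outside f ->
  real_integral ('D_(coord_dir R s) f) = 0.
Proof.
move=> sf f0; have sDf := smooth_real_derive s sf.
have cDf := smooth_real_cont sDf.
have Df0 := zero_outside_derive s f0.
rewrite /real_integral (integral_tuple_eq0 (s := unsplit s) (F := 'D_(coord_dir R s) f \o point)) //.
  exact: box_bounded_continuous cK cDf Df0.
have [_ [k1 Hk1]] := box_bounded_continuous cK (smooth_real_cont sf) f0.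
have [_ [k2 Hk2]] := box_bounded_continuous cK cDf Df0.
move=> t; pose v := coord_dir R s; pose p := point (replace (unsplit s) 0 t).
have line (x : R) : point (replace (unsplit s) x t) = p + x *: v.
  by rewrite point_replace unsplitK.
have far (g : Cn R n -> R) k : (forall t, (g \o point) t != 0 -> box k t) ->
    forall x : R, k%:R < `|x| -> g (p + x *: v) = 0.
  move=> gk x; apply: contraTeq => gx; rewrite -leNgt -line in gx *.
  by have := gk _ gx (unsplit s); rewrite tnth_mktuple eqxx.
have dline (g : Cn R n -> R) : smooth_real g -> forall x : R,
    is_derive x 1 (fun x : R => g (p + x *: v)) ('D_v g (p + x *: v)).
  by move=> sg x; apply: is_derive_line; exact: smooth_real_derivable.
under eq_integral => x _ do rewrite /= line.
apply: (@integral_derivative_eq0 R (fun x : R => f (p + x *: v))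
  (fun x : R => 'D_v f (p + x *: v)) (maxn k1 k2)).
- move=> x; apply/differentiable_continuous/derivable1_diffP.
  by have [] := dline _ sDf x.
- exact: dline.
- move=> x kx; apply: (far f k1) => [u|]; first by case: (Hk1 u).
  by apply: le_lt_trans kx; rewrite ler_nat leq_maxl.
- move=> x kx; apply: (far ('D_v f) k2) => [u|]; first by case: (Hk2 u).
  by apply: le_lt_trans kx; rewrite ler_nat leq_maxr.
Qed.

Definition supported x : Prop := forall z, ~ K z -> x z = 0.

Lemma supported0 : supported 0. Proof. by []. Qed.

Lemma supportedD x y : supported x -> supported y -> supported (x + y).
Proof. by move=> x0 y0 z Kz; rewrite sfunDE x0 ?y0 ?addr0. Qed.

Lemma supportedM x y : supported y -> supported (x * y).
Proof. by move=> y0 z Kz; rewrite sfunME y0 ?mulr0. Qed.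

Let supportedRe x : supported x -> zero_outside (fun z => complex.Re (x z)).
Proof. by move=> x0 z Kz; rewrite x0. Qed.

Let supportedIm x : supported x -> zero_outside (fun z => complex.Im (x z)).
Proof. by move=> x0 z Kz; rewrite x0. Qed.

Definition partialA s x : A := mk_smooth (smooth_partial s (sfunP x)).

Lemma supported_partial s x : supported x -> supported (partialA s x).
Proof.
move=> x0 z Kz; apply: complexP.
  exact: (zero_outside_derive s (supportedRe x0) Kz).
exact: (zero_outside_derive s (supportedIm x0) Kz).
Qed.

Lemma holder_partial s x : exists c i,
  holder s x = sfun_cst _ 2%:R^-1 * (partialA (inl i) x + sfun_cst _ c * partialA (inr i) x).
Proof.
case: (split_ordP s) => i ->.
  exists (- 'i%C), i; apply: sfun_ext => z; rewrite holder_l dzE /wirtinger sfunME mulrC.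
  by rewrite sfunDE sfunME.
exists 'i%C, i; apply: sfun_ext => z; rewrite holder_r dzbarE /wirtinger sfunME mulrC.
by rewrite sfunDE sfunME.
Qed.

Lemma supported_holder s x : supported x -> supported (holder s x).
Proof.
move=> x0; have [c [i ->]] := holder_partial s x.
apply: supportedM; apply: supportedD; last apply: supportedM.
  exact: supported_partial.
exact: supported_partial.
Qed.

Lemma cplx_integralDZ c x y : supported x -> supported y ->
  cplx_integral (fun z => c * x z + y z) = c * cplx_integral x + cplx_integral y.
Proof.
move=> x0 y0; have [rx jx] := sfunP x; have [ry jy] := sfunP y.
have cr := smooth_real_cont rx; have cj := smooth_real_cont jx.
have cry := smooth_real_cont ry; have cjy := smooth_real_cont jy.
have zr := supportedRe x0; have zj := supportedIm x0.
have zry := supportedRe y0; have zjy := supportedIm y0.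
rewrite /cplx_integral.
rewrite (_ : (fun z => complex.Re (c * x z + y z)) = fun z =>
  complex.Re c * complex.Re (x z) + (- complex.Im c * complex.Im (x z) + complex.Re (y z))); last first.
  by apply/funext => z; rewrite ReD ReM mulNr addrA.
rewrite (_ : (fun z => complex.Im (c * x z + y z)) = fun z =>
  complex.Re c * complex.Im (x z) + (complex.Im c * complex.Re (x z) + complex.Im (y z))); last first.
  by apply/funext => z; rewrite ImD ImM addrA.
have cont2 a (u w : Cn R n -> R) : continuous u -> continuous w -> continuous (fun z => a * u z + w z).
  move=> cu cw z; apply: cvgD; last exact: cw.
  by apply: cvgM; [exact: cvg_cst|exact: cu].
have zero2 a (u w : Cn R n -> R) : zero_outside u -> zero_outside w -> zero_outside (fun z => a * u z + w z).
  by move=> zu zw z Kz; rewrite zu ?zw // mulr0 addr0.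
rewrite !real_integralDZ //; try by [exact: cont2|exact: zero2].
by apply: complexP; rewrite !(ReD, ImD, ReM, ImM) /=; ring.
Qed.

Lemma cplx_integralD x y : supported x -> supported y ->
  cplx_integral (x + y) = cplx_integral x + cplx_integral y.
Proof.
move=> x0 y0; rewrite -[in RHS](mul1r (cplx_integral x)) -cplx_integralDZ //.
by congr cplx_integral; apply/funext => z; rewrite mul1r.
Qed.

Lemma cplx_integral_partial s x : supported x -> cplx_integral (partialA s x) = 0.
Proof.
move=> x0; have [rx jx] := sfunP x.
exact: (congr2 (@Complex R) (real_integral_derive s rx (supportedRe x0))
                            (real_integral_derive s jx (supportedIm x0))).
Qed.

Lemma cplx_integral0 : cplx_integral (0 : A) = 0.
Proof.
have := cplx_integralD supported0 supported0; rewrite addr0 => /eqP.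
by rewrite -[X in X == _]addr0 (inj_eq (addrI _)) eq_sym => /eqP.
Qed.

Lemma cplx_integral_holder s x : supported x -> cplx_integral (holder s x) = 0.
Proof.
move=> x0; have [c [i ->]] := holder_partial s x.
have sl := supported_partial (inl i) x0; have sr := supported_partial (inr i) x0.
have E1 : cplx_integral (sfun_cst _ c * partialA (inr i) x + partialA (inl i) x : A) = 0.
  rewrite -[sfun _]/(fun z => c * partialA (inr i) x z + partialA (inl i) x z).
  by rewrite cplx_integralDZ // !cplx_integral_partial // mulr0 addr0.
rewrite [_ + _]addrC; set y := (_ + _ : A) in E1 *.
have sy : supported y by apply: supportedD => //; exact: supportedM.
rewrite -[LHS]/(cplx_integral (fun z => 2%:R^-1 * y z)).
have := cplx_integralDZ 2%:R^-1 sy supported0.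
rewrite E1 cplx_integral0 mulr0 addr0 => <-.
by congr cplx_integral; apply/funext => z; rewrite addr0.
Qed.

Lemma supported_sum (I : Type) (r : seq I) (P : pred I) (F : I -> A) :
  (forall i, P i -> supported (F i)) -> supported (\sum_(i <- r | P i) F i).
Proof. by move=> FP; elim/big_ind: _ => // *; exact: supportedD. Qed.

(** The support is tracked together with the integral, because additivity of the integral along the
    sum needs integrable terms. *)
Lemma divergence_supported x :
  divergence (@wder R n) supported x -> supported x /\ cplx_integral x = 0.
Proof.
move=> [v v0 ->].
have H (r : seq 'I_(n + n)) : supported (\sum_(s <- r) @wder R n s (v s)) /\
    cplx_integral (\sum_(s <- r) @wder R n s (v s) : A) = 0.
  elim: r => [|s r [IH1 IH2]]; first by rewrite big_nil; split; [|exact: cplx_integral0].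
  have sh : supported (@wder R n s (v s)) by exact: supported_holder (v0 s).
  rewrite big_cons; split; first exact: supportedD.
  by rewrite cplx_integralD // IH2 addr0; exact: cplx_integral_holder.
exact: H.
Qed.

End Integration.

(** * Transfer to series of functions *)

Section Series.
Variables (R : realType) (n : nat).
Local Notation A := (smooth_fun R n).
Implicit Types (a b c e : fps A).

(** Forgets the bundled smoothness proofs. Every operation of the statement is the image of a ring
    operation, so identities, and smoothness of the results, come for free. *)
Definition lower a : hseries R n := fun k => a k.

Lemma lowerP (a : hseries R n) : smooth_series a -> exists a', a = lower a'.
Proof. by move=> sa; exists (fun k => mk_smooth (sa k)). Qed.

Lemma lower_smooth a : smooth_series (lower a).
Proof. by move=> k; exact: sfunP. Qed.

Lemma lower_inj a b : lower a = lower b -> a = b.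
Proof.
move=> ab; apply/funext => k; apply: sfun_ext => z.
exact: (congr1 (fun u : hseries R n => u k z) ab).
Qed.

Lemma lower_mul a b : hmul (lower a) (lower b) = lower (a * b).
Proof.
apply/funext => k; apply/funext => z.
rewrite -[RHS]/(sfun_eval z ((a * b) k)).
exact: (@map_fps_mul _ _ (sfun_eval z) _ _ a b k).
Qed.

Lemma lower_inv e : e 0%N = 1 -> hinv (lower e) = lower (geom e).
Proof.
move=> e0; apply/funext => k; apply/funext => z.
rewrite /hinv /fps_inv -[RHS]/(sfun_eval z (geom e k)) /geom rmorph_sum.
apply: eq_bigr => m _; rewrite -[lower e 0%N z]/(sfun_eval z (e 0%N)) e0 rmorph1.
rewrite expr1n invr1 mul1r; apply: map_fps_pow => j.
by rewrite fpsDE fpsNE fps_oneE rmorphB; case: eqP => // _; rewrite rmorph0.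
Qed.

Lemma lower_cst (x : A) : hconst x = lower (fcst x).
Proof. by apply/funext => k; apply/funext => z; rewrite /hconst /lower /fcst; case: eqP. Qed.

Lemma lower_lin (c : R[i]) a b :
  hlin c (lower a) (lower b) = lower (fcst (sfun_cst n c) * a + b).
Proof.
by apply/funext => k; apply/funext => z; rewrite /lower fpsDE fcstM sfunDE sfunME.
Qed.

Lemma wder_cst (s : 'I_(n + n)) (c : R[i]) : @wder R n s (sfun_cst n c) = 0.
Proof.
apply: sfun_ext => z.
have E t : real_partial t (sfun_cst n c) z = 0 by exact: real_partial_cst.
have W (w : R[i]) i : wirtinger w i (sfun_cst n c) z = 0.
  by rewrite /wirtinger !E mulr0 addr0 mul0r.
case: (split_ordP s) => i ->.
  by rewrite -[LHS]/(holder (lshift n i) (sfun_cst n c) z) holder_l dzE W.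
by rewrite -[LHS]/(holder (rshift n i) (sfun_cst n c) z) holder_r dzbarE W.
Qed.

Variables (Phi : Cn R n -> R) (hPhi : kahler_potential Phi).
Local Notation prod := (prodA (@wder R n) (PhiA hPhi)).

Lemma lower_bullet a b : bullet Phi (lower a) (lower b) = lower (sprod prod a b).
Proof.
apply/funext => k; apply/funext => z.
rewrite /bullet -[RHS]/(sfun_eval z (sprod prod a b k)) /sprod /conv rmorph_sum.
apply: eq_bigr => i _ /=; rewrite rmorph_sum; apply: eq_bigr => j _ /=.
by rewrite bullet_funE.
Qed.

Lemma bullet_unit_series e : is_bullet_unit Phi (lower e) ->
  forall x, sprod prod e (fcst x) = fcst x /\ sprod prod (fcst x) e = fcst x.
Proof.
move=> [_ H] x; have [] := H x (sfunP x).
rewrite (lower_cst x) (lower_bullet e (fcst x)) (lower_bullet (fcst x) e).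
move=> El Er; split; first exact: (@lower_inj (sprod prod e (fcst x)) (fcst x) El).
exact: (@lower_inj (sprod prod (fcst x) e) (fcst x) Er).
Qed.

Lemma lower_star e a b : e 0%N = 1 ->
  star Phi (lower e) (lower a) (lower b) = lower (nstar (@wder R n) (PhiA hPhi) e a b).
Proof. by move=> e0; rewrite /star lower_inv // !lower_mul lower_bullet lower_mul. Qed.

End Series.

(** * The trace as an integral, and its symmetry *)

Section Trace.
Variables (R : realType) (n : nat).
Local Open Scope classical_set_scope.
Local Notation A := (smooth_fun R n).
Implicit Types (a b c e : fps A).

Lemma compact_series_support (f : hseries R n) k : compact_series f ->
  exists K : set (Cn R n), [/\ compact K, closed K &
    forall i, (i <= k)%N -> forall z, ~ K z -> f i z = 0].
Proof.
move=> cf.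
exists (\big[setU/set0]_(i < k.+1) closure [set z | f i z != 0]); split.
- by apply: bigsetU_compact => i _; case: (cf i).
- by apply: closed_bigsetU => i _; exact: closed_closure.
move=> i ik z Kz; apply/eqP/negPn/negP => fz; apply: Kz.
rewrite -(bigcup_mkord k.+1 (fun i => closure [set z | f i z != 0])); exists i => //=.
exact: subset_closure.
Qed.

Lemma supported_compact (K : set (Cn R n)) (f : Cn R n -> R[i]) :
  compact K -> closed K -> (forall z, ~ K z -> f z = 0) -> compactly_supported f.
Proof.
move=> cK clK fK; apply: (subclosed_compact _ cK); first exact: closed_closure.
rewrite [X in _ `<=` X](closure_id K).1 //; apply: closureS => z /= fz.
by have [//|/fK f0] := pselect (K z); rewrite f0 eqxx in fz.
Qed.

Variables (Phi : Cn R n -> R) (hPhi : kahler_potential Phi).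
Local Notation d := (@wder R n).
Local Notation prod := (prodA d (PhiA hPhi)).
Local Notation hdet := (hdet d (PhiA hPhi)).

Lemma trE e a m : tr Phi (lower e) (lower a) m =
  match m + n%:Z with
  | Posz k => ((pi : R) ^- n)%:C%C * cplx_integral (hdet * (e * a) k : A)
  | Negz _ => 0
  end.
Proof.
rewrite /tr lower_mul (det_metricE hPhi); case: (m + n%:Z) => // k.
by congr (_ * cplx_integral _); apply/funext => z; rewrite mulrC.
Qed.

Let natU := @sfun_natU R n.
Let dL (s : 'I_(n + n)) : leibniz (d s) := @holder_leibniz R n s.
Let dC (s t : 'I_(n + n)) (x : A) : d s (d t x) = d t (d s x) := @holder_comm R n s t x.
Let hU := hmatU hPhi.

Section Support.
Variable K : set (Cn R n).
Hypotheses (cK : compact K) (clK : closed K).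

Let supp0 := @supported0 R n K.
Let suppD := @supportedD R n K.
Let suppM := @supportedM R n K.
Let suppDer (s : 'I_(n + n)) (x : A) : supported K x -> supported K (d s x).
Proof. exact: supported_holder. Qed.

Lemma supported_sprod k a b : ideal_upto (supported K) k a ->
  supported K (sprod prod a b k).
Proof.
move=> Ia; have := ideal_upto_sprod (PhiA hPhi) supp0 suppD suppM suppDer b Ia.
by apply.
Qed.

(** The difference is a divergence with integral zero. Its support and that of u x bound the support
    of u y, which justifies splitting the integral. *)
Lemma integral_eq_divergence (u x y : A) : supported K (u * x) ->
  divergence d (supported K) (u * (x - y)) ->
  cplx_integral (u * x : A) = cplx_integral (u * y : A).
Proof.
move=> Sx /(divergence_supported cK clK)[]; rewrite mulrBr.
move: (u * x) (u * y) Sx => {}x {}y Sx Sxy Ixy.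
have Sy : supported K y.
  by rewrite -(subKr x y) -mulN1r; apply: suppD => //; exact: suppM.
by rewrite -[x in LHS](subrK y) (cplx_integralD cK) // Ixy add0r.
Qed.

Lemma integral_sprodC k a b : ideal_upto (supported K) k a ->
  cplx_integral (hdet * sprod prod a b k : A) = cplx_integral (hdet * sprod prod b a k : A).
Proof.
move=> Ia; apply: integral_eq_divergence.
  exact: suppM (supported_sprod b Ia).
exact: (sprod_trace natU dL dC hU supp0 suppD suppM suppDer b Ia).
Qed.

End Support.

End Trace.

(** * Assembly of the statement *)

Theorem proposition4p3 (R : realType) (n : nat) (Phi : Cn R n -> R)
    (hPhi : kahler_potential Phi) (e : hseries R n)
    (he : is_bullet_unit Phi e) :
  [/\ is_unital_assoc_algebra (@smooth_series R n) (star Phi e)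
        (hconst (fun=> 1)),
      (forall f1 f2 : Cn R n -> R[i], smooth f1 -> smooth f2 ->
         (forall z, star Phi e (hconst f1) (hconst f2) 0%N z = f1 z * f2 z) /\
         (forall z, star Phi e (hconst f1) (hconst f2) 1%N z =
            \sum_(i < n) \sum_(j < n)
              inv_metric Phi z i j * dzbar j f1 z * dz i f2 z)),
      (forall f, compact_series f -> is_laurent (tr Phi e f)),
      (forall (c : R[i]) (f g : hseries R n),
         compact_series f -> compact_series g ->
         forall m, tr Phi e (hlin c f g) m =
           c * tr Phi e f m + tr Phi e g m)
    & (forall f1 f2 : hseries R n, compact_series f1 -> compact_series f2 ->
         compact_series (star Phi e f1 f2) /\
         tr Phi e (star Phi e f1 f2) = tr Phi e (star Phi e f2 f1))].
Proof.
have natU := @sfun_natU R n.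
have dL s : leibniz (@wder R n s) := @holder_leibniz R n s.
have dC s t x : @wder R n s (@wder R n t x) = @wder R n t (@wder R n s x) :=
  @holder_comm R n s t x.
have dz_z i j : @wder R n (lshift n i) (@coordA R n j) = (i == j)%:R := @holder_coord R n i j.
have hU := hmatU hPhi.
have [e' Ee] := lowerP he.1; rewrite {}Ee in he *.
have unitP := bullet_unit_series hPhi he.
have e0 := unit_0 hU unitP.
pose nst := nstar (@wder R n) (PhiA hPhi) e'.
have Estar a b : star Phi (lower e') (lower a) (lower b) = lower (nst a b).
  exact: (lower_star hPhi a b e0).
have Eone : hconst (fun=> 1) = lower (1 : fps (smooth_fun R n)).
  by apply/funext => -[|k]; apply/funext.
(* The factor e in the trace undoes the normalization, which reduces cyclicity for the normalized
   product to cyclicity for the original one. *)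
have en a b : e' * nst a b = sprod (prodA (@wder R n) (PhiA hPhi)) (a * e') (b * e').
  by rewrite /nst /nstar /conj_prod mulrA mul_geom // mul1r.
split.
- rewrite Eone; split.
  + split; first exact: lower_smooth.
    move=> a b /lowerP[{}a ->] /lowerP[{}b ->]; rewrite Estar; exact: lower_smooth.
  + move=> c a b u /lowerP[{}a ->] /lowerP[{}b ->] /lowerP[{}u ->].
    rewrite lower_lin !Estar lower_lin; congr lower.
    by apply: nstar_linearl => // s; exact: wder_cst.
  + move=> c a b u /lowerP[{}a ->] /lowerP[{}b ->] /lowerP[{}u ->].
    rewrite lower_lin !Estar lower_lin; congr lower.
    by apply: nstar_linearr => // s; exact: wder_cst.
  + move=> a b u /lowerP[{}a ->] /lowerP[{}b ->] /lowerP[{}u ->].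
    rewrite (Estar b u) (Estar a (nst b u)) (Estar a b) (Estar (nst a b) u).
    exact: (congr1 (@lower R n) (nstarA natU dL dC hU dz_z unitP a b u)).
  + move=> a /lowerP[{}a ->]; rewrite (Estar 1 a) (Estar a 1); split.
      exact: (congr1 (@lower R n) (nstar1l hU unitP a)).
    exact: (congr1 (@lower R n) (nstar1r hU unitP a)).
- move=> f1 f2 sf1 sf2.
  have -> : hconst f1 = lower (fcst (mk_smooth sf1)) by exact: (lower_cst (mk_smooth sf1)).
  have -> : hconst f2 = lower (fcst (mk_smooth sf2)) by exact: (lower_cst (mk_smooth sf2)).
  rewrite Estar /lower; split=> z.
    by rewrite /nst (nstar_cst_0 hU unitP).
  rewrite /nst (nstar_cst_1 natU dL hU unitP) -[LHS]/(sfun_eval z _) rmorph_sum.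
  apply: eq_bigr => i _; rewrite rmorph_sum; apply: eq_bigr => j _ /=.
  rewrite (inv_metricE hPhi) mxE.
  exact: (congr2 *%R (congr2 *%R erefl (holder_r _ _ _)) (holder_l _ _ _)).
(* The volume form carries hbar^{-n}, so the trace starts at that order. *)
- move=> f _; exists (- n%:Z) => m; rewrite -[X in _ < X]sub0r ltrBrDr /tr.
  by case: (m + n%:Z).
- move=> c f g cf cg m.
  have [f' Ef] := lowerP (fun k => (cf k).1); have [g' Eg] := lowerP (fun k => (cg k).1).
  have key k : cplx_integral (hdet (@wder R n) (PhiA hPhi) *
        (e' * (fcst (sfun_cst n c) * f' + g')) k : smooth_fun R n) =
      c * cplx_integral (hdet (@wder R n) (PhiA hPhi) * (e' * f') k : smooth_fun R n) +
      cplx_integral (hdet (@wder R n) (PhiA hPhi) * (e' * g') k : smooth_fun R n).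
    have [K1 [cK1 clK1 fK1]] := compact_series_support k cf.
    have [K2 [cK2 clK2 gK2]] := compact_series_support k cg.
    have cK := compactU cK1 cK2; have clK := closedU clK1 clK2.
    have If : ideal_upto (supported (K1 `|` K2)%classic) k f'.
      by move=> i ik z Kz; rewrite -[f' i z]/(lower f' i z) -Ef fK1 // => K1z; apply: Kz; left.
    have Ig : ideal_upto (supported (K1 `|` K2)%classic) k g'.
      by move=> i ik z Kz; rewrite -[g' i z]/(lower g' i z) -Eg gK2 // => K2z; apply: Kz; right.
    have Sf : supported (K1 `|` K2)%classic
        (hdet (@wder R n) (PhiA hPhi) * (e' * f') k : smooth_fun R n).
      apply: supportedM.
      exact: (ideal_uptoM (@supported0 R n _) (@supportedD R n _) (@supportedM R n _) e' If (leqnn k)).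
    have Sg : supported (K1 `|` K2)%classic
        (hdet (@wder R n) (PhiA hPhi) * (e' * g') k : smooth_fun R n).
      apply: supportedM.
      exact: (ideal_uptoM (@supported0 R n _) (@supportedD R n _) (@supportedM R n _) e' Ig (leqnn k)).
    rewrite -(cplx_integralDZ cK c Sf Sg); congr cplx_integral; apply/funext => z.
    rewrite mulrDr mulrCA fpsDE fcstM !sfunME sfunDE sfunME mulrDr /=; congr (_ + _).
    by rewrite mulrCA.
  rewrite Ef Eg lower_lin !(trE hPhi); case: (m + n%:Z) => [k|k].
    by rewrite key mulrDr mulrCA.
  by rewrite mulr0 addr0.
- move=> f1 f2 cf1 cf2.
  have [a Ea] := lowerP (fun k => (cf1 k).1); have [b Eb] := lowerP (fun k => (cf2 k).1).
  (* A compact set is chosen for each order separately; it contains the supports of the coefficients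
     of [a e] up to that order. *)
  have supp k : exists K : set (Cn R n), [/\ compact K, closed K &
      ideal_upto (supported K) k (a * e')].
    have [K [cK clK fK]] := compact_series_support k cf1.
    exists K; split=> //; rewrite mulrC.
    apply: (ideal_uptoM (@supported0 R n _) (@supportedD R n _) (@supportedM R n _)).
    by move=> i ik z Kz; rewrite -[a i z]/(lower a i z) -Ea fK.
  rewrite Ea Eb !Estar; split.
    move=> k; split; first exact: lower_smooth.
    have [K [cK clK IK]] := supp k.
    apply: (supported_compact cK clK); rewrite -/(supported K (nst a b k)).
    have IS : ideal_upto (supported K) k
        (sprod (prodA (@wder R n) (PhiA hPhi)) (a * e') (b * e')).
      move=> i ik; apply: (supported_sprod _ clK) => j ji; apply: IK; exact: leq_trans ji ik.
    exact: (ideal_uptoM (@supported0 R n _) (@supportedD R n _) (@supportedM R n _)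
      (geom e') IS (leqnn k)).
  clearbody nst; apply/funext => m.
  rewrite (trE hPhi e' (nst a b) m) (trE hPhi e' (nst b a) m) (en a b) (en b a).
  case: (m + n%:Z) => [k|k]; last by reflexivity.
  have [K [cK clK IK]] := supp k.
  exact: (congr1 ( *%R _) (integral_sprodC hPhi cK clK (b * e') IK)).
Qed.
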